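(* Let $\xi$ be a random variable with values in $\{0,1,2,\dots\}$ with $\mathbb E\xi=1$ and $0<\operatorname{Var}\xi<\infty$. There exist positive constants $C$, $\beta$, $\delta$ (with $0<\beta<\pi/2$), depending only on the distribution of $\xi$, such that for all $n\ge1$ with $\mathbb P(|\mathcal T|=n)>0$, the function $$h_n(x,y):=\mathbb E\sum_{v,w\in T_n} x^{d(v,v\wedge w)}\,y^{d(w,v\wedge w)}$$ satisfies $$|h_n(x,y)|\le C\,n\,|1-x|^{-1}\,|1-y|^{-1},\qquad x,y\in\Delta(\beta,\delta).$$
   Context: $\mathcal T$ is the Galton--Watson tree with offspring distribution $\xi$: the random rooted tree which is the family tree of the Galton--Watson process, started with one individual (the root), in which each individual has a number of children distributed as $\xi$, independently. $|\mathcal T|$ is its number of vertices. For $n$ with $\mathbb P(|\mathcal T|=n)>0$, the conditioned Galton--Watson tree $T_n$ is $\mathcal T$ conditioned on $|\mathcal T|=n$. For vertices $v,w$ of a rooted tree, $v\wedge w$ is their last common ancestor (a vertex counts as an ancestor of itself), and $d$ is graph distance. The sum is over all ordered pairs $(v,w)$ of vertices of $T_n$, including $v=w$. For $0<\beta<\pi/2$ and $\delta>0$, $$\Delta(\beta,\delta):=\{z\in\mathbb C: |z|<1+\delta,\ z\ne1,\ |\arg(z-1)|>\pi/2-\beta\},$$ with $\arg$ taking values in $(-\pi,\pi]$. *)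

(* Defs.v *)
From HB Require Import structures.
From mathcomp Require Import all_boot all_order all_algebra.
From mathcomp Require Import all_classical all_reals all_analysis.
From mathcomp Require Export complex.

Set Implicit Arguments.
Unset Strict Implicit.
Unset Printing Implicit Defensive.

Import Order.TTheory GRing.Theory Num.Theory.

Local Open Scope classical_set_scope.
Local Open Scope ring_scope.
Local Open Scope complex_scope.

(** Graph distance: the least length of a walk (junk value 0 if there is none) *)

Definition walk (V : eqType) (e : rel V) (u v : V) (k : nat) : Prop :=
  exists2 p : seq V, path e u p & last u p = v /\ size p = k.

Definition graph_dist (V : eqType) (e : rel V) (u v : V) : nat :=
  xget 0%N [set k | walk e u v k /\ forall j, walk e u v j -> (k <= j)%N].

(** Individuals carry Ulam-Harris labels: the root is [::] and the children of
    u are rcons u 0, rcons u 1, ...  Hence "u is an ancestor of v (or v itself)"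
    is [prefix u v]. *)

Definition label := seq nat.

Inductive family_tree (c : label -> nat) : label -> Prop :=
| family_root : family_tree c [::]
| family_child u i :
    family_tree c u -> (i < c u)%N -> family_tree c (rcons u i).

Definition tree_edge (t : set label) : rel label := fun u v =>
  `[< [/\ t u, t v & exists i, v = rcons u i \/ u = rcons v i] >].

Definition tree_dist (t : set label) : label -> label -> nat :=
  graph_dist (tree_edge t).

Fixpoint lca (v w : label) : label :=
  match v, w with
  | i :: v', j :: w' => if i == j then i :: lca v' w' else [::]
  | _, _ => [::]
  end.

Lemma prefix_lca (u v w : label) :
  prefix u (lca v w) = prefix u v && prefix u w.
Proof.
elim: v u w => [|i v IHv] [|k u] [|j w] //=; rewrite ?prefix0s ?andbF //.
have [<-|nij] := eqVneq i j; first by rewrite /= IHv; case: (k == i).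
by have [->|] := eqVneq k i; rewrite ?(negbTE nij) ?andbF.
Qed.

(** The Galton-Watson tree: X u is the number of children that the individual
    labelled u has if it is ever born *)

Definition mutually_independent d (Omega : measurableType d) (R : realType)
    (P : probability Omega R) (I : choiceType) (X : I -> {RV P >-> nat}) :
    Prop :=
  forall (s : seq I) (A : I -> set nat), uniq s ->
    P (\bigcap_(u in [set` s]) (X u @^-1` A u)) =
    (\prod_(u <- s) P (X u @^-1` A u))%E.
Arguments mutually_independent {d Omega R} P {I} X.

Definition iid_with_law d (Omega : measurableType d) (R : realType)
    (P : probability Omega R) (mu : probability nat R)
    (I : choiceType) (X : I -> {RV P >-> nat}) : Prop :=
  mutually_independent P X /\
  forall (u : I) (A : set nat), distribution P (X u) A = mu A.
Arguments iid_with_law {d Omega R} P mu {I} X.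

Definition gw_tree d (Omega : measurableType d) (R : realType)
    (P : probability Omega R) (X : label -> {RV P >-> nat})
    (omega : Omega) : set label :=
  family_tree (fun u => X u omega).
Arguments gw_tree {d Omega R} P X omega.

Definition gw_size_is d (Omega : measurableType d) (R : realType)
    (P : probability Omega R) (X : label -> {RV P >-> nat}) (n : nat) :
    set Omega :=
  [set omega | (gw_tree P X omega #= `I_n)%card].
Arguments gw_size_is {d Omega R} P X n.

(** E[Z | A] = E[Z 1_A] / P(A) for an event A with P(A) > 0 *)

Definition cond_expectation d (Omega : measurableType d) (R : realType)
    (P : probability Omega R) (A : set Omega) (Z : Omega -> R[i]) : R[i] :=
  ((\int[P]_(omega in A) complex.Re (Z omega)) / fine (P A)) +i*
  ((\int[P]_(omega in A) complex.Im (Z omega)) / fine (P A)).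

Definition pair_sum (R : realType) (t : set label) (x y : R[i]) : R[i] :=
  \sum_(vw \in t `*` t)
    x ^+ tree_dist t vw.1 (lca vw.1 vw.2) *
    y ^+ tree_dist t vw.2 (lca vw.1 vw.2).

Definition h d (Omega : measurableType d) (R : realType)
    (P : probability Omega R) (X : label -> {RV P >-> nat}) (n : nat)
    (x y : R[i]) : R[i] :=
  cond_expectation P (gw_size_is P X n)
    (fun omega => pair_sum (gw_tree P X omega) x y).
Arguments h {d Omega R} P X n x y.

(** Argument in ]-pi, pi] of a nonzero complex number *)

Definition carg (R : realType) (z : R[i]) : R :=
  let theta := acos (complex.Re z / complex.Re `|z|) in
  if 0 <= complex.Im z then theta else - theta.

Definition Delta (R : realType) (beta delta : R) : set R[i] :=
  [set z | [/\ `|z| < (1 + delta)%:C, z != 1 &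
               pi / 2 - beta < `|carg (z - 1)|]].

(* Main.v *)
Require Import Defs.
From HB Require Import structures.
From mathcomp Require Import all_boot all_order all_algebra all_solvable all_field finmap.
From mathcomp Require Import all_classical all_reals all_analysis measurable_realfun.
From mathcomp Require Import ring lra zify.
Set Implicit Arguments.
Unset Strict Implicit.
Unset Printing Implicit Defensive.
Import Order.TTheory GRing.Theory Num.Theory.
Local Open Scope classical_set_scope.
Local Open Scope ring_scope.
Local Open Scope complex_scope.

(** Let [q_n] be the probability that the tree has [n] vertices, [Phi] the
    generating function of the offspring law, [Y(z)] that of the [q_n], so that
    [Y = z Phi(Y)], and [F = z Phi'(Y)], [W = z Phi''(Y)]. Cutting a tree at its
    root shows that the generating function [H] of [q_n h_n(x, y)] satisfies
    [[
      H (1 - F) = Y + x F L_x + y F L_y + x y W L_x L_y,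
      L_x (1 - x F) = Y,
    ]]
    where [L_x] belongs to the sum of [x] to the depth over the vertices
    ([depth_gf_resolvent], [lca_gf_resolvent]). Hence
    [H = Y E (G_x + G_y - 1 + x y W Y G_x G_y)] with [E = 1 / (1 - F)] and
    [G_x = 1 / (1 - x F)].

    Since [q_n] is at least of order [n^(-3/2)] when it is positive
    ([tree_size_lower_bound]), it suffices that the coefficient of [z^n] in [H] is
    [O(n^(-1/2) / (|1 - x| |1 - y|))] ([pair_series_coef_bound]). It is computed on
    the circle of radius [1 - 1 / (2 n)], with the scale [t = 1 / (1 - |Y|)].

    - A finite variance and [Phi(0) > 0] force [|1 - F| <= kappa (1 - |F|)] and
      [1 - |F| >= c / t] there ([one_sub_slope_le], [slope_gap]). The first says
      that [F] lies in a Stolz angle at 1. Points [x] of a slit disc [Delta] that is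
      close enough to the unit disc leave the latter only tangentially, and then
      [|1 - x F| >= c |1 - x|] ([Delta_tangential], [resolvent_ge]). So
      [G_x = O(1 / |1 - x|)], while [E = O(t)].
    - Hence [H = O(t / (|1 - x| |1 - y|))]. The derivation [theta = z d/dz] costs a
      factor [t^2], as [theta Y = Y E] ([jet_le]). Two of them multiply the
      coefficient of [z^n] by [n^2] and leave the mean of [t^5] to be bounded.
    - The relation [(1 - F) theta Y = Y = z Phi(Y)] and [|Phi(Y)| >= p_0 / 4] give
      [t = O(|theta Y|)] ([circle_euler_ge]). The coefficients of [theta Y] are
      [n q_n], a coefficient of [Phi^n] by Lagrange inversion, and thus
      [O(n^(-1/2))] ([tree_coef_decay]). With Parseval's identity for the square and
      the cube of [theta Y], the means of [t^4] and [t^6] are [O(n)] and [O(n^2)],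
      and that of [t^5] is [O(n^(3/2))] ([mean_pow5_le]).

    No infinite series occurs: the tree with [n] vertices does not change when
    offspring numbers are truncated at some [K >= n] and heights at some [h >= n],
    which makes [Y] and [H] polynomials for which the relations above hold modulo
    [z^(n+1)]. On the circle, [Y = z Phi(Y)] fails by the increment between two
    heights, which is small for a suitable [h] ([small_increment]); inverses are
    replaced by polynomials ([poly_inverse_approx]) and integrals by averages over
    roots of unity. *)

Lemma le_of_eq d (T : porderType d) (x y : T) : x = y -> (x <= y)%O.
Proof. by move=> ->. Qed.

(** * Binomial coefficients *)

Lemma leq_bin_half m j : ('C(m, j) <= 'C(m, m./2))%N.
Proof.
have step i : (i.+1 <= m./2)%N -> ('C(m, i) <= 'C(m, i.+1))%N.
  move=> him; have h := mul_bin_left m i.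
  have him2 : (i.+1 <= m - i)%N by lia.
  rewrite -(leq_pmul2l (ltn0Sn i)) h.
  by rewrite leq_mul2r him2 orbT.
have incr d i : (i + d <= m./2)%N -> ('C(m, i) <= 'C(m, i + d))%N.
  elim: d => [|d IHd]; first by rewrite addn0.
  rewrite addnS => h; apply: (leq_trans (IHd _)); first lia.
  exact: step.
case: (leqP j m./2) => hj; first by rewrite -(subnKC hj) incr ?subnKC.
case: (leqP j m) => hjm; last by rewrite bin_small.
rewrite -bin_sub //; have hj' : (m - j <= m./2)%N by lia.
by rewrite -(subnKC hj') incr ?subnKC.
Qed.

Lemma bin_odd_middle k : 'C(k.*2.+1, k.+1) = 'C(k.*2.+1, k).
Proof. by rewrite -[LHS]bin_sub; [congr ('C(_, _)); lia | lia]. Qed.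

Lemma central_binS k : ('C(k.+1.*2, k.+1) * k.+1 = 2 * k.*2.+1 * 'C(k.*2, k))%N.
Proof.
have h := mul_bin_diag k.*2.+1 k; rewrite bin_odd_middle /= in h.
rewrite doubleS binS bin_odd_middle -[RHS]mulnA h; lia.
Qed.

(** The constant 3 makes the induction close: passing from [k] to [k.+1]
    multiplies the left side by at most 16, because
    [(2 * (2k + 1))^2 * (3k + 4) <= 16 * (k + 1)^2 * (3k + 1)]. *)
Lemma central_bin_sqr k : ('C(k.*2, k) ^ 2 * (3 * k).+1 <= 16 ^ k)%N.
Proof.
elim: k => [//|k IHk].
have h := central_binS k.
rewrite -(leq_pmul2r (_ : 0 < k.+1 ^ 2)%N) ?expn_gt0 //.
rewrite mulnAC -expnMn h expnMn mulnAC.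
apply: (@leq_trans (16 * (k.+1 ^ 2) * ('C(k.*2, k) ^ 2 * (3 * k).+1))%N); last first.
  by rewrite [(16 ^ k.+1)%N]expnS mulnAC leq_mul2r leq_mul2l IHk orbT.
rewrite -!mulnA [X in (_ <= X)%N](_ : _ = ((16 * k.+1 ^ 2 * (3 * k).+1) * 'C(k.*2, k) ^ 2)%N); last by lia.
rewrite [X in (X <= _)%N](_ : _ = (((2 * k.*2.+1) ^ 2 * (3 * k.+1).+1) * 'C(k.*2, k) ^ 2)%N); last by lia.
by rewrite leq_mul2r; apply/orP; right; nia.
Qed.

Lemma bin_sqr_le m j : ('C(m, j) ^ 2 * m.+1 <= 4 ^ m)%N.
Proof.
apply: (@leq_trans ('C(m, m./2) ^ 2 * m.+1)%N).
  by rewrite leq_mul2r leq_exp2r // leq_bin_half.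
have hm : m = (odd m + m./2.*2)%N by rewrite odd_double_half.
move: (m./2) hm; case: (odd m) => k -> {m} /=; last first.
  rewrite add0n; apply: leq_trans (leq_trans _ (central_bin_sqr k)) _.
    by rewrite leq_mul2l; apply/orP; right; lia.
  by rewrite -muln2 mulnC expnM.
rewrite add1n; have := central_bin_sqr k.+1; rewrite doubleS binS.
rewrite bin_odd_middle addnn -muln2 expnMn => h.
rewrite -(leq_pmul2l (_ : 0 < 4)%N) //.
apply: (@leq_trans (16 ^ k.+1)%N); last first.
  by rewrite (_ : 16 = 4 ^ 2)%N // -expnM -expnS leq_exp2l //; lia.
apply: leq_trans h; rewrite mulnA [(4 * _)%N]mulnC leq_mul2l.
by apply/orP; right; lia.
Qed.

(** * Upper bounds for the coefficients of powers *)

Section PowerCoefficients.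
Variable R : realType.
Implicit Types (P Q A B : {poly R}).

Definition nneg_coef P := forall i, 0 <= P`_i.

Lemma nneg_coefD P Q : nneg_coef P -> nneg_coef Q -> nneg_coef (P + Q).
Proof. by move=> hP hQ i; rewrite coefD addr_ge0. Qed.

Lemma nneg_coefM P Q : nneg_coef P -> nneg_coef Q -> nneg_coef (P * Q).
Proof. by move=> hP hQ i; rewrite coefM; apply: sumr_ge0 => j _; rewrite mulr_ge0. Qed.

Lemma nneg_coefC (c : R) : 0 <= c -> nneg_coef c%:P.
Proof. by move=> c0 i; rewrite coefC; case: ifP. Qed.

Lemma nneg_coefXn n : nneg_coef 'X^n.
Proof. by move=> i; rewrite coefXn ler0n. Qed.

Lemma nneg_coefZ (c : R) P : 0 <= c -> nneg_coef P -> nneg_coef (c *: P).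
Proof. by move=> c0 hP i; rewrite coefZ mulr_ge0. Qed.

Lemma nneg_coefX P n : nneg_coef P -> nneg_coef (P ^+ n).
Proof.
by move=> hP; elim: n => [|n IHn]; [apply: nneg_coefC | rewrite exprS; apply: nneg_coefM].
Qed.

Lemma nneg_coef_sum (I : Type) (r : seq I) (D : pred I) (G : I -> {poly R}) :
  (forall i, D i -> nneg_coef (G i)) -> nneg_coef (\sum_(i <- r | D i) G i).
Proof. by move=> h i; rewrite coef_sum; apply: sumr_ge0 => j Dj; apply: h. Qed.

Lemma nneg_coef_horner P (x : R) : 0 <= x -> nneg_coef P -> 0 <= P.[x].
Proof.
move=> x0 hP; rewrite horner_coef; apply: sumr_ge0 => i _.
by rewrite mulr_ge0 ?exprn_ge0.
Qed.

Lemma horner1E P n : (size P <= n)%N -> P.[1] = \sum_(i < n) P`_i.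
Proof.
move=> h; rewrite (horner_coef_wide _ h).
by apply: eq_bigr => i _; rewrite expr1n mulr1.
Qed.

Lemma coefM_le_sup A B a j : 0 <= a -> (forall i, A`_i <= a) ->
  nneg_coef B -> (A * B)`_j <= a * B.[1].
Proof.
move=> a0 hA hB; rewrite coefMr.
apply: (@le_trans _ _ (\sum_(i < j.+1) a * B`_i)).
  by apply: ler_sum => i _; rewrite ler_wpM2r.
rewrite -mulr_sumr ler_wpM2l // (horner1E (leq_maxl (size B) j.+1)).
rewrite (big_ord_widen _ (fun i => B`_i) (leq_maxr (size B) j.+1)).
rewrite [leRHS](bigID (fun i : 'I_ _ => (i < j.+1)%N)) /= lerDl.
by apply: sumr_ge0.
Qed.

Lemma coef_add1Xn k m j : (0 < k)%N ->
  ((1 + 'X^k) ^+ m : {poly R})`_j = if (k %| j)%N then 'C(m, j %/ k)%:R else 0.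
Proof.
move=> k0; rewrite exprDn coef_sum.
under eq_bigr => i _ do rewrite expr1n mul1r -exprM coefMn coefXn.
case: ifP => [/dvdnP [i ->]|h]; last first.
  apply: big1 => i _; case: eqP => [e|_]; last by rewrite mul0rn.
  by move: h; rewrite e dvdn_mulr.
rewrite mulnK //; case: (ltnP i m.+1) => hi; last first.
  rewrite bin_small //; apply: big1 => i' _.
  rewrite mulnC eqn_pmul2l // gtn_eqF ?mul0rn //.
  by apply: leq_trans (ltn_ord i') _.
rewrite (bigD1 (Ordinal hi)) //= mulnC eqxx big1 ?addr0 // => i' hi'.
rewrite eqn_pmul2l // eq_sym.
case: eqP => [e|_]; last by rewrite mul0rn.
by case/negP: hi'; apply/eqP/val_inj.
Qed.

Lemma bin_le_sqrt m j : ('C(m, j)%:R : R) <= 2 ^+ m / Num.sqrt m.+1%:R.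
Proof.
have s0 : 0 < Num.sqrt (m.+1%:R : R) by rewrite sqrtr_gt0.
rewrite ler_pdivlMr // -ler_sqr ?nnegrE ?mulr_ge0 ?exprn_ge0 ?sqrtr_ge0 //.
rewrite exprMn sqr_sqrtr // -exprM mulnC exprM -!natrX -natrM ler_nat.
exact: bin_sqr_le.
Qed.

Lemma coef_add1Xn_le k m j : (0 < k)%N ->
  ((1 + 'X^k) ^+ m : {poly R})`_j <= 2 ^+ m / Num.sqrt m.+1%:R.
Proof.
move=> k0; rewrite coef_add1Xn //; case: ifP => _; first exact: bin_le_sqrt.
by rewrite divr_ge0 ?exprn_ge0 ?sqrtr_ge0.
Qed.

(** This is the mean of [1 / (M + 1)] for [M] binomial. Multiplied by
    [p * n.+1], its terms become the terms but the first of the expansion of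
    [((1 - p) + p) ^ n.+1]. *)
Lemma binomial_mean_inv n (p : R) : 0 < p <= 1 ->
  \sum_(m < n.+1) 'C(n, m)%:R * p ^+ m * (1 - p) ^+ (n - m) / m.+1%:R
    <= (p * n.+1%:R)^-1.
Proof.
case/andP=> p0 p1.
rewrite -[leRHS]mul1r ler_pdivlMr ?mulr_gt0 // mulr_suml.
have e1 : ((1 - p) + p) ^+ n.+1 = 1 :> R by rewrite subrK expr1n.
rewrite exprDn big_ord_recl /= in e1; rewrite -[leRHS]e1.
rewrite -[leLHS]add0r lerD //.
  by rewrite mulrn_wge0 // mulr_ge0 ?exprn_ge0 ?subr_ge0 // ltW.
apply: ler_sum => m _; rewrite /bump /= add1n subSS.
have := mul_bin_diag n.+1 m; rewrite /= => /(congr1 (fun x => x%:R : R)).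
rewrite !natrM => h.
rewrite -[X in _ <= X]mulr_natl exprS; apply: le_of_eq.
have m0 : m.+1%:R != 0 :> R by rewrite pnatr_eq0.
apply: (mulIf m0).
transitivity (n.+1%:R * 'C(n, m)%:R * p ^+ m * (1 - p) ^+ (n - m) * p); first by field.
by rewrite h; ring.
Qed.

(** Linearizing the inverse square root at its typical value, with
    [l = sqrt (n + 1)] and [t = sqrt (m + 1)]: [1/t <= (l / t^2 + 1/l) / 2], and
    the mean of [1 / t^2] is known. *)
Lemma binomial_mean_invsqrt n (p : R) : 0 < p <= 1 ->
  \sum_(m < n.+1) 'C(n, m)%:R * p ^+ m * (1 - p) ^+ (n - m) / Num.sqrt m.+1%:R
    <= p^-1 / Num.sqrt n.+1%:R.
Proof.
move=> /[dup] hp /andP[p0 p1].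
set l := Num.sqrt (n.+1%:R : R).
have l0 : 0 < l by rewrite sqrtr_gt0.
have l2 : l ^+ 2 = n.+1%:R by rewrite sqr_sqrtr.
apply: (@le_trans _ _ (\sum_(m < n.+1) ('C(n, m)%:R * p ^+ m * (1 - p) ^+ (n - m) / m.+1%:R * (l / 2) + 'C(n, m)%:R * p ^+ m * (1 - p) ^+ (n - m) * (l^-1 / 2)))).
  apply: ler_sum => m _; rewrite -[X in _ <= X + _]mulrA -mulrDr ler_wpM2l //.
    by rewrite !mulr_ge0 ?exprn_ge0 ?subr_ge0 // ltW.
  set t := Num.sqrt (m.+1%:R : R).
  have t0 : 0 < t by rewrite sqrtr_gt0.
  have t2 : t ^+ 2 = m.+1%:R by rewrite sqr_sqrtr.
  rewrite -t2 -subr_ge0.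
  have -> : t ^- 2 * (l / 2) + l^-1 / 2 - t^-1 = (l - t) ^+ 2 / (2 * l * t ^+ 2).
    by field; rewrite !gt_eqF.
  by rewrite divr_ge0 ?sqr_ge0 // mulr_ge0 ?sqr_ge0 // mulr_ge0 // ltW.
rewrite big_split /= -!mulr_suml.
have e1 : \sum_(m < n.+1) 'C(n, m)%:R * p ^+ m * (1 - p) ^+ (n - m) = 1 :> R.
  have e1 : ((1 - p) + p) ^+ n = 1 :> R by rewrite subrK expr1n.
  rewrite exprDn in e1; rewrite -[RHS]e1; apply: eq_bigr => m _.
  by rewrite -[RHS]mulr_natl; ring.
rewrite e1 mul1r.
have h := binomial_mean_inv n hp.
apply: (@le_trans _ _ ((p * n.+1%:R)^-1 * (l / 2) + l^-1 / 2)).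
  by rewrite lerD2r ler_wpM2r // divr_ge0 // ltW.
rewrite -l2 -subr_ge0.
have -> : p^-1 / l - ((p * l ^+ 2)^-1 * (l / 2) + l^-1 / 2) = (1 - p) / (2 * p * l).
  by field; rewrite !gt_eqF.
by rewrite divr_ge0 ?subr_ge0 // !mulr_ge0 // ltW.
Qed.

(** Each of the [n] factors is [eps *: (1 + 'X^k)], a fair coin of weight
    [eps *+ 2], or [S]. Given [m] coins, no value is hit with weight above
    [2 ^ m / sqrt (m + 1)], and the number of coins is binomial. *)
Lemma coef_exp_le (eps : R) (k n j : nat) (Phi S : {poly R}) :
  (0 < k)%N -> 0 < eps -> eps *+ 2 <= 1 ->
  nneg_coef S -> S.[1] <= 1 - eps *+ 2 ->
  Phi = eps *: (1 + 'X^k) + S ->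
  (Phi ^+ n)`_j <= (eps *+ 2)^-1 / Num.sqrt n.+1%:R.
Proof.
move=> k0 e0 e1 hS S1 ->.
have hp : 0 < eps *+ 2 <= 1 by rewrite e1 andbT mulr2n addr_gt0.
apply: le_trans (binomial_mean_invsqrt n hp).
rewrite addrC exprDn coef_sum; apply: ler_sum => m _.
have hS0 : 0 <= S.[1] by rewrite nneg_coef_horner.
have h : (S ^+ (n - m) * (1 + 'X^k) ^+ m)`_j <=
         2 ^+ m / Num.sqrt m.+1%:R * (1 - eps *+ 2) ^+ (n - m).
  rewrite [S ^+ _ * _]mulrC.
  have a0 : 0 <= 2 ^+ m / Num.sqrt m.+1%:R :> R by rewrite divr_ge0 ?exprn_ge0 ?sqrtr_ge0.
  have h1 := coefM_le_sup j a0 (fun i => coef_add1Xn_le m i k0) (nneg_coefX (n - m) hS).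
  apply: (le_trans h1).
  rewrite ler_wpM2l ?divr_ge0 ?exprn_ge0 ?sqrtr_ge0 // horner_exp.
  by rewrite lerXn2r ?nnegrE // subr_ge0.
rewrite coefMn exprZn -scalerAr coefZ -mulr_natr.
rewrite [leLHS](_ : _ = ('C(n, m)%:R * eps ^+ m) * (S ^+ (n - m) * (1 + 'X^k) ^+ m)`_j); last by ring.
apply: (@le_trans _ _ (('C(n, m)%:R * eps ^+ m) * (2 ^+ m / Num.sqrt m.+1%:R * (1 - eps *+ 2) ^+ (n - m)))).
  by rewrite ler_wpM2l // mulr_ge0 ?exprn_ge0 // ltW.
rewrite -(mulr_natr eps 2) exprMn; apply: le_of_eq.
by ring.
Qed.

End PowerCoefficients.

(** * Lower bounds for binomial coefficients near the middle *)

(** Same induction as for the upper bound; the growth factor is now at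
    least 16 because
    [(2 * (2k + 1))^2 * (4k + 5) >= 16 * (k + 1)^2 * (4k + 1)]. *)
Lemma central_bin_ge k : (16 ^ k <= 'C(k.*2, k) ^ 2 * (4 * k).+1)%N.
Proof.
case: k => [//|k]; elim: k => [//|k].
set j := k.+1 => IHk.
have h := central_binS j.
rewrite -(leq_pmul2r (_ : 0 < j.+1 ^ 2)%N) ?expn_gt0 //.
rewrite [leqRHS]mulnAC -expnMn h expnMn [leqRHS]mulnAC.
apply: (@leq_trans (16 * (j.+1 ^ 2) * ('C(j.*2, j) ^ 2 * (4 * j).+1))%N).
  by rewrite [(16 ^ j.+1)%N]expnS mulnAC leq_mul2l IHk orbT.
rewrite -!mulnA [X in (X <= _)%N](_ : _ = ((16 * j.+1 ^ 2 * (4 * j).+1) * 'C(j.*2, j) ^ 2)%N); last by lia.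
rewrite [X in (_ <= X)%N](_ : _ = (((2 * j.*2.+1) ^ 2 * (4 * j.+1).+1) * 'C(j.*2, j) ^ 2)%N); last by lia.
by rewrite leq_mul2r; apply/orP; right; nia.
Qed.

Lemma bin_half_sqr_ge m : (4 ^ m <= 'C(m, m./2) ^ 2 * (4 * m).+1)%N.
Proof.
have hm : m = (odd m + m./2.*2)%N by rewrite odd_double_half.
move: (m./2) hm; case: (odd m) => k -> {m} /=; last first.
  rewrite add0n; apply: (@leq_trans (16 ^ k)%N); first by rewrite -muln2 mulnC expnM.
  apply: (leq_trans (central_bin_ge k)); rewrite leq_mul2l; apply/orP; right; lia.
rewrite add1n; have := central_bin_ge k.+1; rewrite doubleS binS.
rewrite bin_odd_middle addnn -muln2 expnMn => h.
rewrite -(leq_pmul2l (_ : 0 < 4)%N) //.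
apply: (@leq_trans (16 ^ k.+1)%N).
  by rewrite (_ : 16 = 4 ^ 2)%N // -expnM -expnS leq_exp2l //; lia.
apply: (leq_trans h); rewrite [leqRHS]mulnA [('C(_, _) ^ 2 * _)%N]mulnC leq_mul2l.
by apply/orP; right; lia.
Qed.

(** Moving from [m./2] to [m./2 + t] takes [t] steps, and each multiplies the
    binomial coefficient by at least [(m./2 - t) / (m./2 + t)]. *)
Lemma bin_shift_ge m t : (t <= m./2)%N ->
  ('C(m, m./2) * (m./2 - t) ^ t <= 'C(m, m./2 + t) * (m./2 + t) ^ t)%N.
Proof.
set h := m./2 => th.
suff: forall s, (s <= t)%N -> ('C(m, h) * (h - t) ^ s <= 'C(m, h + s) * (h + t) ^ s)%N by apply.
elim => [|s IHs] hs; first by rewrite addn0.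
have := IHs (ltnW hs); have := mul_bin_left m (h + s) => e IH.
rewrite addnS !expnS.
apply: (@leq_trans ('C(m, h + s) * (h + t) ^ s * (m - (h + s)))%N).
  rewrite mulnCA mulnC leq_mul //; lia.
rewrite [leqLHS](_ : _ = ((h + s).+1 * ('C(m, (h + s).+1) * (h + t) ^ s))%N); last by rewrite mulnA e; lia.
by rewrite [leqRHS]mulnCA leq_mul2r; apply/orP; right; lia.
Qed.

Section BinomialLocalLimit.
Variable R : realType.

Lemma expR_le_1B (x : R) : 0 <= x <= 2^-1 -> expR (- (x *+ 2)) <= 1 - x.
Proof.
move=> /andP[x0 x1]; rewrite expRN.
have h := expR_ge1Dx (x *+ 2).
have h0 : 0 < 1 + x *+ 2 by lra.
apply: (@le_trans _ _ (1 + x *+ 2)^-1); first by rewrite lef_pV2 ?posrE ?expR_gt0.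
rewrite -[leLHS]mul1r ler_pdivrMr //; nra.
Qed.

Lemma bin_upper_half_ge m t : (4 * t <= m./2)%N -> (0 < m./2)%N ->
  'C(m, m./2)%:R * expR (- (4 * t%:R ^+ 2 / m./2%:R)) <= ('C(m, m./2 + t)%:R : R).
Proof.
set h := m./2 => th h0; set x : R := (t *+ 2)%:R / h%:R.
have hh : 0 < h%:R :> R by rewrite ltr0n.
have x01 : 0 <= x <= 2^-1.
  rewrite divr_ge0 //= ler_pdivrMr // mulrC ler_pdivlMr // -natrM ler_nat.
  by rewrite mulr2n; lia.
have := @bin_shift_ge m t; rewrite -/h => /(_ _)/wrap[]; first lia.
rewrite -(ler_nat R) !natrM !natrX natrB; last lia.
rewrite natrD => H.
have ht0 : 0 < (h%:R + t%:R) :> R by rewrite ltr_wpDr.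
rewrite -ler_pdivrMr ?exprn_gt0 // in H.
apply: le_trans H; rewrite -[leRHS]mulrA ler_wpM2l // -expr_div_n.
have -> : - (4 * t%:R ^+ 2 / h%:R) = t%:R * - (x *+ 2).
  by rewrite /x !mulr2n natrD; ring.
rewrite expRM_natl; apply: lerXn2r; rewrite ?nnegrE ?expR_ge0 //.
  by apply: divr_ge0; [rewrite subr_ge0 ler_nat; lia | exact: ltW].
apply: (le_trans (expR_le_1B x01)).
rewrite ler_pdivlMr // /x mulr2n natrD.
rewrite -subr_ge0.
have -> : h%:R - t%:R - (1 - (t%:R + t%:R) / h%:R) * (h%:R + t%:R) = 2 * t%:R ^+ 2 / h%:R :> R.
  by field; rewrite gt_eqF.
by rewrite divr_ge0 // mulr_ge0 // sqr_ge0.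
Qed.

(** Within [A * sqrt m] of the middle, a binomial coefficient is comparable with
    the central one: the loss [expR (- 4 t^2 / (m / 2))] stays bounded. *)
Lemma bin_bulk_ge (A : R) : 0 < A -> exists c : R, exists m0 : nat, 0 < c /\
  forall m i : nat, (m0 <= m)%N -> (i <= m)%N ->
    `|i%:R - m%:R / 2| <= A * Num.sqrt m%:R ->
    c * 2 ^+ m / Num.sqrt m%:R <= 'C(m, i)%:R.
Proof.
move=> A0.
(* A shift from m./2 is at most (A + 1) * q, and m./2 >= q^2 / 4; the 3 comes
   from the bound 2 ^ m / sqrt (4 * m + 1) for the central coefficient. *)
pose c : R := expR (- (16 * (A + 1) ^+ 2)) / 3.
have [N hN] : exists N : nat, (16 * (A + 1)) ^+ 2 < N%:R.
  by exists (Num.truncn ((16 * (A + 1)) ^+ 2)).+1; rewrite truncnS_gt.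
exists c, (N + 4)%N; split; first by rewrite divr_gt0 ?expR_gt0.
move=> m i hm him hi.
have m4 : (4 <= m)%N by lia.
have hNm : (16 * (A + 1)) ^+ 2 <= m%:R.
  by apply: (le_trans (ltW hN)); rewrite ler_nat; lia.
set q := Num.sqrt (m%:R : R) in hi *.
have q0 : 0 < q by rewrite sqrtr_gt0 ltr0n; lia.
have q2 : q ^+ 2 = m%:R by rewrite sqr_sqrtr.
have qA : 16 * (A + 1) <= q.
  by rewrite -ler_sqr ?nnegrE ?q2 ?sqrtr_ge0 //; lra.
have hodd : m = (odd m + m./2.*2)%N by rewrite odd_double_half.
set h := m./2 in hodd.
have key j : (h <= j)%N -> (j <= m)%N -> `|j%:R - m%:R / 2| <= A * q ->
    c * 2 ^+ m / q <= 'C(m, j)%:R.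
  move=> hj hjm hjA.
  have mE : m%:R = (odd m)%:R + 2 * h%:R :> R.
    by rewrite [in LHS]hodd natrD -muln2 natrM mulrC.
  have o1 : (odd m)%:R <= 1 :> R by rewrite lern1 leq_b1.
  have o0 : 0 <= (odd m)%:R :> R by [].
  set t := (j - h)%N.
  have tE : t%:R = j%:R - h%:R :> R by rewrite natrB.
  have tA : t%:R <= (A + 1) * q.
    move: hjA; rewrite ler_norml => /andP[_ hjA].
    rewrite tE; nra.
  have hq : q ^+ 2 / 4 <= h%:R by rewrite q2 mE; have : 4 <= m%:R :> R by [rewrite ler_nat]; lra.
  have h0 : 0 < h%:R :> R by apply: lt_le_trans hq; rewrite divr_gt0 // exprn_gt0.
  have t4 : (4 * t <= h)%N.
    rewrite -(ler_nat R) natrM; apply: (le_trans _ hq).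
    apply: (@le_trans _ _ (4 * ((A + 1) * q))); first by rewrite ler_pM2l.
    rewrite expr2; nra.
  have h0' : (0 < h)%N by rewrite -(ltr_nat R).
  have := bin_upper_half_ge t4 h0'; rewrite subnKC //; apply: le_trans.
  have b0 : 2 ^+ m / (3 * q) <= 'C(m, h)%:R.
    have := bin_half_sqr_ge m; rewrite -/h -(ler_nat R) natrM !natrX => hb.
    rewrite ler_pdivrMr ?mulr_gt0 // -ler_sqr ?nnegrE ?mulr_ge0 ?exprn_ge0 ?(ltW q0) //.
    rewrite -exprM mulnC exprM -natrX exprMn; apply: (le_trans hb).
    rewrite ler_wpM2l ?sqr_ge0 // exprMn q2 -natr1 natrM.
    have : 4 <= m%:R :> R by [rewrite ler_nat]; lra.
  apply: (@le_trans _ _ (2 ^+ m / (3 * q) * expR (- (16 * (A + 1) ^+ 2)))).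
    by rewrite /c; apply: le_of_eq; field; rewrite gt_eqF.
  apply: ler_pM => //.
  - by rewrite divr_ge0 ?exprn_ge0 // mulr_ge0 // ltW.
  - rewrite ler_expR lerN2 ler_pdivrMr //.
    have t2 : t%:R ^+ 2 <= ((A + 1) * q) ^+ 2 :> R by rewrite lerXn2r ?nnegrE // mulr_ge0 ?addr_ge0 // ltW.
    rewrite exprMn in t2.
    have : 0 <= (A + 1) ^+ 2 by rewrite sqr_ge0.
    by nra.
have [hj|hj] := leqP h i; first exact: key.
rewrite -bin_sub //; apply: key; [lia | lia |].
rewrite natrB // (_ : _ - _ = - (i%:R - m%:R / 2)); last by field.
by rewrite normrN.
Qed.

End BinomialLocalLimit.

(** * Truncations of a critical offspring law *)

Section TruncatedLaw.
Variable R : realType.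
Implicit Types (P Q A B : {poly R}) (p : nat -> R).

Definition trunc_pgf p K : {poly R} := \poly_(k < K.+1) p k.

(** The offspring law enters only through its truncations at [K]. The lower bounds
    in [cl_mass] and [cl_mean] are what a second moment at most [m2] leaves of the
    mass 1 and of the mean 1; [cl_p0] and [cl_branch] say that the law is
    nondegenerate. *)
Record critical_law p (m2 : R) : Prop := CriticalLaw {
  cl_ge0 : forall k, 0 <= p k;
  cl_p0 : 0 < p 0%N;
  cl_branch : exists2 k, (0 < k)%N & 0 < p k;
  cl_mass : forall K, (0 < K)%N ->
    1 - m2 / K%:R ^+ 2 <= \sum_(k < K.+1) p k <= 1;
  cl_mean : forall K, (0 < K)%N ->
    1 - m2 / K%:R <= \sum_(k < K.+1) k%:R * p k <= 1;
  cl_second : forall K, \sum_(k < K.+1) k%:R ^+ 2 * p k <= m2 }.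

Lemma bernoulli_ge (x : R) n : 0 <= x <= 1 -> 1 - n%:R * x <= (1 - x) ^+ n.
Proof.
move=> /andP[x0 x1]; elim: n => [|n IHn]; first by rewrite mul0r subr0 expr0.
rewrite exprS; apply: (@le_trans _ _ ((1 - x) * (1 - n%:R * x))).
  rewrite -natr1 -subr_ge0.
  rewrite [X in 0 <= X](_ : _ = n%:R * x ^+ 2); last by ring.
  by rewrite mulr_ge0 ?sqr_ge0.
by rewrite ler_wpM2l // subr_ge0.
Qed.

Lemma coef_trunc_pgf p K k : (trunc_pgf p K)`_k = if (k <= K)%N then p k else 0.
Proof. by rewrite coef_poly ltnS. Qed.

Lemma coefM_le A B A' B' : nneg_coef A -> nneg_coef B ->
  (forall i, A`_i <= A'`_i) -> (forall i, B`_i <= B'`_i) ->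
  forall i, (A * B)`_i <= (A' * B')`_i.
Proof.
move=> hA hB hAA hBB i; rewrite !coefM; apply: ler_sum => j _.
exact: ler_pM.
Qed.

Lemma coef_exp_mono A A' n : nneg_coef A -> (forall i, A`_i <= A'`_i) ->
  forall i, (A ^+ n)`_i <= (A' ^+ n)`_i.
Proof.
move=> hA h; elim: n => [|n IHn] i; first by rewrite !expr0.
rewrite !exprS; apply: coefM_le => //; exact: nneg_coefX.
Qed.

Lemma coefM_ge A B i j : nneg_coef A -> nneg_coef B ->
  A`_i * B`_j <= (A * B)`_(i + j).
Proof.
move=> hA hB; have hi : (i < (i + j).+1)%N by rewrite ltnS leq_addr.
rewrite coefM (bigD1 (Ordinal hi)) //= addKn lerDl.
by apply: sumr_ge0 => k _; rewrite mulr_ge0.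
Qed.

Lemma coefM_wide A B N J : (size A <= J)%N ->
  (A * B)`_N = \sum_(j < J) A`_j * (if (j <= N)%N then B`_(N - j) else 0).
Proof.
move=> hJ; rewrite coefM.
pose G j := A`_j * (if (j <= N)%N then B`_(N - j) else 0).
transitivity (\sum_(j < maxn J N.+1) G j).
  rewrite (big_ord_widen _ (fun j => A`_j * B`_(N - j)) (leq_maxr J N.+1)).
  rewrite [RHS](bigID (fun j : 'I_ _ => (j < N.+1)%N)) /= [X in _ = _ + X]big1 ?addr0.
    by apply: eq_bigr => j; rewrite /G ltnS => ->.
  by move=> j; rewrite /G ltnS => /negPf ->; rewrite mulr0.
rewrite (big_ord_widen _ G (leq_maxl J N.+1)).
rewrite (bigID (fun j : 'I_ _ => (j < J)%N)) /= [X in _ + X = _]big1 ?addr0 //.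
by move=> j; rewrite -leqNgt /G => hj; rewrite nth_default ?mul0r // (leq_trans hJ).
Qed.

(** ** Centred moments as values at 1 *)

Definition centred_deriv (a : R) P := 'X * P^`() - a *: P.

Lemma coef_centred_deriv a P i : (centred_deriv a P)`_i = (i%:R - a) * P`_i.
Proof.
rewrite coefB coefXM coef_deriv coefZ; case: i => [|i] /=; first by ring.
by rewrite -mulr_natr; ring.
Qed.

Lemma centred_derivM a b P Q :
  centred_deriv (a + b) (P * Q) = centred_deriv a P * Q + P * centred_deriv b Q.
Proof. by rewrite /centred_deriv derivM -!mul_polyC polyCD; ring. Qed.

Lemma centred_derivD a P Q :
  centred_deriv a (P + Q) = centred_deriv a P + centred_deriv a Q.
Proof. by rewrite /centred_deriv derivD -!mul_polyC; ring. Qed.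

Lemma centred_deriv_sum a (I : Type) (r : seq I) (D : pred I) (G : I -> {poly R}) :
  centred_deriv a (\sum_(i <- r | D i) G i) = \sum_(i <- r | D i) centred_deriv a (G i).
Proof.
elim/big_rec2: _ => [|i x y _ <-]; last by rewrite centred_derivD.
by rewrite /centred_deriv deriv0 mulr0 scaler0 subr0.
Qed.

Lemma centred_derivZ a c P : centred_deriv a (c *: P) = c *: centred_deriv a P.
Proof. by rewrite /centred_deriv derivZ -!mul_polyC; ring. Qed.

Lemma centred_derivX P n :
  centred_deriv n.+1%:R (P ^+ n.+1) = n.+1%:R *: (P ^+ n * centred_deriv 1 P).
Proof.
elim: n => [|n IHn]; first by rewrite expr1 expr0 mul1r scale1r.
rewrite -natr1 exprSr centred_derivM IHn -!mul_polyC polyCD exprSr; ring.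
Qed.

(** The second moment of [P] about [a], written as a value at 1 so that the Leibniz
    rule applies to products. *)
Definition mom2 (a : R) P := (centred_deriv a (centred_deriv a P)).[1].

Lemma mom2E a P J : (size P <= J)%N -> mom2 a P = \sum_(j < J) (j%:R - a) ^+ 2 * P`_j.
Proof.
move=> hJ; rewrite /mom2 (@horner1E _ _ J); last first.
  by apply/leq_sizeP => i hi; rewrite !coef_centred_deriv nth_default ?mulr0 // (leq_trans hJ).
by apply: eq_bigr => i _; rewrite !coef_centred_deriv mulrA expr2.
Qed.

Lemma mom2_ge0 a P : nneg_coef P -> 0 <= mom2 a P.
Proof.
move=> hP; rewrite (mom2E a (leqnn _)); apply: sumr_ge0 => i _.
by rewrite mulr_ge0 // sqr_ge0.
Qed.

Lemma mom2_sum a (I : Type) (r : seq I) (D : pred I) (G : I -> {poly R}) :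
  mom2 a (\sum_(i <- r | D i) G i) = \sum_(i <- r | D i) mom2 a (G i).
Proof. by rewrite /mom2 !centred_deriv_sum horner_sum. Qed.

Lemma mom2Z a c P : mom2 a (c *: P) = c * mom2 a P.
Proof. by rewrite /mom2 !centred_derivZ hornerZ. Qed.

Lemma mom2M a b P Q :
  mom2 (a + b) (P * Q) =
  mom2 a P * Q.[1] + 2 * (centred_deriv a P).[1] * (centred_deriv b Q).[1] + P.[1] * mom2 b Q.
Proof.
rewrite /mom2 centred_derivM centred_derivD !centred_derivM !(hornerD, hornerM).
by ring.
Qed.

(** Centring one factor at its mean kills the cross term, and what remains of
    that factor is a variance, hence nonnegative. *)
Lemma mom2M_ge a b P Q : nneg_coef P -> nneg_coef Q -> (centred_deriv b Q).[1] = 0 ->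
  mom2 a P * Q.[1] <= mom2 (a + b) (P * Q).
Proof.
move=> hP hQ h; rewrite mom2M h mulr0 addr0 lerDl mulr_ge0 ?mom2_ge0 //.
exact: nneg_coef_horner.
Qed.

(** Squared bias plus the sum of the variances, for a sum of [n] independent copies
    of a possibly defective variable. *)
Lemma mom2X P n : P.[1] <= 1 -> nneg_coef P ->
  mom2 n%:R (P ^+ n) <= (n%:R * (centred_deriv 1 P).[1]) ^+ 2 + n%:R * mom2 1 P.
Proof.
move=> P1 hP; have P0 : 0 <= P.[1] by rewrite nneg_coef_horner.
have hX m : 0 <= P.[1] ^+ m <= 1 by rewrite exprn_ge0 //= exprn_ile1.
have dP2 : 0 <= (centred_deriv 1 P).[1] ^+ 2 by rewrite sqr_ge0.
have M0 := mom2_ge0 1 hP.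
case: n => [|n].
  rewrite expr0 !mul0r expr0n /= addr0 /mom2 /centred_deriv scale0r subr0 -polyC1.
  by rewrite derivC mulr0 deriv0 scale0r mulr0 subr0 horner0.
rewrite /mom2 centred_derivX centred_derivZ hornerZ.
case: n => [|n].
  rewrite expr0 mul1r !mul1r lerDr //.
rewrite -[n.+2%:R]natr1 centred_derivM centred_derivX hornerD !(hornerM, hornerZ, horner_exp).
have /andP[a0 a1] := hX n; have /andP[b0 b1] := hX n.+1.
set u := (centred_deriv 1 P).[1] in dP2 *; set v := (centred_deriv 1 (centred_deriv 1 P)).[1].
have hv : 0 <= v by exact: M0.
have hn : 0 <= n.+1%:R :> R by [].
rewrite /mom2 -/v.
move: (P.[1] ^+ n) (P.[1] ^+ n.+1) a0 a1 b0 b1 => x y x0 x1 y0 y1.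
rewrite exprMn.
have -> : (n.+1%:R + 1) * (n.+1%:R * (x * u) * u + y * v) =
  ((n.+1%:R + 1) * n.+1%:R) * (x * u ^+ 2) + (n.+1%:R + 1) * (y * v) by ring.
apply: lerD; last by rewrite ler_wpM2l ?addr_ge0 // ler_piMl.
apply: ler_pM.
- by rewrite mulr_ge0 ?addr_ge0.
- by rewrite mulr_ge0.
- by rewrite expr2 ler_wpM2l ?addr_ge0 // lerDl.
- by rewrite ler_piMl.
Qed.

End TruncatedLaw.

(** * A local lower bound for the powers *)

Section LocalLowerBound.
Variables (R : realType) (p : nat -> R) (m2 : R).
Hypothesis cl : critical_law p m2.
Let Phi := trunc_pgf p.

Lemma second_moment_ge0 : 0 <= m2.
Proof.
apply: le_trans (cl_second cl 0); apply: sumr_ge0 => i _.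
by rewrite mulr_ge0 ?sqr_ge0 // (cl_ge0 cl).
Qed.

Lemma nneg_trunc_pgf K : nneg_coef (Phi K).
Proof. by move=> i; rewrite coef_trunc_pgf; case: ifP => // _; apply: (cl_ge0 cl). Qed.

Lemma trunc_pgf_le K K' i : (K <= K')%N -> (Phi K)`_i <= (Phi K')`_i.
Proof.
move=> h; rewrite !coef_trunc_pgf; case: ifP => hi; first by rewrite (leq_trans hi).
by case: ifP => // _; apply: (cl_ge0 cl).
Qed.

Lemma trunc_pgf_sum K : (Phi K).[1] = \sum_(k < K.+1) p k.
Proof.
rewrite (horner1E (size_poly _ _)); apply: eq_bigr => i _.
by rewrite coef_trunc_pgf -ltnS ltn_ord.
Qed.

Lemma supp_exp_mono K K' n i : (K <= K')%N -> 0 < (Phi K ^+ n)`_i -> 0 < (Phi K' ^+ n)`_i.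
Proof.
move=> h hi; apply: (lt_le_trans hi); apply: coef_exp_mono; first exact: nneg_trunc_pgf.
by move=> j; apply: trunc_pgf_le.
Qed.

Lemma supp_expD K a b i j : 0 < (Phi K ^+ a)`_i -> 0 < (Phi K ^+ b)`_j ->
  0 < (Phi K ^+ (a + b))`_(i + j).
Proof.
move=> hi hj; rewrite exprD; apply: (lt_le_trans (mulr_gt0 hi hj)).
by apply: coefM_ge; apply: nneg_coefX; apply: nneg_trunc_pgf.
Qed.

Lemma supp_exp0 K n : 0 < (Phi K ^+ n)`_0.
Proof.
elim: n => [|n IHn]; first by rewrite expr0 coef1.
rewrite -(addn0 0%N) -addn1; apply: supp_expD => //.
by rewrite expr1 coef_trunc_pgf /=; apply: (cl_p0 cl).
Qed.

Lemma supp_expM K n i q : 0 < (Phi K ^+ n)`_i -> 0 < (Phi K ^+ (q * n))`_(q * i).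
Proof.
move=> h; elim: q => [|q IHq]; first by rewrite !mul0n expr0 coef1.
by rewrite !mulSn; apply: supp_expD.
Qed.

(** The span [d] of the law is the smallest positive difference of two values that
    one and the same sum of copies can take. It divides every attainable [j]: if
    not, adding multiples of [e] and of [e + d] to [0] and to [j] produces the
    smaller difference [j %% d]. *)
Lemma span_exists : exists d b e K1 : nat,
  [/\ (0 < d)%N, 0 < (Phi K1 ^+ b)`_e, 0 < (Phi K1 ^+ b)`_(e + d) &
      forall K n j, 0 < (Phi K ^+ n)`_j -> (d %| j)%N].
Proof.
pose D d := (0 < d)%N /\ exists b e K, 0 < (Phi K ^+ b)`_e /\ 0 < (Phi K ^+ b)`_(e + d).
have exD : exists d, `[< D d >].
  have [k k0 pk] := cl_branch cl; exists k; apply/asboolP; split => //.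
  exists 1%N, 0%N, k; split; first exact: supp_exp0.
  by rewrite expr1 coef_trunc_pgf leqnn.
case: (ex_minnP exD) => d /asboolP [d0 [b [e [K1 [h1 h2]]]]] dmin.
exists d, b, e, K1; split => // K n j hj.
rewrite /dvdn; apply/negPn/negP => hr; pose q := (j %/ d)%N.
pose K' := maxn K K1.
have hj' : 0 < (Phi K' ^+ n)`_j by apply: supp_exp_mono hj; rewrite leq_maxl.
have h1' : 0 < (Phi K' ^+ b)`_e by apply: supp_exp_mono h1; rewrite leq_maxr.
have h2' : 0 < (Phi K' ^+ b)`_(e + d) by apply: supp_exp_mono h2; rewrite leq_maxr.
have : D (j %% d)%N.
  split; first by rewrite lt0n.
  exists (n + q * b)%N, (0 + q * (e + d))%N, K'; split.
    by apply: supp_expD; [exact: supp_exp0 | exact: supp_expM].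
  rewrite [X in _`_X](_ : _ = j + q * e)%N; first by apply: supp_expD => //; apply: supp_expM.
  by have := divn_eq j d; rewrite -/q; lia.
by move=> /asboolP /dmin; rewrite leqNgt ltn_mod d0.
Qed.

Lemma centred_deriv_pgf1 K : (0 < K)%N ->
  `|(centred_deriv 1 (Phi K)).[1]| <= 2 * (m2 / K%:R).
Proof.
move=> K0; have hs : (size (centred_deriv 1 (Phi K)) <= K.+1)%N.
  by apply/leq_sizeP => i hi; rewrite coef_centred_deriv nth_default ?mulr0 // (leq_trans (size_poly _ _)).
rewrite (horner1E hs).
rewrite (eq_bigr (fun k : 'I_K.+1 => k%:R * p k - p k)); last first.
  move=> i _; rewrite coef_centred_deriv coef_trunc_pgf -ltnS ltn_ord; ring.
rewrite sumrB; have /andP[a1 a2] := cl_mass cl K0; have /andP[b1 b2] := cl_mean cl K0.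
have KR : 1 <= K%:R :> R by rewrite ler1n.
have m20 := second_moment_ge0.
have hK : m2 / K%:R ^+ 2 <= m2 / K%:R.
  apply: ler_wpM2l => //; rewrite lef_pV2 ?posrE ?exprn_gt0 ?(lt_le_trans ltr01) //.
  by rewrite expr2 ler_peMl // (le_trans ler01).
have hK0 : 0 <= m2 / K%:R by rewrite divr_ge0.
by rewrite ler_norml; apply/andP; split; lra.
Qed.

Lemma mom2_pgf_le K : mom2 1 (Phi K) <= m2 + 1.
Proof.
rewrite (mom2E _ (size_poly _ _ : (size (Phi K) <= K.+1)%N)).
have h := cl_second cl K.
apply: (@le_trans _ _ (\sum_(k < K.+1) (k%:R ^+ 2 * p k + (k == 0 :> nat)%:R * p k))).
  apply: ler_sum => k _; rewrite coef_trunc_pgf -ltnS ltn_ord -mulrDl.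
  apply: ler_wpM2r; first exact: (cl_ge0 cl).
  case: (val k) => [|i]; first by rewrite sub0r sqrrN expr1n expr0n add0r.
  rewrite addr0 lerXn2r ?nnegrE // ?subr_ge0 ?ler1n //.
  by rewrite gerBl.
rewrite big_split /=; apply: lerD => //.
rewrite big_ord_recl /= mul1r big1 ?addr0; last by move=> i _; rewrite mul0r.
have := cl_mass cl (ltn0Sn 0); rewrite big_ord_recl /= => /andP[_ h1].
apply: le_trans h1; rewrite lerDl; apply: sumr_ge0 => i _; exact: (cl_ge0 cl).
Qed.

End LocalLowerBound.

(** A block of length [b] is either tossed, as a fair coin with the outcomes [e] and
    [e + d], or left to [S]; [m] is the number of tossed blocks. *)
Lemma block_expansion (R : realType) (Psi S : {poly R}) (eps : R) b e d n :
  (0 < b)%N -> Psi ^+ b = S + eps *: ('X^e * (1 + 'X^d)) ->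
  Psi ^+ n = \sum_(m < (n %/ b).+1)
    ('C(n %/ b, m)%:R * eps ^+ m) *:
      ((Psi ^+ (n %% b) * S ^+ (n %/ b - m)) * ('X^(e * m) * (1 + 'X^d) ^+ m)).
Proof.
move=> b0 h; rewrite {1}(divn_eq n b) exprD mulnC exprM h exprDn mulr_suml.
apply: eq_bigr => m _.
rewrite exprZn exprMn -exprM -mulr_natl -!mul_polyC polyCM.
by rewrite -polyC_natr; ring.
Qed.

(** The [m] tossed blocks are symmetric about their mean [e * m + d * m / 2]. *)
Lemma coin_deriv1 (R : realType) e d m :
  (centred_deriv ((e * m)%:R + d%:R * m%:R / 2) ('X^(e * m) * (1 + 'X^d) ^+ m : {poly R})).[1] = 0.
Proof.
have h0 : (centred_deriv (d%:R / 2) (1 + 'X^d : {poly R})).[1] = 0.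
  rewrite /centred_deriv derivD derivXn -polyC1 derivC add0r !hornerE.
  by rewrite hornerMn !hornerXn !expr1n; field.
have h1 : (centred_deriv (d%:R * m%:R / 2) ((1 + 'X^d) ^+ m : {poly R})).[1] = 0.
  elim: m => [|m IHm].
    by rewrite expr0 /centred_deriv -polyC1 derivC !mulr0 mul0r scale0r subr0 horner0.
  rewrite exprSr (_ : d%:R * m.+1%:R / 2 = d%:R * m%:R / 2 + d%:R / 2); last first.
    by rewrite -natr1; ring.
  by rewrite centred_derivM hornerD !hornerM IHm h0 mul0r mulr0 addr0.
rewrite centred_derivM hornerD !hornerM h1 mulr0 addr0.
rewrite /centred_deriv derivXn !hornerE hornerMn !hornerXn !expr1n.
by rewrite ?mul1r ?mulr1 subrr mul0r.
Qed.

(** Integrated over a configuration, this is the union of two Markov bounds. *)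
Lemma one_le_good_or_bad (R : realType) (u v X Y : R) : 0 <= u -> 0 < v -> 0 <= X -> 0 < Y ->
  1 <= ((u <= v) && (X <= Y))%:R + (X / Y + u / v).
Proof.
move=> u0 v0 X0 Y0.
have p1 : 0 <= X / Y by rewrite divr_ge0 // ltW.
have p2 : 0 <= u / v by rewrite divr_ge0 // ltW.
case: (leP u v) => /= [_|k1]; last first.
  by rewrite add0r ler_wpDl // ler_pdivlMr // mul1r ltW.
case: (leP X Y) => /= k2; first by rewrite lerDl addr_ge0.
by rewrite add0r ler_wpDr // ler_pdivlMr // mul1r ltW.
Qed.

(** By [span_exists], a block of [b] summands contains a fair coin with the two
    outcomes [e] and [e + d]. With probability at least 1/2, there are of order [n]
    coins and what they have to complete lies within [O(sqrt n)] of their mean; the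
    excess of that value over [e] per coin is a multiple of [d], so that the coins
    hit it with probability of order [1 / sqrt n] by [bin_bulk_ge]. *)
Lemma local_lower_bound (R : realType) (p : nat -> R) (m2 : R) :
  critical_law p m2 -> exists c : R, exists K0 n1 : nat, 0 < c /\
  forall n K, (n1 <= n)%N -> (n + K0 <= K)%N -> 0 < (trunc_pgf p K ^+ n)`_n.-1 ->
    c / Num.sqrt n%:R <= (trunc_pgf p K ^+ n)`_n.-1.
Proof.
move=> cl; pose Phi := trunc_pgf p.
have [d [b [e [K1 [d0 he hed hspan]]]]] := span_exists cl.
pose eps := Num.min (Phi K1 ^+ b)`_e (Phi K1 ^+ b)`_(e + d).
have eps0 : 0 < eps by rewrite lt_min he hed.
have b0 : (0 < b)%N.
  rewrite lt0n; apply/eqP => b0; move: he hed; rewrite b0 expr0 !coef1.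
  clear -d0; case: e => [|e]; last by rewrite ltxx.
  by rewrite add0n; case: d d0 => // d _ _; rewrite ltxx.
have m20 := second_moment_ge0 cl.
(* sg * n bounds the second moment about n of the n-fold sum, so that by
   Chebyshev the deviation exceeds Bd * sqrt n with probability at most 1/8;
   at least kap times the number of blocks are tossed, up to probability 1/8;
   rt * n is then a lower bound for the number of coins. *)
pose sg : R := 4 * m2 ^+ 2 + m2 + 1.
have sg1 : 1 <= sg by rewrite /sg; nra.
pose Bd : R := 8 * sg.
have bR : 1 <= b%:R :> R by rewrite ler1n.
pose kap : R := eps / 4.
have kap0 : 0 < kap by rewrite divr_gt0.
pose rt : R := kap / (2 * b%:R).
have rt0 : 0 < rt by rewrite divr_gt0 // mulr_gt0 // (lt_le_trans ltr01).
pose A : R := (Bd + 1) / Num.sqrt rt.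
have srt0 : 0 < Num.sqrt rt by rewrite sqrtr_gt0.
have Bd0 : 0 < Bd by rewrite /Bd; lra.
have A0 : 0 < A by rewrite divr_gt0 // addr_gt0.
have [cb [mb [cb0 hbin]]] := bin_bulk_ge A0.
(* The threshold for n; each summand serves one of the four bounds below. *)
pose L : R := 1 + 4 * m2 + ((2 * Bd + 3) * (2 / rt)) ^+ 2 + (mb%:R + 4 * A ^+ 2 + 1) / rt.
exists (cb / 2), K1, (Num.truncn L).+1; split; first by rewrite divr_gt0.
move=> n K hn hK hpos.
have LN : L < n%:R by apply: (lt_le_trans (truncnS_gt L)); rewrite ler_nat.
have T2 : 0 <= ((2 * Bd + 3) * (2 / rt)) ^+ 2 by rewrite sqr_ge0.
have T3 : 0 <= (mb%:R + 4 * A ^+ 2 + 1) / rt by rewrite divr_ge0 ?(ltW rt0) // !addr_ge0 // mulr_ge0 // sqr_ge0.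
have n1R : 1 <= n%:R :> R by apply: ltW; apply: le_lt_trans LN; rewrite /L; lra.
have n0 : (0 < n)%N by rewrite -(ltr_nat R) (lt_le_trans ltr01).
have nm2 : 4 * m2 <= n%:R by apply: ltW; apply: le_lt_trans LN; rewrite /L; lra.
have nB : ((2 * Bd + 3) * (2 / rt)) ^+ 2 <= n%:R by apply: ltW; apply: le_lt_trans LN; rewrite /L; lra.
have nrt : mb%:R + 4 * A ^+ 2 + 1 <= rt * n%:R.
  by rewrite [rt * _]mulrC -ler_pdivrMr //; apply: ltW; apply: le_lt_trans LN; rewrite /L; lra.
set q := Num.sqrt (n%:R : R).
have q0 : 0 < q by rewrite sqrtr_gt0 (lt_le_trans ltr01).
have q2 : q ^+ 2 = n%:R by rewrite sqr_sqrtr.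
have qB : (2 * Bd + 3) * (2 / rt) <= q.
  rewrite -ler_sqr ?nnegrE ?q2 ?sqrtr_ge0 //.
  by apply: mulr_ge0; [rewrite addr_ge0 // mulr_ge0 // ltW | rewrite divr_ge0 // ltW].
have q1 : 1 <= q by rewrite -(ler_sqr (x := 1)) ?nnegrE ?q2 ?expr1n ?sqrtr_ge0.
have nK : (n <= K)%N by exact: leq_trans (leq_addr _ _) hK.
have K1K : (K1 <= K)%N by exact: leq_trans (leq_addl _ _) hK.
have K0 : (0 < K)%N by exact: leq_trans nK.
set Psi := Phi K.
have hPsi : nneg_coef Psi by exact: (nneg_trunc_pgf cl).
have hdn : (d %| n.-1)%N by exact: hspan hpos.
have hde : (d %| e)%N by exact: hspan he.
set U : {poly R} := eps *: ('X^e * (1 + 'X^d)).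
set S := Psi ^+ b - U.
have coefU i : U`_i = eps * ((i == e)%:R + (i == e + d)%N%:R).
  by rewrite coefZ mulrDr mulr1 -exprD coefD !coefXn.
have U0 : nneg_coef U by move=> i; rewrite coefU mulr_ge0 ?(ltW eps0) // addr_ge0.
have hS : nneg_coef S.
  move=> i; rewrite coefB coefU subr_ge0.
  have hi : (Phi K1 ^+ b)`_i <= (Psi ^+ b)`_i.
    apply: coef_exp_mono; first exact: (nneg_trunc_pgf cl).
    by move=> j; apply: (trunc_pgf_le cl).
  apply: le_trans hi; case: (eqVneq i e) => [->|_].
    rewrite (_ : (e == e + d)%N = false); last by clear -d0; lia.
    by rewrite addr0 mulr1 ge_min lexx.
  rewrite add0r; case: eqP => [->|_]; first by rewrite mulr1 ge_min lexx orbT.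
  by rewrite mulr0 nneg_coefX //; apply: (nneg_trunc_pgf cl).
have hPb : Psi ^+ b = S + U by rewrite subrK.
have SleP i : S`_i <= (Psi ^+ b)`_i by rewrite hPb [leRHS]coefD lerDl.
have /andP[mass_ge mass_le] := cl_mass cl K0; rewrite -trunc_pgf_sum -/Phi -/Psi in mass_ge mass_le.
have Psi0 : 0 <= Psi.[1] by rewrite nneg_coef_horner.
have U1 : U.[1] = eps *+ 2.
  by rewrite /U hornerZ hornerM hornerD !hornerXn !expr1n hornerC mul1r -mulr2n mulr_natr.
have S1 : S.[1] <= 1 - eps *+ 2.
  by rewrite -U1 hornerD hornerN lerD2r horner_exp exprn_ile1.
have S0 : 0 <= S.[1] by rewrite nneg_coef_horner.
have eps2 : 0 < eps *+ 2 <= 1.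
  by rewrite mulrn_wgt0 //= -subr_ge0 (le_trans S0 S1).
set l := (n %/ b)%N; set t := (n %% b)%N.
pose G m := Psi ^+ t * S ^+ (l - m).
pose B m : {poly R} := 'X^(e * m) * (1 + 'X^d) ^+ m.
have expansion : Psi ^+ n = \sum_(m < l.+1) ('C(l, m)%:R * eps ^+ m) *: (G m * B m).
  exact: block_expansion.
have hG m : nneg_coef (G m) by apply: nneg_coefM; apply: nneg_coefX.
have hB m : nneg_coef (B m).
  apply: nneg_coefM; first exact: nneg_coefXn.
  by apply: nneg_coefX; apply: nneg_coefD; [apply: nneg_coefC | apply: nneg_coefXn].
have B1 m : (B m).[1] = 2 ^+ m.
  by rewrite hornerM hornerXn horner_exp hornerD hornerC hornerXn !expr1n mul1r.
pose J := \max_(m < l.+1) size (G m).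
have hJ (m : 'I_l.+1) : (size (G m) <= J)%N by exact: (leq_bigmax m).
pose w m := 'C(l, m)%:R * (eps *+ 2) ^+ m.
have w0 m : 0 <= w m by rewrite mulr_ge0 // exprn_ge0 // mulrn_wge0 // ltW.
pose dev m (j : nat) : R := j%:R + (e * m)%:R + d%:R * m%:R / 2 - n%:R.
(* truncation at K >= n costs little mass, even to the power n *)
have mass : 3 / 4 <= \sum_(m < l.+1) \sum_(j < J) w m * (G m)`_j.
  have -> : \sum_(m < l.+1) \sum_(j < J) w m * (G m)`_j = (Psi ^+ n).[1].
    rewrite expansion horner_sum; apply: eq_bigr => m _.
    rewrite -mulr_sumr -(horner1E (hJ m)) hornerZ [(G m * B m).[1]]hornerM B1 /w -(mulr_natr eps 2) exprMn.
    by ring.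
  rewrite horner_exp; set x := m2 / K%:R ^+ 2 in mass_ge.
  have KR : n%:R <= K%:R :> R by rewrite ler_nat.
  have xle : x * n%:R <= 4^-1.
    rewrite /x mulrAC ler_pdivrMr; last by rewrite exprn_gt0 // (lt_le_trans _ KR) // (lt_le_trans ltr01).
    apply: (@le_trans _ _ (n%:R / 4 * n%:R)); first by rewrite ler_wpM2r //; move: nm2; clear -R; lra.
    have : n%:R * n%:R <= K%:R ^+ 2 :> R by rewrite expr2 ler_pM.
    by clear -R; lra.
  have x0 : 0 <= x by rewrite divr_ge0 // sqr_ge0.
  have x1 : x <= 1 by apply: (@le_trans _ _ (x * n%:R)); [rewrite ler_peMr | move: xle; clear -R; lra].
  apply: (@le_trans _ _ ((1 - x) ^+ n)); last first.
    by apply: lerXn2r => //; rewrite nnegrE // subr_ge0.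
  have := @bernoulli_ge R x n; rewrite x0 x1 => /(_ isT); move: xle; clear -R; lra.
(* the coins only add variance to the deviation of the remaining part *)
have second : \sum_(m < l.+1) \sum_(j < J) w m * (G m)`_j * dev m j ^+ 2 <= sg * n%:R.
  apply: (@le_trans _ _ (mom2 n%:R (Psi ^+ n))).
    rewrite expansion mom2_sum; apply: ler_sum => m _; rewrite mom2Z.
    have h := @mom2M_ge R (n%:R - ((e * m)%:R + d%:R * m%:R / 2))
       ((e * m)%:R + d%:R * m%:R / 2) (G m) (B m) (hG m) (hB m) (coin_deriv1 R e d m).
    rewrite subrK B1 in h.
    apply: (@le_trans _ _ ('C(l, m)%:R * eps ^+ m * (mom2 (n%:R - ((e * m)%:R + d%:R * m%:R / 2)) (G m) * 2 ^+ m))).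
      rewrite (mom2E _ (hJ m)) mulr_suml mulr_sumr; apply: ler_sum => j _.
      apply: le_of_eq.
      by rewrite /w /dev -(mulr_natr eps 2) exprMn; ring.
    by rewrite ler_wpM2l // mulr_ge0 // exprn_ge0 // ltW.
  apply: (le_trans (mom2X n mass_le hPsi)).
  have h1 := centred_deriv_pgf1 cl K0; rewrite -/Phi -/Psi in h1.
  have h2 := mom2_pgf_le cl K; rewrite -/Phi -/Psi in h2.
  have KR : n%:R <= K%:R :> R by rewrite ler_nat.
  have h3 : (n%:R * (centred_deriv 1 Psi).[1]) ^+ 2 <= (2 * m2) ^+ 2.
    rewrite -[leLHS]real_normK ?num_real //; apply: lerXn2r; rewrite ?nnegrE ?mulr_ge0 //.
    rewrite normrM (ger0_norm (ler0n _ n)).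
    apply: (le_trans (ler_wpM2l (ler0n R n) h1)).
    rewrite mulrCA ler_pM2l // mulrA ler_pdivrMr; last by rewrite (lt_le_trans _ KR) // (lt_le_trans ltr01).
    by rewrite mulrC ler_wpM2l.
  apply: (@le_trans _ _ ((2 * m2) ^+ 2 + n%:R * (m2 + 1))); first by rewrite lerD // ler_wpM2l.
  rewrite /sg exprMn; have : 4 * m2 ^+ 2 <= 4 * m2 ^+ 2 * n%:R by rewrite ler_peMr // mulr_ge0 // sqr_ge0.
  by clear -R; lra.
(* few tossed blocks are unlikely, by Markov for the inverse of their number *)
have few : \sum_(m < l.+1) \sum_(j < J) w m * (G m)`_j * (kap * l.+1%:R / m.+1%:R) <= 1 / 8.
  have h := binomial_mean_inv l eps2.
  apply: (@le_trans _ _ (kap * l.+1%:R * (eps *+ 2 * l.+1%:R)^-1)); last first.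
    rewrite /kap mulr2n; apply: le_of_eq; field.
    by rewrite nat1r pnatr_eq0 /= -mulr2n mulrn_eq0 /= gt_eqF.
  apply: le_trans (ler_wpM2l _ h); last by rewrite mulr_ge0 // ltW.
  rewrite mulr_sumr; apply: ler_sum => m _; rewrite -mulr_suml -mulr_sumr -(horner1E (hJ m)).
  have hGm : (G m).[1] <= (1 - eps *+ 2) ^+ (l - m).
    rewrite hornerM !horner_exp -[leRHS]mul1r; apply: ler_pM; rewrite ?exprn_ge0 //.
      by rewrite exprn_ile1.
    by rewrite lerXn2r ?nnegrE // (le_trans S0).
  rewrite [leRHS](_ : _ = w m * (1 - eps *+ 2) ^+ (l - m) * (kap * l.+1%:R / m.+1%:R)); last by rewrite /w; ring.
  by apply: ler_wpM2r; [rewrite divr_ge0 // mulr_ge0 // ltW | apply: ler_wpM2l].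
pose good m j := (kap * l.+1%:R <= m.+1%:R) && (dev m j ^+ 2 <= Bd ^+ 2 * n%:R).
have good_mass : 1 / 2 <= \sum_(m < l.+1) \sum_(j < J) w m * (G m)`_j * (good m j)%:R.
  (* total mass 3/4, minus 1/8 for each kind of bad configuration *)
  have bad : \sum_(m < l.+1) \sum_(j < J) w m * (G m)`_j <=
      \sum_(m < l.+1) \sum_(j < J) w m * (G m)`_j * (good m j)%:R +
      (\sum_(m < l.+1) \sum_(j < J) w m * (G m)`_j * (dev m j ^+ 2 / (Bd ^+ 2 * n%:R)) +
       \sum_(m < l.+1) \sum_(j < J) w m * (G m)`_j * (kap * l.+1%:R / m.+1%:R)).
    rewrite -!big_split /=; apply: ler_sum => m _.
    rewrite -!big_split /=; apply: ler_sum => j _.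
    have Bn0 : 0 < Bd ^+ 2 * n%:R by rewrite mulr_gt0 ?exprn_gt0 // (lt_le_trans ltr01).
    have := @one_le_good_or_bad R (kap * l.+1%:R) m.+1%:R (dev m j ^+ 2) (Bd ^+ 2 * n%:R).
    rewrite ltr0n sqr_ge0 mulr_ge0 ?(ltW kap0) // => /(_ isT isT isT Bn0).
    rewrite -/(good m j); move: (mulr_ge0 (w0 m) (hG m j)).
    move: (w m * _) (good m j) (dev m j ^+ 2 / _) (kap * _ / _) => x g u v x0 h1.
    rewrite -!mulrDr; by rewrite ler_peMr.
  have e2 : \sum_(m < l.+1) \sum_(j < J) w m * (G m)`_j * (dev m j ^+ 2 / (Bd ^+ 2 * n%:R)) <= 1 / 8.
    have -> : \sum_(m < l.+1) \sum_(j < J) w m * (G m)`_j * (dev m j ^+ 2 / (Bd ^+ 2 * n%:R)) =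
      (\sum_(m < l.+1) \sum_(j < J) w m * (G m)`_j * dev m j ^+ 2) / (Bd ^+ 2 * n%:R).
      rewrite mulr_suml; apply: eq_bigr => m _; rewrite mulr_suml; apply: eq_bigr => j _.
      by rewrite [LHS]mulrA.
    rewrite ler_pdivrMr ?mulr_gt0 ?exprn_gt0 // ?(lt_le_trans ltr01) //.
    apply: (le_trans second); rewrite mulrA ler_wpM2r // /Bd.
    by clear -R sg1; nra.
  move: bad e2 few mass; clear -R; lra.
(* a good configuration is completed by the coins *)
have ln : (l <= n)%N by exact: leq_div.
have lb : n%:R <= b%:R * l.+1%:R :> R.
  by rewrite -natrM ler_nat mulnC ltnW // ltn_ceil.
have completion (m : 'I_l.+1) (j : 'I_J) : 0 < (G m)`_j -> good m j ->
   2 ^+ m * (cb / q) <= if (j <= n.-1)%N then (B m)`_(n.-1 - j) else 0.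
  move=> Gj /andP[g1 g2].
  have hm : 2 * rt * n%:R <= m.+1%:R.
    apply: le_trans g1; rewrite /rt.
    have -> : 2 * (kap / (2 * b%:R)) * n%:R = kap * (n%:R / b%:R).
      by field; rewrite gt_eqF // (lt_le_trans ltr01).
    by rewrite ler_pM2l // ler_pdivrMr ?(lt_le_trans ltr01) // mulrC.
  have rtn1 : 1 <= rt * n%:R.
    by apply: le_trans nrt; rewrite lerDr addr_ge0 // mulr_ge0 // sqr_ge0.
  have hm' : rt * n%:R <= m%:R by move: hm rtn1; rewrite -natr1; clear -R; lra.
  have adev : `|dev m j| <= Bd * q.
    have Bq0 : 0 <= Bd * q by rewrite mulr_ge0 // ltW.
    rewrite -ler_sqr ?nnegrE //.
    by rewrite real_normK ?num_real // exprMn q2.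
  have dR : 1 <= d%:R :> R by rewrite ler1n.
  move: (adev); rewrite ler_norml => /andP[ad1 ad2].
  have rq : 2 * Bd + 3 <= rt / 2 * q.
    by move: qB; rewrite mulrA ler_pdivrMr //; clear -R; lra.
  have big : Bd * q + 1 <= d%:R * m%:R / 2.
    apply: (@le_trans _ _ (m%:R / 2)); last by rewrite ler_pM2r // ler_peMl.
    rewrite -q2 expr2 in hm'.
    have : (2 * Bd + 3) * q <= rt / 2 * q * q by rewrite ler_pM2r.
    have : 0 < Bd * q by rewrite mulr_gt0.
    by move: hm' q1; clear -R; lra.
  have hN : (j + e * m <= n.-1)%N.
    rewrite -(ler_nat R) natrD -subn1 natrB //.
    by move: ad2 big; rewrite /dev; clear -R; lra.
  have hdj : (d %| j)%N.
    apply: (hspan K (t + b * (l - m))%N); rewrite exprD exprM -/Psi.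
    apply: (lt_le_trans Gj); apply: coefM_le => //.
    - exact: nneg_coefX.
    - exact: nneg_coefX.
    - exact: coef_exp_mono.
  have hdN : (d %| n.-1 - (j + e * m))%N.
    by rewrite dvdn_sub // dvdn_add // dvdn_mulr.
  have jn : (j <= n.-1)%N by apply: leq_trans hN; rewrite leq_addr.
  rewrite jn /B coefXnM ltnNge (_ : e * m <= n.-1 - j)%N /=; last by clear -hN; lia.
  rewrite (_ : n.-1 - j - e * m = n.-1 - (j + e * m))%N; last by clear; lia.
  rewrite coef_add1Xn // hdN; set i := (_ %/ d)%N.
  have iE : d%:R * i%:R = n%:R - 1 - j%:R - (e * m)%:R :> R.
    rewrite -natrM mulnC divnK // natrB // natrD -subn1 natrB //.
    by ring.
  have idev : `|i%:R - m%:R / 2| <= (Bd + 1) * q.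
    have hh : d%:R * (i%:R - m%:R / 2) = - (dev m j + 1) by rewrite mulrBr iE /dev; ring.
    apply: (@le_trans _ _ (`|d%:R * (i%:R - m%:R / 2)|)).
      by rewrite normrM ger0_norm // ler_peMl.
    rewrite hh normrN; apply: (le_trans (ler_normD _ _)); rewrite normr1.
    by move: adev q1; clear -R; lra.
  set qm := Num.sqrt (m%:R : R).
  have qm2 : qm ^+ 2 = m%:R by rewrite sqr_sqrtr.
  have qmq : Num.sqrt rt * q <= qm.
    rewrite -sqrtrM ?(ltW rt0) //; exact: ler_wsqrtr.
  have idevm : `|i%:R - m%:R / 2| <= A * qm.
    apply: (le_trans idev); rewrite /A mulrAC ler_pdivlMr // -mulrA.
    by rewrite ler_pM2l ?addr_gt0 // mulrC.
  have mb_m : (mb <= m)%N.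
    rewrite -(ler_nat R); apply: le_trans hm'; apply: le_trans nrt.
    by rewrite -addrA lerDl addr_ge0 // mulr_ge0 // sqr_ge0.
  have A2m : (2 * A) ^+ 2 <= m%:R.
    apply: le_trans hm'; apply: le_trans nrt.
    by rewrite exprMn [X in X <= _](_ : _ = 4 * A ^+ 2); [have := ler0n R mb; clear -R; lra | ring].
  have qmA : 2 * A <= qm.
    by rewrite -ler_sqr ?nnegrE ?qm2 ?sqrtr_ge0 // mulr_ge0 // ltW.
  have him : (i <= m)%N.
    rewrite -(ler_nat R); move: idevm; rewrite ler_norml => /andP[_ hi].
    have h1 : A * qm <= m%:R / 2.
      have : 2 * A * qm <= qm * qm by apply: ler_wpM2r => //; exact: sqrtr_ge0.
      by rewrite -expr2 qm2; clear -R; lra.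
    by move: hi h1; clear -R; lra.
  apply: le_trans (hbin m i mb_m him idevm).
  rewrite mulrCA mulrA; rewrite -/qm.
  apply: ler_wpM2l; first by rewrite mulr_ge0 ?exprn_ge0 // ltW.
  have qm0 : 0 < qm by apply: lt_le_trans qmA; rewrite mulr_gt0.
  rewrite lef_pV2 ?posrE //; apply: ler_wsqrtr; rewrite ler_nat.
  by apply: leq_trans ln; rewrite -ltnS.
rewrite expansion coef_sum.
apply: (@le_trans _ _ (\sum_(m < l.+1) \sum_(j < J) w m * (G m)`_j * (good m j)%:R * (cb / q))).
  rewrite -(eq_bigr _ (fun m _ => mulr_suml _ _ _ _)) -mulr_suml.
  rewrite -/q [X in X <= _](_ : _ = 1 / 2 * (cb / q)); last by field; rewrite gt_eqF.
  by rewrite ler_pM2r // divr_gt0.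
apply: ler_sum => m _; rewrite coefZ (coefM_wide _ _ (hJ m)) mulr_sumr.
apply: ler_sum => j _.
rewrite [leLHS](_ : _ = 'C(l, m)%:R * eps ^+ m * ((G m)`_j * ((good m j)%:R * (2 ^+ m * (cb / q))))); last first.
  by rewrite /w -(mulr_natr eps 2) exprMn; ring.
apply: ler_wpM2l; first by rewrite mulr_ge0 // exprn_ge0 // ltW.
have := hG m j; rewrite le_eqVlt => /predU1P[<-|Gj]; first by rewrite !mul0r.
rewrite ler_pM2l //; case hg: (good m j); last by rewrite mul0r; case: ifP => // _; apply: hB.
by rewrite mul1r; apply: completion.
Qed.

(** * Lagrange inversion for the tree series *)

Section TreeSeries.
Variable R : realType.
Variable Phi : {poly R}.

(** Fixed-point iteration for [Y = 'X * (Phi \Po Y)]: [tree_series h] is the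
    generating polynomial, by number of vertices, of the plane trees of height less
    than [h], each individual with [k] children having weight [Phi`_k]. *)
Fixpoint tree_series (h : nat) : {poly R} :=
  if h is h'.+1 then 'X * (Phi \Po tree_series h') else 0.

Lemma tree_series_0 h : (tree_series h)`_0 = 0.
Proof. by case: h => [|h] /=; rewrite ?coef0 // coefXM. Qed.

Lemma tree_seriesX_0 h j : (tree_series h ^+ j)`_0 = (j == 0%N)%:R.
Proof.
elim: j => [|j IHj]; first by rewrite expr0 coef1.
by rewrite exprS coef0M tree_series_0 mul0r.
Qed.

(** Strong induction on [n], through [Y ^+ k = 'X^k * (Phi ^+ k \Po Y)]: expanding
    the composition reduces the claim to smaller coefficients of powers of [Y], and
    the resulting convolution is a coefficient of the derivative of [Phi ^+ n]. *)
Lemma lagrange_inversion n h k : (0 < n)%N -> (n <= h)%N ->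
  n%:R * (tree_series h ^+ k)`_n =
  if (k <= n)%N then k%:R * (Phi ^+ n)`_(n - k) else 0.
Proof.
elim/ltn_ind: n h k => n IHn h k n0; case: h => [|h] hn; first by rewrite leqNgt n0 in hn.
case: k => [|k].
  by rewrite expr0 coef1 leq0n mul0r gtn_eqF // mulr0.
set Q := Phi ^+ k.+1.
have -> : tree_series h.+1 ^+ k.+1 = 'X^(k.+1) * (Q \Po tree_series h).
  by rewrite /= exprMn /Q rmorphXn.
rewrite coefXnM ltnNge; have [kn|kn] /= := leqP k.+1 n; last by rewrite mulr0.
set m := (n - k.+1)%N; rewrite comp_polyE coef_sum.
have [m0|m0] := posnP m.
  have -> : n = k.+1 by lia.
  congr (_ * _); rewrite m0.
  have [q0|q0] := posnP (size Q).
    by rewrite q0 big_ord0 -/Q nth_default // q0.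
  rewrite (bigD1 (Ordinal q0)) //= coefZ tree_seriesX_0 mulr1 big1 ?addr0 // => i hi.
  rewrite coefZ tree_seriesX_0; case: eqP => [e|_]; last by rewrite mulr0.
  by case/negP: hi; apply/eqP/val_inj.
have mn : (m < n)%N by lia.
have mh : (m <= h)%N by lia.
have mR : m%:R != 0 :> R by rewrite pnatr_eq0 -lt0n.
apply: (mulfI mR).
rewrite mulrCA mulr_sumr.
rewrite (eq_bigr (fun i : 'I_(size Q) => ('X * Q^`())`_i *
    (if (i <= m)%N then (Phi ^+ m)`_(m - i) else 0))); last first.
  move=> i _; rewrite coefZ mulrCA IHn // coefXM coef_deriv.
  case: ifP => _; last by rewrite !mulr0.
  case: (nat_of_ord i) => [|j] /=; first by rewrite !mul0r mulr0.
  by rewrite -[_ *+ j.+1]mulr_natl; ring.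
rewrite -coefM_wide; last first.
  by apply/leq_sizeP => j hj; rewrite coefXM coef_deriv; case: j hj => [|j] hj //=; rewrite nth_default ?mul0rn.
have -> : 'X * Q^`() * Phi ^+ m = k.+1%:R *: ('X * Phi^`() * Phi ^+ n.-1).
  rewrite /Q deriv_exp /= (_ : n.-1 = k + m)%N; last by lia.
  by rewrite exprD -mul_polyC polyC_natr -[_ *+ k.+1]mulr_natr; ring.
have e : n%:R *: ('X * Phi^`() * Phi ^+ n.-1) = 'X * (Phi ^+ n)^`().
  by rewrite deriv_exp -mul_polyC polyC_natr -[_ *+ n]mulr_natr; ring.
rewrite coefZ mulrCA -coefZ e coefXM coef_deriv gtn_eqF //.
by rewrite prednK // -[_ *+ m]mulr_natl; ring.
Qed.

Hypothesis Phi_ge0 : nneg_coef Phi.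

Lemma nneg_comp_poly (P Q : {poly R}) : nneg_coef P -> nneg_coef Q -> nneg_coef (P \Po Q).
Proof.
move=> hP hQ; rewrite comp_polyE; apply: nneg_coef_sum => i _.
by apply: nneg_coefZ => //; apply: nneg_coefX.
Qed.

Lemma nneg_tree_series h : nneg_coef (tree_series h).
Proof.
elim: h => [|h IHh] /=; first by move=> i; rewrite coef0.
rewrite -['X]expr1; apply: nneg_coefM; first exact: nneg_coefXn.
exact: nneg_comp_poly.
Qed.

Lemma coef_comp_poly_mono (P A B : {poly R}) i : nneg_coef P -> nneg_coef A ->
  (forall j, A`_j <= B`_j) -> (P \Po A)`_i <= (P \Po B)`_i.
Proof.
move=> hP hA hAB; rewrite !comp_polyE !coef_sum; apply: ler_sum => j _.
by rewrite !coefZ; apply: ler_wpM2l; [exact: hP | exact: coef_exp_mono].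
Qed.

Lemma tree_series_mono h i : (tree_series h)`_i <= (tree_series h.+1)`_i.
Proof.
elim: h i => [|h IHh] i; first by rewrite coef0 nneg_tree_series.
rewrite [tree_series h.+1]/= [tree_series h.+2]/= !coefXM; case: ifP => // _.
by apply: coef_comp_poly_mono => //; exact: nneg_tree_series.
Qed.

Lemma coef_tree_series_stable n h h' : (n <= h)%N -> (n <= h')%N ->
  (tree_series h)`_n = (tree_series h')`_n.
Proof.
case: n => [|n] hn hn'; first by rewrite !tree_series_0.
have n0 : n.+1%:R != 0 :> R by rewrite pnatr_eq0.
apply: (mulfI n0).
by rewrite -[tree_series h]expr1 -[tree_series h']expr1 !lagrange_inversion.
Qed.

Lemma coef_tree_series n h : (0 < n)%N -> (n <= h)%N ->
  n%:R * (tree_series h)`_n = (Phi ^+ n)`_n.-1.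
Proof.
by move=> n0 hn; rewrite -[tree_series h]expr1 lagrange_inversion // n0 mul1r subn1.
Qed.

Lemma coef_tree_series_le n h : (0 < n)%N ->
  n%:R * (tree_series h)`_n <= (Phi ^+ n)`_n.-1.
Proof.
move=> n0; have [hn|hn] := leqP n h; first by rewrite coef_tree_series.
rewrite -(@coef_tree_series n n) // ler_wpM2l //.
have mono d : (tree_series h)`_n <= (tree_series (h + d))`_n.
  elim: d => [|d IHd]; first by rewrite addn0.
  by apply: (le_trans IHd); rewrite addnS; apply: tree_series_mono.
by have := mono (n - h)%N; rewrite subnKC // ltnW.
Qed.

Hypothesis Phi1 : Phi.[1] <= 1.

Lemma pgf_le1 (x : R) : 0 <= x <= 1 -> 0 <= Phi.[x] <= 1.
Proof.
move=> /andP[x0 x1]; rewrite nneg_coef_horner //=; apply: le_trans Phi1.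
rewrite !horner_coef; apply: ler_sum => i _; rewrite ler_wpM2l //.
by rewrite expr1n exprn_ile1.
Qed.

Lemma tree_series_le h (x : R) : 0 <= x <= 1 -> 0 <= (tree_series h).[x] <= x.
Proof.
move=> /[dup] hx /andP[x0 x1]; elim: h => [|h /andP[a0 a1]] /=.
  by rewrite horner0 lexx.
have /andP[b0 b1] : 0 <= Phi.[(tree_series h).[x]] <= 1.
  by apply: pgf_le1; rewrite a0 (le_trans a1).
by rewrite hornerM hornerX horner_comp mulr_ge0 //= ler_piMr.
Qed.

End TreeSeries.

(** * Moduli of complex numbers *)

Section ComplexModulus.
Variable R : realType.
Implicit Types (z : R[i]) (x : R).

(** The norm of [R[i]] takes values in [R[i]]; estimates are easier with its real
    part. *)
Definition cabs z : R := complex.Re `|z|.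

Lemma cabsE z : `|z| = (cabs z)%:C.
Proof. by rewrite /cabs normc_def. Qed.

Lemma cabs_ge0 z : 0 <= cabs z.
Proof. by rewrite -ler0c -cabsE. Qed.

Lemma cabsM z1 z2 : cabs (z1 * z2) = cabs z1 * cabs z2.
Proof. by apply: complexI; rewrite -cabsE normrM !cabsE rmorphM. Qed.

Lemma cabsV z : cabs z^-1 = (cabs z)^-1.
Proof. by apply: complexI; rewrite -cabsE normfV cabsE fmorphV. Qed.

Lemma cabsX z n : cabs (z ^+ n) = cabs z ^+ n.
Proof. by apply: complexI; rewrite -cabsE normrX cabsE rmorphXn. Qed.

Lemma cabsN z : cabs (- z) = cabs z.
Proof. by apply: complexI; rewrite -!cabsE normrN. Qed.

Lemma cabs_subC z1 z2 : cabs (z1 - z2) = cabs (z2 - z1).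
Proof. by rewrite -cabsN opprB. Qed.

Lemma cabs_real x : cabs x%:C = `|x|.
Proof. by rewrite /cabs normc_def /= expr0n addr0 sqrtr_sqr. Qed.

Lemma cabs0 : cabs 0 = 0.
Proof. by rewrite -[0]/(0%:C) cabs_real normr0. Qed.

Lemma cabs1 : cabs 1 = 1.
Proof. by rewrite -[1]/(1%:C) cabs_real normr1. Qed.

Lemma cabs_nat n : cabs n%:R = n%:R.
Proof. by rewrite -(rmorph_nat (@real_complex R)) cabs_real ger0_norm. Qed.

Lemma cabs_eq0 z : (cabs z == 0) = (z == 0).
Proof. by rewrite -(inj_eq (@complexI R)) -cabsE normr_eq0. Qed.

Lemma ler_cabsD z1 z2 : cabs (z1 + z2) <= cabs z1 + cabs z2.
Proof. by rewrite -lecR rmorphD -!cabsE ler_normD. Qed.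

Lemma ler_cabsB z1 z2 : cabs (z1 - z2) <= cabs z1 + cabs z2.
Proof. by rewrite -(cabsN z2) ler_cabsD. Qed.

Lemma lerB_cabs z1 z2 : cabs z1 - cabs z2 <= cabs (z1 - z2).
Proof. by rewrite lerBlDr -{1}(subrK z2 z1) ler_cabsD. Qed.

Lemma ler_cabs_sum (I : Type) (r : seq I) (D : pred I) (F : I -> R[i]) :
  cabs (\sum_(i <- r | D i) F i) <= \sum_(i <- r | D i) cabs (F i).
Proof.
elim/big_rec2: _ => [|i y x _ h]; first by rewrite cabs0.
by apply: (le_trans (ler_cabsD _ _)); rewrite lerD2l.
Qed.

Lemma cabs_sqr z : cabs z ^+ 2 = complex.Re z ^+ 2 + complex.Im z ^+ 2.
Proof. by rewrite /cabs normc_def /= sqr_sqrtr // addr_ge0 // sqr_ge0. Qed.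

Lemma Re_le_cabs z : complex.Re z <= cabs z.
Proof.
apply: (le_trans (ler_norm _)).
by rewrite -ler_sqr ?nnegrE ?cabs_ge0 // real_normK ?num_real // cabs_sqr lerDl sqr_ge0.
Qed.

Lemma cabs_sqrC z : (cabs z ^+ 2)%:C = z * (z^*)%C.
Proof. by rewrite rmorphXn /= -cabsE sqr_normc. Qed.

Lemma horner_cabs_le (P : {poly R}) (z : R[i]) : nneg_coef P ->
  cabs ((map_poly (@real_complex R) P).[z]) <= P.[cabs z].
Proof.
move=> hP; rewrite horner_coef size_map_poly horner_coef.
apply: (le_trans (ler_cabs_sum _ _ _)); apply: ler_sum => i _.
by rewrite coef_map /= cabsM cabsX cabs_real ger0_norm.
Qed.

End ComplexModulus.

(** * Averages over regular polygons *)

Section CircleAverages.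
Variable R : realType.
Notation C := R[i].
Implicit Types (P Q : {poly C}).

(** ['X^N - 1] splits over [R[i]] and is separable in characteristic 0. *)
Lemma prim_root_exists N : (0 < N)%N -> exists w : C, N.-primitive_root w.
Proof.
move=> N0; pose P : {poly C} := 'X^N - 1; have [r Dp] := closed_field_poly_normal P.
rewrite (monicP _) ?monicXnsubC // scale1r in Dp.
have rn1 : all N.-unity_root r by apply/allP => z; rewrite -root_prod_XsubC -Dp.
have sz_r : (N < (size r).+1)%N by rewrite -(size_prod_XsubC r id) -Dp size_XnsubC.
have [|z] := hasP (has_prim_root N0 rn1 _ sz_r); last by exists z.
by rewrite -separable_prod_XsubC -Dp cyclotomic.separable_Xn_sub_1 // pnatr_eq0 -lt0n.
Qed.

Variables (N : nat) (w : C).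
Hypothesis hw : N.-primitive_root w.

Lemma cabs_prim_root : cabs w = 1.
Proof.
apply/eqP; rewrite -(@pexpr_eq1 _ _ N) ?cabs_ge0 ?(prim_order_gt0 hw) //.
by rewrite -cabsX (prim_expr_order hw) cabs1.
Qed.

Lemma prim_root_neq0 : w != 0.
Proof. by rewrite -cabs_eq0 cabs_prim_root oner_eq0. Qed.

Lemma conj_prim_root : (w^*)%C = w^-1.
Proof.
apply: (mulfI prim_root_neq0).
by rewrite divff ?prim_root_neq0 // -cabs_sqrC cabs_prim_root expr1n.
Qed.

Lemma prim_root_orthogonality m n : (m < N)%N -> (n < N)%N ->
  \sum_(j < N) w ^+ j ^+ m * (w ^+ j) ^- n = if m == n then N%:R else 0.
Proof.
move=> hm hn; set a := w ^+ m * w ^- n.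
have e j : w ^+ j ^+ m * (w ^+ j) ^- n = a ^+ j.
  by rewrite /a exprMn !exprVn -!exprM mulnC [(j * n)%N]mulnC.
rewrite (eq_bigr (fun j : 'I_N => a ^+ j)) //.
have wn : w ^+ n != 0 by rewrite expf_neq0 // prim_root_neq0.
case: eqP => [mn|/eqP mn].
  rewrite (eq_bigr (fun=> 1)) ?sumr_const ?card_ord // => j _.
  by rewrite /a mn divff // expr1n.
have a1 : a - 1 != 0.
  rewrite subr_eq0; apply: contra mn => /eqP a1.
  have : w ^+ m = w ^+ n by rewrite -[RHS]mul1r -a1 /a mulfVK.
  by move/eqP; rewrite (eq_prim_root_expr hw) !modn_small.
have aN : a ^+ N = 1.
  by rewrite /a exprMn exprVn (exprAC w m N) (exprAC w n N) (prim_expr_order hw) !expr1n divr1.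
by apply: (mulfI a1); rewrite mulr0 -subrX1 aN subrr.
Qed.

(** Cauchy's formula; the average over [N] points replaces the integral without
    error because the degree is less than [N]. *)
Lemma coef_circle P (r : C) n : (size P <= N)%N -> (n < N)%N ->
  \sum_(j < N) P.[r * w ^+ j] * (w ^+ j) ^- n = P`_n * r ^+ n * N%:R.
Proof.
move=> hP hn.
transitivity (\sum_(j < N) \sum_(m < N) P`_m * r ^+ m * (w ^+ j ^+ m * (w ^+ j) ^- n)).
  apply: eq_bigr => j _; rewrite (horner_coef_wide _ hP) mulr_suml.
  by apply: eq_bigr => m _; rewrite exprMn !mulrA.
rewrite exchange_big /= (bigD1 (Ordinal hn)) //= -mulr_sumr prim_root_orthogonality //.
rewrite eqxx big1 ?addr0 // => m hm; rewrite -mulr_sumr prim_root_orthogonality //.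
case: eqP => [e|_]; last by rewrite mulr0.
by case/negP: hm; apply/eqP/val_inj.
Qed.

Lemma cabs_coef_le P (r : R) n : 0 <= r -> (size P <= N)%N -> (n < N)%N ->
  cabs P`_n * r ^+ n * N%:R <= \sum_(j < N) cabs P.[r%:C * w ^+ j].
Proof.
move=> r0 hP hn; have := congr1 (@cabs R) (coef_circle r%:C hP hn).
rewrite !cabsM cabsX cabs_real ger0_norm // cabs_nat => <-.
apply: (le_trans (ler_cabs_sum _ _ _)); apply: ler_sum => j _.
by rewrite cabsM cabsV !cabsX cabs_prim_root !expr1n invr1 mulr1.
Qed.

Lemma parseval P (r : R) : 0 <= r -> (size P <= N)%N ->
  \sum_(j < N) cabs P.[r%:C * w ^+ j] ^+ 2 =
  N%:R * \sum_(m < N) cabs P`_m ^+ 2 * (r ^+ 2) ^+ m.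
Proof.
move=> r0 hP; apply: complexI; rewrite rmorphM !rmorph_sum /= rmorph_nat.
transitivity (\sum_(j < N) \sum_(m < N) (P`_m)^*%C * r%:C ^+ m *
   (P.[r%:C * w ^+ j] * (w ^+ j) ^- m)).
  apply: eq_bigr => j _; rewrite cabs_sqrC mulrC.
  have -> : (P.[r%:C * w ^+ j])^*%C = \sum_(m < N) (P`_m)^*%C * r%:C ^+ m * (w ^+ j) ^- m.
    rewrite (horner_coef_wide _ hP) rmorph_sum; apply: eq_bigr => m _ /=.
    rewrite rmorphM rmorphXn rmorphM rmorphXn /= oppr0 -[r +i* 0]/(r%:C) conj_prim_root.
    by rewrite exprMn mulrA -!exprM exprVn.
  by rewrite mulr_suml; apply: eq_bigr => m _; ring.
rewrite exchange_big /= mulr_sumr; apply: eq_bigr => m _.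
rewrite -mulr_sumr coef_circle //.
rewrite rmorphM /= cabs_sqrC !rmorphXn /= -exprM mulnC exprM; ring.
Qed.

End CircleAverages.

(** * Polynomials in place of inverses *)

Section PolynomialInverses.
Variable R : realType.

Lemma exists_expr_le (q eps : R) n : 0 <= q < 1 -> 0 < eps ->
  exists2 L, (n < L)%N & q ^+ L <= eps.
Proof.
move=> /andP[q0 q1] e0.
have key L : q ^+ L * (1 + L%:R * (1 - q)) <= 1.
  elim: L => [|L IHL]; first by rewrite expr0 mul0r addr0 mulr1.
  apply: le_trans IHL; rewrite exprSr -mulrA ler_wpM2l ?exprn_ge0 // -natr1.
  have : 0 <= L%:R * (1 - q) ^+ 2 by rewrite mulr_ge0 // sqr_ge0.
  have : 0 <= (1 - q) ^+ 2 by rewrite sqr_ge0.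
  nra.
have a0 : 0 < 1 - q by rewrite subr_gt0.
exists (n + (Num.truncn ((eps * (1 - q))^-1)).+1)%N; first by rewrite -addSnnS leq_addr.
set L := (_ + _)%N.
have hL : eps^-1 <= 1 + L%:R * (1 - q).
  have h : (eps * (1 - q))^-1 <= L%:R.
    by apply: (le_trans (ltW (truncnS_gt _))); rewrite ler_nat leq_addl.
  by rewrite -(ler_pM2r a0) invfM mulfVK ?gt_eqF // in h; rewrite ler_wpDl.
have h1 : 0 < 1 + L%:R * (1 - q) by apply: lt_le_trans hL; rewrite invr_gt0.
have := key L; rewrite -ler_pdivlMr // => h; apply: (le_trans h).
by rewrite div1r -[leRHS]invrK lef_pV2 ?posrE ?invr_gt0.
Qed.

Definition cong_poly (S : nzRingType) n (P Q : {poly S}) :=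
  forall i, (i <= n)%N -> P`_i = Q`_i.

Lemma congM (S : nzRingType) n (P Q P' Q' : {poly S}) :
  cong_poly n P Q -> cong_poly n P' Q' -> cong_poly n (P * P') (Q * Q').
Proof.
move=> h h' i hi; rewrite !coefM; apply: eq_bigr => j _; rewrite h ?h' //.
  by apply: leq_trans hi; rewrite leq_subr.
by apply: leq_trans hi; rewrite -ltnS.
Qed.

(** This replaces the power series of [1 / Q]. For each root [zeta] of [Q], which
    lies outside the disc, dividing [1 - (X / zeta)^L] by [1 - X / zeta] gives a
    polynomial inverse with an error that is small on the disc and vanishes modulo
    [X^n.+1] once [L] is large; the product over the roots does for [Q]. *)
Lemma poly_inverse_approx (Q : {poly R[i]}) (r eps : R) n : 0 <= r -> 0 < eps ->
  (forall z, cabs z <= r -> Q.[z] != 0) ->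
  exists T, cong_poly n (T * Q) 1 /\
    forall z, cabs z <= r -> cabs ((T * Q).[z] - 1) <= eps.
Proof.
move=> r0 + hQ; have [s Qs] := closed_field_poly_normal Q.
have lc0 : lead_coef Q != 0.
  rewrite lead_coef_eq0; apply/eqP => Q0; have := hQ 0.
  by rewrite cabs0 Q0 horner0 eqxx => /(_ r0).
have hs zeta : zeta \in s -> r < cabs zeta.
  move=> hz; rewrite ltNge; apply/negP => /hQ; rewrite Qs hornerZ mulf_eq0 negb_or.
  by rewrite lc0 /= -rootE root_prod_XsubC hz.
suff H : forall eps, 0 < eps -> exists T, cong_poly n (T * \prod_(z <- s) ('X - z%:P)) 1 /\
    forall z, cabs z <= r -> cabs ((T * \prod_(z <- s) ('X - z%:P)).[z] - 1) <= eps.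
  move=> e0; have [T [h1 h2]] := H eps e0; exists ((lead_coef Q)^-1 *: T).
  rewrite Qs lead_coefZ lead_coef_prod_XsubC mulr1.
  have -> : (lead_coef Q)^-1 *: T * (lead_coef Q *: \prod_(z <- s) ('X - z%:P)) =
            T * \prod_(z <- s) ('X - z%:P).
    by rewrite -scalerAl -scalerAr scalerA mulVf // scale1r.
  by [].
elim: s hs {Qs} => [|zeta s IHs] hs e e0.
  exists 1; rewrite big_nil mulr1; split=> // z _.
  by rewrite hornerE subrr cabs0 ltW.
pose e' := Num.min (e / 3) 1.
have e'0 : 0 < e' by rewrite lt_min ltr01 divr_gt0.
have e'1 : e' <= 1 by rewrite ge_min lexx orbT.
have e'e : e' <= e / 3 by rewrite ge_min lexx.
have hs' z : z \in s -> r < cabs z by move=> hz; apply: hs; rewrite inE hz orbT.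
have [T [h1 h2]] := IHs hs' e' e'0.
have rz : r < cabs zeta by apply: hs; rewrite mem_head.
have cz : 0 < cabs zeta by apply: le_lt_trans rz.
have z0 : zeta != 0 by rewrite -cabs_eq0 gt_eqF.
have [|L nL hL] := @exists_expr_le (r / cabs zeta) e' n _ e'0.
  by rewrite divr_ge0 ?cabs_ge0 //= ltr_pdivrMr // mul1r.
pose Y : {poly R[i]} := zeta^-1 *: 'X.
pose T' : {poly R[i]} := - zeta^-1 *: \sum_(k < L) Y ^+ k.
have T'E : T' * ('X - zeta%:P) = 1 - Y ^+ L.
  have -> : 'X - zeta%:P = zeta *: (Y - 1).
    by rewrite scalerBr scalerA divff // scale1r alg_polyC.
  rewrite -scalerAl -scalerAr scalerA mulNr mulVf // scaleN1r mulrC -subrX1.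
  by rewrite opprB.
exists (T * T'); rewrite big_cons.
have -> : T * T' * (('X - zeta%:P) * \prod_(z <- s) ('X - z%:P)) =
   (1 - Y ^+ L) * (T * \prod_(z <- s) ('X - z%:P)) by rewrite -T'E; ring.
split.
  rewrite -[1 in X in cong_poly _ _ X](mulr1 (1 : {poly R[i]})); apply: congM => // i hi.
  rewrite coefB exprZn coefZ coefXn ltn_eqF ?mulr0 ?subr0 //.
  exact: leq_ltn_trans nL.
move=> z hz; have hb := h2 z hz; rewrite [((1 - _) * _).[z]]hornerM.
set a := (1 - _).[z]; set b := (T * _).[z] in hb *.
have ha : cabs (a - 1) <= e'.
  rewrite /a hornerD hornerN hornerC addrAC subrr add0r cabsN horner_exp hornerZ hornerX.
  rewrite cabsX cabsM cabsV; apply: le_trans hL.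
  apply: lerXn2r; rewrite ?nnegrE ?divr_ge0 ?mulr_ge0 ?invr_ge0 ?cabs_ge0 //.
  by rewrite mulrC ler_wpM2r // invr_ge0 ltW.
have -> : a * b - 1 = (a - 1) * (b - 1) + ((a - 1) + (b - 1)) by ring.
apply: (le_trans (ler_cabsD _ _)).
have h3 := ler_cabsD (a - 1) (b - 1); rewrite cabsM.
have h4 : cabs (a - 1) * cabs (b - 1) <= e' * 1.
  by apply: ler_pM; rewrite ?cabs_ge0 // (le_trans hb).
lra.
Qed.

End PolynomialInverses.

(** * Estimates at a point of the disc *)

Section PointwiseEstimates.
Variables (R : realType) (p : nat -> R) (m2 : R).
Hypothesis cl : critical_law p m2.
Notation toC := (map_poly (@real_complex R)).

Lemma expr_taylor2 (s : R) k : 0 <= s <= 1 ->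
  (1 - s) ^+ k <= 1 - k%:R * s + k%:R ^+ 2 * s ^+ 2.
Proof.
move=> /andP[s0 s1]; elim: k => [|k IHk].
  by rewrite expr0 expr0n /= !mul0r subr0 addr0.
rewrite exprS -natr1; set k' : R := k%:R in IHk *.
have k0 : 0 <= k' by [].
apply: (le_trans (ler_wpM2l _ IHk)); first by rewrite subr_ge0.
rewrite -subr_ge0.
have -> : 1 - (k' + 1) * s + (k' + 1) ^+ 2 * s ^+ 2 - (1 - s) * (1 - k' * s + k' ^+ 2 * s ^+ 2)
   = (k' + 1) * s ^+ 2 + k' ^+ 2 * s ^+ 2 * s by ring.
by rewrite addr_ge0 // !mulr_ge0 ?sqr_ge0 // addr_ge0.
Qed.

(** The left side is one term of the expansion of [(rho + (1 - rho)) ^ m.+1]. *)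
Lemma natX_expr_le1 (rho : R) m : 0 <= rho <= 1 -> m.+1%:R * rho ^+ m * (1 - rho) <= 1.
Proof.
move=> /andP[r0 r1]; have s0 : 0 <= 1 - rho by rewrite subr_ge0.
have e1 : (rho + (1 - rho)) ^+ m.+1 = 1 by rewrite addrC subrK expr1n.
have h1 : (1 < m.+2)%N by [].
rewrite exprDn (bigD1 (Ordinal h1)) //= subn1 expr1 bin1 in e1.
rewrite -[leRHS]e1 -[(_ * _) *+ _]mulr_natl mulrA lerDl.
by apply: sumr_ge0 => i _; rewrite mulrn_wge0 // mulr_ge0 ?exprn_ge0.
Qed.

(** Twice one term of the expansion of [(rho + (1 - rho)) ^ m.+2]. *)
Lemma natX2_expr_le (rho : R) m : 0 <= rho <= 1 ->
  (m.+2 * m.+1)%:R * rho ^+ m * (1 - rho) ^+ 2 <= 2.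
Proof.
move=> /andP[r0 r1]; have s0 : 0 <= 1 - rho by rewrite subr_ge0.
have e1 : (rho + (1 - rho)) ^+ m.+2 = 1 by rewrite addrC subrK expr1n.
have h2 : (2 < m.+3)%N by [].
rewrite exprDn (bigD1 (Ordinal h2)) //= in e1.
have h : (rho ^+ (m.+2 - 2) * (1 - rho) ^+ 2) *+ 'C(m.+2, 2) <= 1.
  rewrite -[leRHS]e1 lerDl; apply: sumr_ge0 => i _.
  by rewrite mulrn_wge0 // mulr_ge0 ?exprn_ge0.
have e2 : (m.+2 * m.+1 = 2 * 'C(m.+2, 2))%N by rewrite -[RHS]mul_bin_diag bin1.
rewrite subn2 /= -mulr_natl in h.
by rewrite e2 natrM -[leRHS]mulr1 -!mulrA ler_pM2l.
Qed.

Variables (K : nat).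
Let Phi := trunc_pgf p K.
Hypothesis K0 : (0 < K)%N.

Lemma horner_trunc (x : R) : Phi.[x] = \sum_(k < K.+1) p k * x ^+ k.
Proof.
rewrite (horner_coef_wide _ (size_poly _ _ : (size Phi <= K.+1)%N)).
by apply: eq_bigr => k _; rewrite coef_trunc_pgf -ltnS ltn_ord.
Qed.

Lemma horner_truncC (u : R[i]) : (toC Phi).[u] = \sum_(k < K.+1) (p k)%:C * u ^+ k.
Proof.
have hs : (size (toC Phi) <= K.+1)%N by rewrite size_map_poly size_poly.
rewrite (horner_coef_wide _ hs).
by apply: eq_bigr => k _; rewrite coef_map /= coef_trunc_pgf -ltnS ltn_ord.
Qed.

Lemma Phi_at1 : 0 <= Phi.[1] <= 1.
Proof.
rewrite nneg_coef_horner ?ler01 //=; last exact: nneg_trunc_pgf cl K.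
by rewrite trunc_pgf_sum; have /andP[] := cl_mass cl K0.
Qed.

Variables (u : R[i]).
Let rho := cabs u.
Let s := 1 - rho.
(** The truncation errors must not exceed the order of the distance [s] of [u] from
    the unit circle. *)
Hypothesis s_gt : m2 / K%:R <= 2 * m2 * s.
Hypothesis s0 : 0 < s.

Lemma rho01 : 0 <= rho <= 1.
Proof. by rewrite cabs_ge0 /= -subr_ge0 ltW. Qed.

Lemma s01 : 0 <= s <= 1.
Proof. by rewrite ltW //= gerBl cabs_ge0. Qed.

(** Second-order Taylor expansion at 1, where value and slope are 1 up to truncation
    errors. *)
Lemma pgf_sub_id_le : Phi.[rho] - rho <= 3 * m2 * s ^+ 2.
Proof.
have hrho : rho = 1 - s by rewrite /s subKr.
have h1 : Phi.[rho] <= \sum_(k < K.+1) (p k - s * (k%:R * p k) + s ^+ 2 * (k%:R ^+ 2 * p k)).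
  rewrite horner_trunc; apply: ler_sum => k _; rewrite hrho.
  apply: (le_trans (ler_wpM2l (cl_ge0 cl _) (expr_taylor2 k s01))).
  by apply: le_of_eq; ring.
rewrite big_split sumrB -!mulr_sumr /= in h1.
have /andP[_ a] := cl_mass cl K0; have /andP[b _] := cl_mean cl K0; have c := cl_second cl K.
have /andP[sg0 sl1] := s01.
have b' := ler_wpM2l sg0 b; have c' := ler_wpM2l (sqr_ge0 s) c.
have d' := ler_wpM2l sg0 s_gt.
have : rho = 1 - s by [].
move: h1 a b' c' d'; rewrite /= expr2; move: (\sum_(i < _) _) (\sum_(i < _) _) (\sum_(i < _) _) (m2 / _) => A B D E.
by nra.
Qed.

(** Since [p 0 > 0], cancellation among the terms of [Phi.[u]] already shows in
    its sum with the constant term: [|Phi(u) - p 0| <= Phi(rho) - p 0]. *)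
Lemma pgf_cabs_gap :
  2 * p 0%N * (Phi.[rho] - complex.Re (toC Phi).[u]) <= Phi.[rho] ^+ 2 - cabs (toC Phi).[u] ^+ 2.
Proof.
have hB : cabs ((toC Phi).[u] - (p 0%N)%:C) <= Phi.[rho] - p 0%N.
  rewrite horner_truncC horner_trunc !big_ord_recl /= !expr0 !mulr1.
  rewrite addrAC subrr add0r addrAC subrr add0r.
  apply: (le_trans (ler_cabs_sum _ _ _)); apply: ler_sum => i _.
  by rewrite cabsM cabsX cabs_real ger0_norm // (cl_ge0 cl).
have hB2 : cabs ((toC Phi).[u] - (p 0%N)%:C) ^+ 2 <= (Phi.[rho] - p 0%N) ^+ 2.
  by apply: lerXn2r; rewrite ?nnegrE ?cabs_ge0 // (le_trans _ hB) // cabs_ge0.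
rewrite cabs_sqr raddfB /= in hB2.
have e : complex.Im ((toC Phi).[u] - (p 0%N)%:C) = complex.Im (toC Phi).[u].
  by rewrite raddfB /= subr0.
rewrite e in hB2; rewrite cabs_sqr.
by move: hB2; move: (complex.Re _) (complex.Im _) => a b; nra.
Qed.

Hypothesis rho_le : rho <= cabs (toC Phi).[u].

(** As [|Phi(u)|] lies between [rho] and [Phi(rho)], which differ by [O(s^2)], there
    is room only for that much cancellation. *)
Lemma pgf_phase_le : Phi.[rho] - complex.Re (toC Phi).[u] <= 3 * m2 / p 0%N * s ^+ 2.
Proof.
have p0 := cl_p0 cl; have h1 := pgf_cabs_gap; have h2 := pgf_sub_id_le.
have /andP[r0 r1] := rho01; have /andP[a0 a1] := pgf_le1 (nneg_trunc_pgf cl K) (proj2 (andP Phi_at1)) rho01.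
have m20 := second_moment_ge0 cl.
have h3 : rho ^+ 2 <= cabs (toC Phi).[u] ^+ 2 by apply: lerXn2r; rewrite ?nnegrE ?cabs_ge0.
have h4 : Phi.[rho] ^+ 2 - rho ^+ 2 <= 2 * (3 * m2 * s ^+ 2).
  have -> : Phi.[rho] ^+ 2 - rho ^+ 2 = (Phi.[rho] + rho) * (Phi.[rho] - rho) by ring.
  have M0 : 0 <= 3 * m2 * s ^+ 2 by rewrite mulr_ge0 ?sqr_ge0 // mulr_ge0.
  apply: (le_trans (ler_wpM2l _ h2)); first by rewrite addr_ge0.
  by apply: ler_wpM2r => //; lra.
rewrite mulrAC ler_pdivlMr //.
move: h1 h3 h4; move: (3 * m2 * s ^+ 2) (Phi.[rho] - _) (Phi.[rho] ^+ 2) (rho ^+ 2) (cabs _ ^+ 2) => A B D E F.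
by lra.
Qed.

(** Termwise, [|rho^k - u^k|^2 <= 2 (rho^k - Re u^k)]. *)
Lemma phase_spread : \sum_(k < K.+1) p k * cabs (rho%:C ^+ k - u ^+ k) ^+ 2 <= 6 * m2 / p 0%N * s ^+ 2.
Proof.
have h := pgf_phase_le; have /andP[r0 r1] := rho01.
rewrite [leRHS](_ : _ = 2 * (3 * m2 / p 0%N * s ^+ 2)); last by ring.
apply: le_trans (ler_wpM2l (ler0n R 2) h).
rewrite horner_trunc horner_truncC raddf_sum -sumrB mulr_sumr; apply: ler_sum => k _.
rewrite -rmorphXn /= cabs_sqr raddfB /= raddfB /= sub0r sqrrN.
have hu : complex.Re (u ^+ k) ^+ 2 + complex.Im (u ^+ k) ^+ 2 = (rho ^+ k) ^+ 2.
  by rewrite -cabs_sqr cabsX.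
have hre : complex.Re (u ^+ k) <= rho ^+ k by rewrite -cabsX Re_le_cabs.
have hre2 : complex.Re ((p k)%:C * u ^+ k) = p k * complex.Re (u ^+ k).
  by case: (u ^+ k) => a b /=; rewrite mul0r subr0.
rewrite hre2 -mulrBr mulrCA; apply: ler_wpM2l; first exact: cl_ge0 cl _.
have rk1 : rho ^+ k <= 1 by rewrite exprn_ile1.
have rk0 : 0 <= rho ^+ k by rewrite exprn_ge0.
move: hu hre rk0 rk1; move: (complex.Re _) (complex.Im _) (rho ^+ k) => a b c.
by nra.
Qed.

Definition defect_const : R := (m2 + 1) / 2 + 3 * m2 / p 0%N + 5 * m2.

(** This bounds [u Phi'(u) - Phi(u)]. At [rho] it is [O(s)] because mean and mass
    are both 1 up to truncation. Passing from [rho^k] to [u^k] costs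
    [sum_k |k - 1| p_k |rho^k - u^k|], which is [O(s)] by the Cauchy-Schwarz
    inequality, the variance being finite and [phase_spread] being [O(s^2)]. *)
Lemma mean_defect_le : cabs (toC (centred_deriv 1 Phi)).[u] <= defect_const * s.
Proof.
have p0 := cl_p0 cl; have /andP[r0 r1] := rho01; have m20 := second_moment_ge0 cl.
have /andP[sg0 sl1] := s01.
set D := centred_deriv 1 Phi.
have szD : (size D <= K.+1)%N.
  by apply/leq_sizeP => i hi; rewrite coef_centred_deriv nth_default ?mulr0 // (leq_trans (size_poly _ _)).
have coefD (k : 'I_K.+1) : D`_k = (k%:R - 1) * p k.
  by rewrite coef_centred_deriv coef_trunc_pgf -ltnS ltn_ord.
have eD : (toC D).[u] = D.[rho]%:C - \sum_(k < K.+1) (D`_k)%:C * (rho%:C ^+ k - u ^+ k).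
  have szC : (size (toC D) <= K.+1)%N by rewrite size_map_poly.
  rewrite (horner_coef_wide _ szC) (horner_coef_wide _ szD) rmorph_sum -sumrB /=.
  apply: eq_bigr => k _; rewrite coef_map rmorphM rmorphXn /=; ring.
have h1 : cabs (\sum_(k < K.+1) (D`_k)%:C * (rho%:C ^+ k - u ^+ k)) <=
          ((m2 + 1) / 2 + 3 * m2 / p 0%N) * s.
  apply: (le_trans (ler_cabs_sum _ _ _)).
  (* Cauchy-Schwarz in the form a * b <= s / 2 * a^2 + b^2 / (2 * s) *)
  apply: (@le_trans _ _ (\sum_(k < K.+1) (s / 2 * ((k%:R - 1) ^+ 2 * Phi`_k) +
      (2 * s)^-1 * (p k * cabs (rho%:C ^+ k - u ^+ k) ^+ 2)))).
    apply: ler_sum => k _; rewrite coefD coef_trunc_pgf -ltnS ltn_ord cabsM cabs_real normrM.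
    rewrite (ger0_norm (cl_ge0 cl k)).
    have pk := cl_ge0 cl k.
    have := cabs_ge0 (rho%:C ^+ k - u ^+ k).
    rewrite -[(k%:R - 1) ^+ 2]real_normK ?num_real //.
    move: (`|k%:R - 1|) (cabs _) (p k) pk => a b pk pk0 b0.
    rewrite -subr_ge0.
    have -> : s / 2 * (a ^+ 2 * pk) + (2 * s)^-1 * (pk * b ^+ 2) - a * pk * b =
       pk * (s * a - b) ^+ 2 / (2 * s) by field; rewrite gt_eqF.
    by apply: divr_ge0; [rewrite mulr_ge0 ?sqr_ge0 | rewrite mulr_ge0 // ltW].
  rewrite big_split /= -!mulr_sumr -(mom2E 1 (size_poly _ _ : (size Phi <= K.+1)%N)).
  have a1 : s / 2 * mom2 1 Phi <= s / 2 * (m2 + 1).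
    by apply: ler_wpM2l; [rewrite divr_ge0 | exact: mom2_pgf_le cl K].
  have a2 : (2 * s)^-1 * (\sum_(k < K.+1) p k * cabs (rho%:C ^+ k - u ^+ k) ^+ 2) <=
     (2 * s)^-1 * (6 * m2 / p 0%N * s ^+ 2).
    by apply: ler_wpM2l phase_spread; rewrite invr_ge0 mulr_ge0.
  apply: (le_trans (lerD a1 a2)); apply: le_of_eq.
  by field; rewrite !gt_eqF.
have h2 : `|D.[rho]| <= 5 * m2 * s.
  have -> : D.[rho] = D.[1] - \sum_(k < K.+1) D`_k * (1 - rho ^+ k).
    rewrite (horner_coef_wide _ szD) (horner_coef_wide _ szD) -sumrB.
    by apply: eq_bigr => k _; rewrite expr1n; ring.
  apply: (le_trans (ler_normB _ _)).
  have b1 : `|D.[1]| <= 4 * m2 * s.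
    apply: (le_trans (centred_deriv_pgf1 cl K0)); move: s_gt; move: (m2 / _) => t; lra.
  have b2 : `|\sum_(k < K.+1) D`_k * (1 - rho ^+ k)| <= m2 * s.
    apply: (le_trans (ler_norm_sum _ _ _)).
    apply: (@le_trans _ _ (\sum_(k < K.+1) k%:R ^+ 2 * p k * s)); last first.
      by rewrite -mulr_suml ler_wpM2r //; exact: cl_second cl K.
    apply: ler_sum => k _; rewrite coefD normrM normrM (ger0_norm (cl_ge0 cl k)).
    have t0 : 0 <= 1 - rho ^+ k by rewrite subr_ge0 exprn_ile1.
    have t1 : 1 - rho ^+ k <= k%:R * s.
      have := @bernoulli_ge R s k s01; rewrite /s subKr -/rho -/s => h; lra.
    rewrite (ger0_norm t0); have pk := cl_ge0 cl k.
    have c1 : `|k%:R - 1| * (1 - rho ^+ k) <= k%:R * (k%:R * s).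
      case: (nat_of_ord k) t0 t1 => [|j] t0 t1.
        by rewrite expr0 subrr mulr0 mul0r.
      apply: ler_pM => //; rewrite ger0_norm; first by rewrite gerBl.
      by rewrite subr_ge0 ler1n.
    rewrite mulrAC (_ : _ ^+ 2 * _ * _ = k%:R * (k%:R * s) * p k); last by ring.
    exact: ler_wpM2r.
  apply: (le_trans (lerD b1 b2)); lra.
rewrite eD; apply: (le_trans (ler_cabsB _ _)); rewrite cabs_real /defect_const.
by rewrite [leRHS]mulrDl addrC lerD.
Qed.

End PointwiseEstimates.

Section FixedPointEstimates.
Variables (R : realType) (p : nat -> R) (m2 : R).
Hypothesis cl : critical_law p m2.
Notation toC := (map_poly (@real_complex R)).
Variable (K : nat).
Let Phi := trunc_pgf p K.
Hypothesis K0 : (0 < K)%N.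

Lemma second_moment_shift (j : nat) :
  \sum_(i < K.+1) ((j + i)%:R ^+ 2 * Phi`_(j + i)) <= m2.
Proof.
apply: le_trans (cl_second cl (j + K)).
rewrite -addnS big_split_ord /= -[leLHS]add0r; apply: lerD.
  by apply: sumr_ge0 => i _; rewrite mulr_ge0 ?sqr_ge0 ?(cl_ge0 cl).
apply: ler_sum => i _; apply: ler_wpM2l; first exact: sqr_ge0.
by rewrite coef_trunc_pgf; case: ifP => // _; exact: cl_ge0 cl _.
Qed.

(** Only a second moment is available, so that each derivative beyond the second
    costs one power of [1 - rho]. *)
Lemma derivn_pgf_le (rho c : R) j : 0 <= rho <= 1 -> 0 <= c ->
  (forall i, ((j + i) ^_ j)%:R * rho ^+ i * (1 - rho) ^+ j <= c) ->
  (Phi^`(j.+2)).[rho] * (1 - rho) ^+ j <= c * m2.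
Proof.
move=> /andP[r0 r1] c0 hc; have s0 : 0 <= 1 - rho by rewrite subr_ge0.
have hs : (size (Phi^`(j.+2)) <= K.+1)%N.
  apply/leq_sizeP => i hi; rewrite coef_derivn nth_default ?mul0rn //.
  by rewrite (leq_trans (size_poly _ _)) // (leq_trans hi) // leq_addl.
rewrite (horner_coef_wide _ hs) mulr_suml.
apply: le_trans (ler_wpM2l c0 (second_moment_shift j.+2)).
rewrite mulr_sumr; apply: ler_sum => i _.
rewrite coef_derivn -[_ *+ _ ^_ _]mulr_natl !ffactnS !addSn /=.
have P0 : 0 <= Phi`_(j + i).+2 by exact: nneg_trunc_pgf cl K _.
move: (hc i) P0; move: (Phi`_ _) => a h a0.
rewrite !natrM.
set b := ((j + i) ^_ j)%:R in h *.
have b0 : 0 <= b by [].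
have -> : (j + i).+2%:R * ((j + i).+1%:R * b) * a * rho ^+ i * (1 - rho) ^+ j =
   ((j + i).+2%:R * (j + i).+1%:R * a) * (b * rho ^+ i * (1 - rho) ^+ j) by ring.
have X0 : 0 <= (j + i).+2%:R * (j + i).+1%:R * a by rewrite !mulr_ge0.
apply: (le_trans (ler_wpM2l X0 h)).
rewrite mulrC ler_wpM2l // -mulrA expr2 -mulrA ler_wpM2l // ler_wpM2r //.
by rewrite ler_nat.
Qed.

Lemma derivn_pgfC_le (u : R[i]) (c : R) j : cabs u <= 1 -> 0 <= c ->
  (forall i, ((j + i) ^_ j)%:R * (cabs u) ^+ i * (1 - cabs u) ^+ j <= c) ->
  cabs ((toC Phi)^`(j.+2)).[u] * (1 - cabs u) ^+ j <= c * m2.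
Proof.
move=> u1 c0 hc; have r01 : 0 <= cabs u <= 1 by rewrite cabs_ge0.
apply: le_trans (derivn_pgf_le r01 c0 hc).
apply: ler_wpM2r; first by rewrite exprn_ge0 // subr_ge0.
rewrite derivn_map; apply: horner_cabs_le => i.
by rewrite coef_derivn mulrn_wge0 //; exact: nneg_trunc_pgf cl K _.
Qed.

Lemma deriv2_pgf_le (u : R[i]) : cabs u <= 1 -> cabs ((toC Phi)^`(2)).[u] <= m2.
Proof.
move=> u1; have := @derivn_pgfC_le u 1 0 u1 ler01; rewrite expr0 mulr1 mul1r; apply => i.
by rewrite ffactn0 mul1r mulr1 exprn_ile1 ?cabs_ge0.
Qed.

Lemma deriv3_pgf_le (u : R[i]) : cabs u <= 1 ->
  cabs ((toC Phi)^`(3)).[u] * (1 - cabs u) <= m2.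
Proof.
move=> u1; have := @derivn_pgfC_le u 1 1 u1 ler01; rewrite expr1 mul1r; apply => i.
by rewrite ffactn1 add1n natX_expr_le1 // cabs_ge0.
Qed.

Lemma deriv4_pgf_le (u : R[i]) : cabs u <= 1 ->
  cabs ((toC Phi)^`(4)).[u] * (1 - cabs u) ^+ 2 <= 2 * m2.
Proof.
move=> u1; have := @derivn_pgfC_le u 2 2 u1; apply => // i.
by rewrite !ffactnS ffactn0 muln1 add2n natX2_expr_le // cabs_ge0.
Qed.

(** Mean at most 1 and mass at most 1 give
    [sum_k k p_k rho^(k-1) <= p_1 + rho (1 - p_1)], and [1 - p_1 >= p_0]. *)
Lemma deriv1_pgf_le (rho : R) : 0 <= rho <= 1 -> 0 <= Phi^`().[rho] <= 1 - p 0%N * (1 - rho).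
Proof.
move=> /andP[r0 r1]; have dn : nneg_coef Phi^`().
  by move=> i; rewrite coef_deriv mulrn_wge0 //; exact: nneg_trunc_pgf cl K _.
rewrite nneg_coef_horner //=.
have szD : (size Phi^`() <= K)%N.
  by apply/leq_sizeP => i hi; rewrite coef_deriv nth_default ?mul0rn // (leq_trans (size_poly _ _)).
rewrite (horner_coef_wide _ szD).
have /andP[_] := cl_mean cl K0; rewrite big_ord_recl mul0r add0r => hM.
have /andP[_] := cl_mass cl K0.
case: (K) K0 hM szD => [//|k] _ hM _.
rewrite !big_ord_recl /= => hm.
have q0 : 0 <= \sum_(i < k) p (bump 0 (bump 0 i)) by apply: sumr_ge0 => i _; exact: cl_ge0 cl _.
move: hM; rewrite big_ord_recl /= mul1r.
set T := \sum_(i < k) _ => hM.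
have hp j : 0 <= Phi`_j <= p j.
  by rewrite coef_trunc_pgf; case: ifP => _; rewrite ?lexx ?(cl_ge0 cl).
have hc1 : Phi^`()`_0 * rho ^+ 0 <= p 1%N.
  by rewrite coef_deriv expr0 mulr1 mulr1n; have /andP[] := hp 1%N.
have h : \sum_(i < k) Phi^`()`_(lift ord0 i) * rho ^+ (lift ord0 i) <= rho * T.
  rewrite mulr_sumr; apply: ler_sum => i _.
  rewrite coef_deriv /= /bump /= !add1n -[_ *+ i.+2]mulr_natl exprS mulrC -mulrA.
  apply: ler_wpM2l => //; rewrite mulrC.
  have c0 : 0 <= i.+2%:R * Phi`_i.+2 by rewrite mulr_ge0 //; exact: nneg_trunc_pgf cl K _.
  apply: (@le_trans _ _ (i.+2%:R * Phi`_i.+2)); first by rewrite ler_piMr // exprn_ile1.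
  by apply: ler_wpM2l => //; have /andP[] := hp i.+2.
have p0 := cl_p0 cl; have p1 := cl_ge0 cl 1.
have h' : rho * T <= rho * (1 - p 1%N) by apply: ler_wpM2l => //; lra.
have h3 : p 0%N * (1 - rho) <= (1 - p 1%N) * (1 - rho).
  by apply: ler_wpM2r; rewrite ?subr_ge0 //; lra.
lra.
Qed.

Variables (n : nat) (z u : R[i]) (eta : R).
Hypotheses (n0 : (0 < n)%N) (nK : (n <= K)%N).
Let r : R := 1 - (2 * n%:R)^-1.
Let s := 1 - cabs u.
Hypotheses (zr : cabs z <= r) (ur : cabs u <= r).
(** [u] stands for [Y(z)], the equation [Y = z Phi(Y)] holding up to [eta]. *)
Hypothesis fix_err : cabs (z * (toC Phi).[u] - u) <= eta.
Hypothesis eta_le : eta <= p 0%N / 4 * (1 - r).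

Lemma natr_gt0 : 0 < n%:R :> R. Proof. by rewrite ltr0n. Qed.

Lemma radius_gap : 0 < 1 - r <= 2^-1.
Proof.
have h := natr_gt0; rewrite /r subKr invr_gt0 mulr_gt0 //=.
by rewrite invfM ler_piMr // invf_le1 // ler1n.
Qed.

Lemma gap_ge : 1 - r <= s. Proof. by rewrite lerD2l lerN2. Qed.

Lemma gap_gt0 : 0 < s.
Proof. by have /andP[h _] := radius_gap; apply: lt_le_trans gap_ge. Qed.

Lemma p0_le1 : 0 < p 0%N <= 1.
Proof.
rewrite (cl_p0 cl) /=; have /andP[_] := cl_mass cl (ltn0Sn 0).
apply: le_trans; rewrite big_ord_recl lerDl; apply: sumr_ge0 => i _; exact: cl_ge0 cl _.
Qed.

(** If [u] is small, the constant term [p 0] dominates; if not, [|Phi(u)|] is at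
    least [|z Phi(u)|], which is close to [|u|]. *)
Lemma pgf_cabs_ge : p 0%N / 4 <= cabs (toC Phi).[u].
Proof.
have /andP[p0 p1] := p0_le1; have /andP[g0 g1] := radius_gap.
have sg := gap_gt0.
have r01 : 0 <= cabs u <= 1 by rewrite cabs_ge0 /= -subr_ge0 ltW.
have z1 : cabs z <= 1 by apply: (le_trans zr); lra.
have h1 : p 0%N - cabs u <= cabs (toC Phi).[u].
  rewrite horner_truncC big_ord_recl expr0 mulr1 /=.
  set T := \sum_(i < K) _.
  have hT : cabs T <= cabs u.
    apply: (le_trans (ler_cabs_sum _ _ _)).
    apply: (@le_trans _ _ (\sum_(i < K) p (lift ord0 i) * cabs u)).
      apply: ler_sum => i _; rewrite cabsM cabsX cabs_real ger0_norm ?(cl_ge0 cl) //.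
      apply: ler_wpM2l; first exact: cl_ge0 cl _.
      have /andP[c0 c1] := r01.
      by rewrite exprS ler_piMr ?exprn_ile1.
    rewrite -mulr_suml ler_piMl ?cabs_ge0 //.
    have /andP[_] := cl_mass cl K0; apply: le_trans; rewrite big_ord_recl lerDr.
    exact: cl_ge0 cl _.
  have := lerB_cabs (p 0%N)%:C (- T); rewrite opprK cabsN cabs_real (ger0_norm (ltW p0)).
  by apply: le_trans; rewrite lerD2l lerN2.
have h2 : cabs u - eta <= cabs (toC Phi).[u].
  have fe := fix_err.
  have a := lerB_cabs u (u - z * (toC Phi).[u]).
  rewrite subKr cabs_subC in a.
  have b : cabs (z * (toC Phi).[u]) <= cabs (toC Phi).[u].
    by rewrite cabsM ler_piMl ?cabs_ge0.
  lra.
have : eta <= p 0%N / 8.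
  apply: (le_trans eta_le); apply: (@le_trans _ _ (p 0%N / 4 * 2^-1)); last lra.
  by apply: ler_wpM2l => //; rewrite divr_ge0 // ltW.
lra.
Qed.

(** The gain [(1 - r) |Phi(u)|] from [|z| <= r] outweighs [eta]. *)
Lemma cabs_le_pgf : cabs u <= cabs (toC Phi).[u].
Proof.
have h := pgf_cabs_ge; have /andP[g0 g1] := radius_gap.
have fe := fix_err; have el := eta_le.
have a := lerB_cabs u (u - z * (toC Phi).[u]).
rewrite subKr cabs_subC cabsM in a.
have b : cabs z * cabs (toC Phi).[u] <= r * cabs (toC Phi).[u].
  by apply: ler_wpM2r; rewrite ?cabs_ge0.
have c : p 0%N / 4 * (1 - r) <= cabs (toC Phi).[u] * (1 - r) by apply: ler_wpM2r => //; exact: ltW.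
lra.
Qed.

Definition stolz_const : R := 4 / p 0%N * (defect_const p m2 + 1).

(** [Phi(u) (1 - z Phi'(u))] is [Phi(u) - u Phi'(u)] up to [O(eta)]. Together with
    [slope_gap], this places the slope [z Phi'(u)] in a Stolz angle at 1. *)
Lemma one_sub_slope_le : cabs (1 - z * (toC Phi)^`().[u]) <= stolz_const * s.
Proof.
have /andP[p0 p1] := p0_le1; have sg := gap_gt0; have hs := gap_ge.
have m20 := second_moment_ge0 cl.
have s_gt : m2 / K%:R <= 2 * m2 * s.
  rewrite [leRHS](_ : _ = m2 * (2 * s)); last by ring.
  apply: ler_wpM2l => //; have := natr_gt0 => nR.
  have KR : n%:R <= K%:R :> R by rewrite ler_nat.
  apply: (@le_trans _ _ (n%:R^-1)).
    by rewrite lef_pV2 ?posrE // (lt_le_trans nR).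
  have : (2 * n%:R)^-1 <= s by move: hs; rewrite /r subKr.
  rewrite invfM => h; lra.
have h1 := mean_defect_le cl K0 s_gt sg cabs_le_pgf.
rewrite -/Phi -/s in h1.
have h2 := pgf_cabs_ge; have hP0 : 0 < cabs (toC Phi).[u] by apply: lt_le_trans h2; rewrite divr_gt0.
have hd : cabs (toC Phi)^`().[u] <= 1.
  have u1 : 0 <= cabs u <= 1 by rewrite cabs_ge0 /= -subr_ge0 ltW.
  have /andP[_ hh] := deriv1_pgf_le u1.
  rewrite deriv_map; apply: (le_trans (horner_cabs_le _ _)).
    by move=> i; rewrite coef_deriv mulrn_wge0 //; exact: nneg_trunc_pgf cl K _.
  apply: (le_trans hh); rewrite gerBl mulr_ge0 //; exact: ltW.
have e : (toC Phi).[u] * (1 - z * (toC Phi)^`().[u]) =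
   - (toC (centred_deriv 1 Phi)).[u] - (z * (toC Phi).[u] - u) * (toC Phi)^`().[u].
  rewrite /centred_deriv rmorphB rmorphM /= map_polyX scale1r deriv_map.
  by rewrite hornerD hornerN hornerM hornerX; ring.
have h3 : cabs (toC Phi).[u] * cabs (1 - z * (toC Phi)^`().[u]) <= (defect_const p m2 + 1) * s.
  rewrite -cabsM e; apply: (le_trans (ler_cabsB _ _)); rewrite cabsN cabsM.
  rewrite mulrDl mul1r; apply: lerD => //.
  apply: (@le_trans _ _ (eta * 1)).
    by apply: ler_pM; rewrite ?cabs_ge0.
  rewrite mulr1; apply: (le_trans eta_le); apply: le_trans hs.
  by rewrite ler_piMl //; [have /andP[/ltW] := radius_gap | lra].
have h4 : p 0%N / 4 * cabs (1 - z * (toC Phi)^`().[u]) <= (defect_const p m2 + 1) * s.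
  by apply: le_trans h3; apply: ler_wpM2r; rewrite ?cabs_ge0.
rewrite /stolz_const [leRHS](_ : _ = (p 0%N / 4)^-1 * ((defect_const p m2 + 1) * s)).
  by rewrite ler_pdivlMl ?divr_gt0.
by rewrite invf_div mulrA.
Qed.

Lemma slope_gap : p 0%N * s <= 1 - cabs (z * (toC Phi)^`().[u]).
Proof.
have /andP[p0 p1] := p0_le1; have sg := gap_gt0; have /andP[g0 g1] := radius_gap.
have u1 : 0 <= cabs u <= 1 by rewrite cabs_ge0 /= -subr_ge0 ltW.
have /andP[hh0 hh] := deriv1_pgf_le u1.
have h : cabs (toC Phi)^`().[u] <= Phi^`().[cabs u].
  rewrite deriv_map; apply: horner_cabs_le.
  by move=> i; rewrite coef_deriv mulrn_wge0 //; exact: nneg_trunc_pgf cl K _.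
rewrite lerBrDr -lerBrDl cabsM; apply: (@le_trans _ _ (1 * Phi^`().[cabs u])).
  by apply: ler_pM; rewrite ?cabs_ge0 //; apply: (le_trans zr); lra.
by rewrite mul1r; apply: (le_trans hh).
Qed.

End FixedPointEstimates.

(** * Slopes in a Stolz angle against tangential parameters *)

Section Resolvent.
Variable R : realType.

(** If [|1 - xF|] were much smaller than [|1 - x|], then [|F|] would be near 1: as
    [|xF|] is near 1 and [|x|] exceeds 1 by little compared with [|1 - x|], the gap
    [1 - |F|] would be small compared with [|1 - x|]. The Stolz condition would then
    make [|1 - F|] small too, against [1 - xF = (1 - F) + (1 - x) F]. *)
Lemma resolvent_ge (x F : R[i]) (kappa : R) : 1 <= kappa ->
  cabs (1 - F) <= kappa * (1 - cabs F) ->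
  cabs x <= 3 / 2 -> cabs x <= 1 + (4 * kappa)^-1 * cabs (1 - x) ->
  cabs (1 - x) <= 10 * (kappa + 1) * cabs (1 - x * F).
Proof.
move=> k1 hF x32 hx; have k0 : 0 < kappa by apply: lt_le_trans k1.
have F1 : cabs F <= 1.
  by rewrite -subr_ge0 -(pmulr_rge0 _ k0) (le_trans _ hF) // cabs_ge0.
have h1 : 1 - cabs x * cabs F <= cabs (1 - x * F).
  by have := lerB_cabs 1 (x * F); rewrite cabs1 cabsM.
have h2 : cabs (1 - x) * cabs F - cabs (1 - F) <= cabs (1 - x * F).
  have := lerB_cabs ((1 - x) * F) (- (1 - F)).
  rewrite cabsN opprK cabsM (_ : (1 - x) * F + (1 - F) = 1 - x * F); last by ring.
  exact.
have c0 := cabs_ge0 (1 - x); have cF := cabs_ge0 F; have cx := cabs_ge0 x.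
have c1x : cabs (1 - x) <= 1 + cabs x by have := ler_cabsB 1 x; rewrite cabs1.
set D := cabs (1 - x * F) in h1 h2 *; set X := cabs (1 - x) in h2 hx c0 c1x *.
set f := cabs F in F1 h1 h2 cF hF *; set a := cabs x in h1 hx x32 cx c1x.
have D0 : 0 <= D by exact: cabs_ge0.
have [f2|f2] := leP f 2^-1.
  have hD : 4^-1 <= D by nra.
  have : 10 * (kappa + 1) * 4^-1 <= 10 * (kappa + 1) * D by rewrite ler_wpM2l //; lra.
  lra.
have e1 : (4 * kappa)^-1 * kappa = 4^-1 by field; rewrite gt_eqF.
have h3 : 1 - f <= D + (4 * kappa)^-1 * X.
  have cX : 0 <= (4 * kappa)^-1 * X by rewrite mulr_ge0 // invr_ge0 mulr_ge0 // ltW.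
  have h5 : a * f <= (1 + (4 * kappa)^-1 * X) * f by apply: ler_wpM2r.
  have h6 : (4 * kappa)^-1 * X * f <= (4 * kappa)^-1 * X by rewrite ler_piMr.
  lra.
have h4 : kappa * (1 - f) <= kappa * D + 4^-1 * X.
  have h7 : kappa * ((4 * kappa)^-1 * X) = 4^-1 * X by rewrite mulrA [kappa * _]mulrC e1.
  by have := ler_wpM2l (ltW k0) h3; rewrite (mulrDr kappa D) h7.
have h8 : X * 2^-1 <= X * f by rewrite ler_wpM2l // ltW.
have h9 : 0 <= (kappa + 1) * D by rewrite mulr_ge0 // addr_ge0 // ltW.
lra.
Qed.

End Resolvent.

(** * Congruences modulo a power of X and Euler derivatives *)

Section CongPoly.
Variables (S : comNzRingType) (n : nat).
Implicit Types P Q : {poly S}.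

Definition euler_deriv P := 'X * P^`().

Lemma coef_euler_deriv P i : (euler_deriv P)`_i = i%:R * P`_i.
Proof. by rewrite coefXM coef_deriv; case: i => [|i] /=; rewrite ?mul0r // mulr_natl. Qed.

Lemma euler_derivM P Q : euler_deriv (P * Q) = euler_deriv P * Q + P * euler_deriv Q.
Proof. by rewrite /euler_deriv derivM; ring. Qed.

Lemma euler_derivD P Q : euler_deriv (P + Q) = euler_deriv P + euler_deriv Q.
Proof. by rewrite /euler_deriv derivD; ring. Qed.

Lemma euler_derivZ c P : euler_deriv (c *: P) = c *: euler_deriv P.
Proof. by rewrite /euler_deriv derivZ scalerAr. Qed.

Lemma euler_derivB P Q : euler_deriv (P - Q) = euler_deriv P - euler_deriv Q.
Proof. by rewrite /euler_deriv derivB; ring. Qed.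

Lemma euler_deriv1 : euler_deriv 1 = 0.
Proof. by rewrite /euler_deriv -polyC1 derivC mulr0. Qed.

Lemma cong_sym P Q : cong_poly n P Q -> cong_poly n Q P.
Proof. by move=> h i hi; rewrite h. Qed.

Lemma cong_trans Q P P' : cong_poly n P Q -> cong_poly n Q P' -> cong_poly n P P'.
Proof. by move=> h h' i hi; rewrite h // h'. Qed.

Lemma congD P Q P' Q' :
  cong_poly n P Q -> cong_poly n P' Q' -> cong_poly n (P + P') (Q + Q').
Proof. by move=> h h' i hi; rewrite !coefD h ?h'. Qed.

Lemma congN P Q : cong_poly n P Q -> cong_poly n (- P) (- Q).
Proof. by move=> h i hi; rewrite !coefN h. Qed.

Lemma congB P Q P' Q' :
  cong_poly n P Q -> cong_poly n P' Q' -> cong_poly n (P - P') (Q - Q').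
Proof. by move=> h h'; apply: congD => //; apply: congN. Qed.

Lemma congZ c P Q : cong_poly n P Q -> cong_poly n (c *: P) (c *: Q).
Proof. by move=> h i hi; rewrite !coefZ h. Qed.

Lemma cong_euler P Q : cong_poly n P Q -> cong_poly n (euler_deriv P) (euler_deriv Q).
Proof. by move=> h i hi; rewrite !coef_euler_deriv h. Qed.

Lemma cong_solve T A P Q : cong_poly n (T * A) 1 ->
  cong_poly n (A * P) Q -> cong_poly n P (T * Q).
Proof.
move=> hT h; apply: (@cong_trans (T * A * P)).
  by rewrite -{1}[P]mul1r; apply: congM => //; apply: cong_sym.
by rewrite -mulrA; apply: congM.
Qed.

Lemma euler_inverse T A : cong_poly n (T * A) 1 ->
  cong_poly n (euler_deriv T) (- (T ^+ 2 * euler_deriv A)).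
Proof.
move=> h; have := cong_euler h; rewrite euler_derivM euler_deriv1 => h1.
apply: (@cong_trans (T * (- (T * euler_deriv A)))).
  apply: (cong_solve h); rewrite mulrC => i hi.
  by have := h1 i hi; rewrite coefD coef0 coefN => /eqP; rewrite addr_eq0 => /eqP.
by rewrite expr2 mulrN mulrA.
Qed.

End CongPoly.

(** * Growth of a polynomial and of its Euler derivatives *)

Section Jets.
Variable R : realType.
Notation C := R[i].
Variables (n : nat) (D : set C) (t : C -> R).
Hypothesis t1 : forall z, D z -> 1 <= t z.

(** The scale [t] stands for [1 / (1 - |Y|)], and the Euler derivative of [Y] has order [t].
    That is why one Euler derivative is allowed to cost [t^2]: it differentiates a
    quantity of order [1 - |Y|] in a denominator. Congruence modulo [X^n.+1] is
    enough because only the coefficient of [X^n] matters in the end. *)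
Definition jet_le (k : nat) (M : R) (P : {poly C}) := exists P0 P1 P2 : {poly C},
  [/\ cong_poly n P P0, cong_poly n (euler_deriv P) P1,
      cong_poly n (euler_deriv (euler_deriv P)) P2 &
      forall z, D z -> [/\ cabs P0.[z] <= M * t z ^+ k, cabs P1.[z] <= M * t z ^+ (k + 2) &
                           cabs P2.[z] <= M * t z ^+ (k + 4)]].

Lemma jet_leM k l M M' P Q : 0 <= M -> 0 <= M' ->
  jet_le k M P -> jet_le l M' Q -> jet_le (k + l) (4 * M * M') (P * Q).
Proof.
move=> M0 M'0 [P0 [P1 [P2 [p0 p1 p2 hP]]]] [Q0 [Q1 [Q2 [q0 q1 q2 hQ]]]].
exists (P0 * Q0), (P1 * Q0 + P0 * Q1), (P2 * Q0 + P1 * Q1 + (P1 * Q1 + P0 * Q2)).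
split.
- exact: congM.
- by rewrite euler_derivM; apply: congD; apply: congM.
- rewrite (euler_derivM P Q) euler_derivD (euler_derivM _ Q) (euler_derivM P).
  by apply: congD; apply: congD; apply: congM.
move=> z hz; have [a0 a1 a2] := hP z hz; have [b0 b1 b2] := hQ z hz.
have tz := t1 hz; have tz0 : 0 <= t z by apply: le_trans tz.
have X i : 0 <= t z ^+ i by rewrite exprn_ge0.
have mm a b i j m : cabs a <= M * t z ^+ i -> cabs b <= M' * t z ^+ j -> (i + j = m)%N ->
    cabs (a * b) <= M * M' * t z ^+ m.
  move=> ha hb <-; rewrite cabsM exprD mulrACA.
  by apply: ler_pM; rewrite ?cabs_ge0.
have hM i : 0 <= M * M' * t z ^+ i by rewrite !mulr_ge0.
split; rewrite !(hornerD, hornerM).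
- have := mm _ _ _ _ _ a0 b0 erefl; have := hM (k + l)%N; lra.
- have c1 := mm _ _ _ _ (k + l + 2)%N a1 b0 (addnAC _ _ _).
  have c2 := mm _ _ _ _ (k + l + 2)%N a0 b1 (addnA _ _ _).
  apply: (le_trans (ler_cabsD _ _)); have := hM (k + l + 2)%N; lra.
- have c1 := mm _ _ _ _ (k + l + 4)%N a2 b0 (addnAC _ _ _).
  have c2 := mm _ _ _ _ (k + l + 4)%N a1 b1 (addnACA _ _ _ _).
  have c3 := mm _ _ _ _ (k + l + 4)%N a0 b2 (addnA _ _ _).
  apply: (le_trans (ler_cabsD _ _)).
  have d1 := ler_cabsD (P2.[z] * Q0.[z]) (P1.[z] * Q1.[z]).
  have d2 := ler_cabsD (P1.[z] * Q1.[z]) (P0.[z] * Q2.[z]).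
  lra.
Qed.

Lemma jet_leD k M M' P Q :
  jet_le k M P -> jet_le k M' Q -> jet_le k (M + M') (P + Q).
Proof.
move=> [P0 [P1 [P2 [p0 p1 p2 hP]]]] [Q0 [Q1 [Q2 [q0 q1 q2 hQ]]]].
exists (P0 + Q0), (P1 + Q1), (P2 + Q2); rewrite !euler_derivD; split; try exact: congD.
move=> z hz; have [a0 a1 a2] := hP z hz; have [b0 b1 b2] := hQ z hz.
by rewrite !hornerD !mulrDl; split; apply: (le_trans (ler_cabsD _ _)); apply: lerD.
Qed.

Lemma jet_leZ k M c P : 0 <= M -> jet_le k M P -> jet_le k (cabs c * M) (c *: P).
Proof.
move=> M0 [P0 [P1 [P2 [p0 p1 p2 hP]]]]; exists (c *: P0), (c *: P1), (c *: P2).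
rewrite !euler_derivZ; split; try exact: congZ.
move=> z hz; have [a0 a1 a2] := hP z hz; rewrite !hornerZ !cabsM -!mulrA.
by split; apply: ler_wpM2l; rewrite ?cabs_ge0.
Qed.

Lemma jet_le_mono k M M' P : M <= M' -> jet_le k M P -> jet_le k M' P.
Proof.
move=> MM [P0 [P1 [P2 [p0 p1 p2 hP]]]]; exists P0, P1, P2; split => // z hz.
have tz0 : 0 <= t z by apply: le_trans (t1 hz).
have [a0 a1 a2] := hP z hz.
by split; [apply: (le_trans a0) | apply: (le_trans a1) | apply: (le_trans a2)];
   rewrite ler_wpM2r // exprn_ge0.
Qed.

Lemma jet_le1 : jet_le 0 1 1.
Proof.
exists 1, 0, 0; rewrite euler_deriv1 /euler_deriv deriv0 mulr0; split => // z hz.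
have tz0 : 0 <= t z by apply: le_trans (t1 hz).
by rewrite !hornerC cabs1 cabs0 expr0 mulr1 lexx !mul1r !exprn_ge0.
Qed.

(** [Y] is the tree series; [F], [W], [V], [U] are [X] times the derivatives of
    [Phi] at [Y], from the first to the fourth, and [E] is an inverse of [1 - F].
    Euler derivatives of these are expressed through the same polynomials, so that
    bounds without derivatives suffice. *)
Section TreeJets.
Variables (Y F W V U E : {poly C}) (B : R).
Hypotheses (B1 : 1 <= B)
  (eqY : cong_poly n (euler_deriv Y) (Y + F * euler_deriv Y))
  (eqF : euler_deriv F = F + W * euler_deriv Y)
  (eqW : euler_deriv W = W + V * euler_deriv Y)
  (eqV : euler_deriv V = V + U * euler_deriv Y)
  (eqE : cong_poly n (E * (1 - F)) 1).
Hypotheses (hY : forall z, D z -> cabs Y.[z] <= B)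
  (hF : forall z, D z -> cabs F.[z] <= B)
  (hW : forall z, D z -> cabs W.[z] <= B)
  (hV : forall z, D z -> cabs V.[z] <= B * t z)
  (hU : forall z, D z -> cabs U.[z] <= B * t z ^+ 2)
  (hE : forall z, D z -> cabs E.[z] <= B * t z).

(* Derivative-free expressions of the Euler derivatives: the letter says of which
   polynomial, with N for Y, and the digit how many. *)
Let N1 := Y * E.
Let F1 := F + W * N1.
Let E1 := E ^+ 2 * F1.
Let N2 := N1 * E + Y * E1.
Let W1 := W + V * N1.
Let F2 := F1 + (W1 * N1 + W * N2).
Let V1 := V + U * N1.
Let W2 := W1 + (V1 * N1 + V * N2).

Lemma cong_N1 : cong_poly n (euler_deriv Y) N1.
Proof.
rewrite /N1 mulrC; apply: (cong_solve eqE) => i hi.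
by rewrite mulrBl mul1r coefB eqY // coefD addrK.
Qed.

Lemma cong_F1 : cong_poly n (euler_deriv F) F1.
Proof. by rewrite eqF; apply: congD => //; apply: congM => //; exact: cong_N1. Qed.

Lemma cong_E1 : cong_poly n (euler_deriv E) E1.
Proof.
apply: (cong_trans (euler_inverse eqE)); rewrite euler_derivB euler_deriv1 sub0r mulrN opprK.
by apply: congM => //; exact: cong_F1.
Qed.

Lemma cong_N2 : cong_poly n (euler_deriv (euler_deriv Y)) N2.
Proof.
apply: (cong_trans (cong_euler cong_N1)); rewrite euler_derivM.
by apply: congD; apply: congM => //; [exact: cong_N1 | exact: cong_E1].
Qed.

Lemma cong_W1 : cong_poly n (euler_deriv W) W1.
Proof. by rewrite eqW; apply: congD => //; apply: congM => //; exact: cong_N1. Qed.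

Lemma cong_V1 : cong_poly n (euler_deriv V) V1.
Proof. by rewrite eqV; apply: congD => //; apply: congM => //; exact: cong_N1. Qed.

Lemma cong_F2 : cong_poly n (euler_deriv (euler_deriv F)) F2.
Proof.
rewrite eqF euler_derivD (euler_derivM W).
apply: congD; first exact: cong_F1.
by apply: congD; apply: congM => //; [exact: cong_W1 | exact: cong_N1 | exact: cong_N2].
Qed.

Lemma cong_W2 : cong_poly n (euler_deriv (euler_deriv W)) W2.
Proof.
rewrite eqW euler_derivD (euler_derivM V).
apply: congD; first exact: cong_W1.
by apply: congD; apply: congM => //; [exact: cong_V1 | exact: cong_N1 | exact: cong_N2].
Qed.

Lemma tree_jet_bounds z : D z ->
  [/\ cabs N1.[z] <= B ^+ 2 * t z, cabs F1.[z] <= 2 * B ^+ 3 * t z,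
      cabs E1.[z] <= 2 * B ^+ 5 * t z ^+ 3, cabs N2.[z] <= 3 * B ^+ 6 * t z ^+ 3 &
   [/\ cabs W1.[z] <= 2 * B ^+ 3 * t z ^+ 2,
      cabs F2.[z] <= 7 * B ^+ 7 * t z ^+ 3 & cabs W2.[z] <= 7 * B ^+ 7 * t z ^+ 4]].
Proof.
move=> hz; have tz := t1 hz; have tz0 : 0 <= t z by apply: le_trans tz.
have B0 : 0 <= B by apply: le_trans B1.
have a := hY hz; have b := hF hz; have c := hW hz; have d := hV hz; have e := hU hz; have f := hE hz.
set T := t z in tz tz0 d e f *.
(* monomials grow with both exponents *)
have mono i j i' j' : (i <= i')%N -> (j <= j')%N -> B ^+ i * T ^+ j <= B ^+ i' * T ^+ j'.
  by move=> hi hj; apply: ler_pM; rewrite ?exprn_ge0 // ler_weXn2l.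
have pr (x y : C) (p q : R) : cabs x <= p -> cabs y <= q -> cabs (x * y) <= p * q.
  by move=> hx hy; rewrite cabsM; apply: ler_pM; rewrite ?cabs_ge0.
have pl (x y : C) (p q : R) : cabs x <= p -> cabs y <= q -> cabs (x + y) <= p + q.
  by move=> hx hy; apply: (le_trans (ler_cabsD _ _)); apply: lerD.
have n1 : cabs N1.[z] <= B ^+ 2 * T.
  by rewrite hornerM; apply: (le_trans (pr _ _ _ _ a f)); rewrite mulrA expr2.
have f1 : cabs F1.[z] <= 2 * B ^+ 3 * T.
  rewrite hornerD hornerM; apply: (le_trans (pl _ _ _ _ b (pr _ _ _ _ c n1))).
  have := mono 1%N 0%N 3%N 1%N isT isT; rewrite !expr1 expr0 mulr1 => h.
  rewrite (_ : B * (B ^+ 2 * T) = B ^+ 3 * T); [lra | ring].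
have e1 : cabs E1.[z] <= 2 * B ^+ 5 * T ^+ 3.
  rewrite hornerM horner_exp expr2; apply: (le_trans (pr _ _ _ _ (pr _ _ _ _ f f) f1)).
  by apply: le_of_eq; ring.
have n2 : cabs N2.[z] <= 3 * B ^+ 6 * T ^+ 3.
  rewrite hornerD hornerM [(Y * _).[_]]hornerM.
  apply: (le_trans (pl _ _ _ _ (pr _ _ _ _ n1 f) (pr _ _ _ _ a e1))).
  have := mono 3%N 2%N 6%N 3%N isT isT => h.
  rewrite (_ : B ^+ 2 * T * (B * T) = B ^+ 3 * T ^+ 2); last by ring.
  rewrite (_ : B * (2 * B ^+ 5 * T ^+ 3) = 2 * (B ^+ 6 * T ^+ 3)); last by ring.
  lra.
have w1 : cabs W1.[z] <= 2 * B ^+ 3 * T ^+ 2.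
  rewrite hornerD hornerM; apply: (le_trans (pl _ _ _ _ c (pr _ _ _ _ d n1))).
  have := mono 1%N 0%N 3%N 2%N isT isT; rewrite expr1 expr0 mulr1 => h.
  rewrite (_ : B * T * (B ^+ 2 * T) = B ^+ 3 * T ^+ 2); [lra | ring].
have v1 : cabs V1.[z] <= 2 * B ^+ 3 * T ^+ 3.
  rewrite hornerD hornerM; apply: (le_trans (pl _ _ _ _ d (pr _ _ _ _ e n1))).
  have := mono 1%N 1%N 3%N 3%N isT isT; rewrite !expr1 => h.
  rewrite (_ : B * T ^+ 2 * (B ^+ 2 * T) = B ^+ 3 * T ^+ 3); [lra | ring].
have f2 : cabs F2.[z] <= 7 * B ^+ 7 * T ^+ 3.
  have -> : F2.[z] = F1.[z] + (W1.[z] * N1.[z] + W.[z] * N2.[z]) by rewrite -!hornerM -!hornerD.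
  apply: (le_trans (pl _ _ _ _ f1 (pl _ _ _ _ (pr _ _ _ _ w1 n1) (pr _ _ _ _ c n2)))).
  have h1 := mono 3%N 1%N 7%N 3%N isT isT; rewrite expr1 in h1.
  have h2 := mono 5%N 3%N 7%N 3%N isT isT.
  rewrite (_ : 2 * B ^+ 3 * T ^+ 2 * (B ^+ 2 * T) = 2 * (B ^+ 5 * T ^+ 3)); last by ring.
  rewrite (_ : B * (3 * B ^+ 6 * T ^+ 3) = 3 * (B ^+ 7 * T ^+ 3)); last by ring.
  lra.
have w2 : cabs W2.[z] <= 7 * B ^+ 7 * T ^+ 4.
  have -> : W2.[z] = W1.[z] + (V1.[z] * N1.[z] + V.[z] * N2.[z]) by rewrite -!hornerM -!hornerD.
  apply: (le_trans (pl _ _ _ _ w1 (pl _ _ _ _ (pr _ _ _ _ v1 n1) (pr _ _ _ _ d n2)))).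
  have h1 := mono 3%N 2%N 7%N 4%N isT isT.
  have h2 := mono 5%N 4%N 7%N 4%N isT isT.
  rewrite (_ : 2 * B ^+ 3 * T ^+ 3 * (B ^+ 2 * T) = 2 * (B ^+ 5 * T ^+ 4)); last by ring.
  rewrite (_ : B * T * (3 * B ^+ 6 * T ^+ 3) = 3 * (B ^+ 7 * T ^+ 4)); last by ring.
  lra.
by [].
Qed.

(* 46 and 9 are the largest factor and exponent of B among all bounds of this part *)
Let M0 : R := 46 * B ^+ 9.

Lemma jet_const_le c i z j : D z -> 0 <= c -> c <= 46 -> (i <= 9)%N ->
  c * B ^+ i * t z ^+ j <= M0 * t z ^+ j.
Proof.
move=> hz c0 c46 hi; have tz0 : 0 <= t z by apply: le_trans (t1 hz).
apply: ler_wpM2r; first by rewrite exprn_ge0.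
apply: ler_pM => //; first by rewrite exprn_ge0 // (le_trans _ B1).
by rewrite ler_weXn2l.
Qed.

Lemma jet_scale_le z i j : D z -> (i <= j)%N -> t z ^+ i <= t z ^+ j.
Proof. by move=> hz hij; rewrite ler_weXn2l // t1. Qed.

Lemma jet_const_ge0 : 0 <= M0.
Proof. by rewrite mulr_ge0 // exprn_ge0 // (le_trans _ B1). Qed.

Let B0 : 0 <= B. Proof. exact: le_trans B1. Qed.

Lemma jet_bound_step z c i j j' (x : C) : D z -> 0 <= c -> c <= 46 -> (i <= 9)%N -> (j <= j')%N ->
  cabs x <= c * B ^+ i * t z ^+ j -> cabs x <= M0 * t z ^+ j'.
Proof.
move=> hz c0 c46 i9 jj h; apply: (le_trans h); apply: (@le_trans _ _ (M0 * t z ^+ j)).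
  exact: jet_const_le.
by rewrite ler_wpM2l ?jet_const_ge0 // jet_scale_le.
Qed.

Lemma jet_Y : jet_le 0 M0 Y.
Proof.
exists Y, N1, N2; split; [by [] | exact: cong_N1 | exact: cong_N2 | move=> z hz].
have [h1 _ _ h2 _] := tree_jet_bounds hz; have h0 := hY hz; split.
- by apply: (@jet_bound_step z 1 1 0) => //; rewrite ?ler1n // mul1r expr1 expr0 mulr1.
- by apply: (@jet_bound_step z 1 2 1) => //; rewrite ?ler1n // mul1r expr1.
- by apply: (@jet_bound_step z 3 6 3) => //; rewrite ler_nat.
Qed.

Lemma jet_W : jet_le 0 M0 W.
Proof.
exists W, W1, W2; split; [by [] | exact: cong_W1 | exact: cong_W2 | move=> z hz].
have [_ _ _ _ [h1 _ h2]] := tree_jet_bounds hz; have h0 := hW hz; split.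
- by apply: (@jet_bound_step z 1 1 0) => //; rewrite ?ler1n // mul1r expr1 expr0 mulr1.
- by apply: (@jet_bound_step z 2 3 2) => //; rewrite ler_nat.
- by apply: (@jet_bound_step z 7 7 4) => //; rewrite ler_nat.
Qed.

(** The Euler derivative of [G = 1 / (1 - xF)] is [x G^2] times that of [F]. One of
    the factors [G] is bounded by [g] and all the others by [B * t], so that [g]
    occurs only to the first power. *)
Lemma jet_resolvent (x : C) (g : R) G k :
  cong_poly n (G * (1 - x *: F)) 1 -> cabs x <= 2 -> 0 <= g ->
  (forall z, D z -> cabs G.[z] <= B * t z) ->
  (forall z, D z -> cabs G.[z] <= B * g * t z ^+ k) ->
  jet_le k (M0 * g) G.
Proof.
move=> eqG x2 g0 hG hg.
pose G1 := x *: (G ^+ 2 * F1); pose G2 := x *: (2 *: (G * G1 * F1) + G ^+ 2 * F2).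
have c1 : cong_poly n (euler_deriv G) G1.
  apply: (cong_trans (euler_inverse eqG)).
  rewrite euler_derivB euler_deriv1 sub0r mulrN opprK euler_derivZ -scalerAr.
  by apply: congZ; apply: congM => //; exact: cong_F1.
have c2 : cong_poly n (euler_deriv (euler_deriv G)) G2.
  apply: (cong_trans (cong_euler c1)); rewrite euler_derivZ; apply: congZ.
  rewrite euler_derivM; apply: congD.
    rewrite expr2 euler_derivM (_ : euler_deriv G * G + _ = 2 *: (G * euler_deriv G)); last first.
      by rewrite -mul_polyC polyC_natr; ring.
    rewrite -scalerAl; apply: congZ.
    by apply: congM => //; apply: congM.
  by apply: congM => //; apply: (cong_trans (cong_euler (cong_sym cong_F1))); exact: cong_F2.
exists G, G1, G2; split => // z hz.
have [_ h1 _ _ [_ h2 _]] := tree_jet_bounds hz; have a := hG z hz; have b := hg z hz.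
have tz0 : 0 <= t z by apply: le_trans (t1 hz).
set T := t z in tz0 h1 h2 a b *.
have T1 : 1 <= T by exact: t1.
have pr (x' y : C) (p q : R) : cabs x' <= p -> cabs y <= q -> cabs (x' * y) <= p * q.
  by move=> hx hy; rewrite cabsM; apply: ler_pM; rewrite ?cabs_ge0.
have pl (x' y : C) (p q : R) : cabs x' <= p -> cabs y <= q -> cabs (x' + y) <= p + q.
  by move=> hx hy; apply: (le_trans (ler_cabsD _ _)); apply: lerD.
have Bm i : (i <= 9)%N -> B ^+ i <= B ^+ 9 by move=> hi; rewrite ler_weXn2l.
have g1 : cabs G1.[z] <= 4 * B ^+ 5 * g * T ^+ (k + 2).
  rewrite hornerZ hornerM horner_exp expr2.
  apply: (le_trans (pr _ _ _ _ x2 (pr _ _ _ _ (pr _ _ _ _ b a) h1))).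
  by rewrite exprD; apply: le_of_eq; ring.
have g2 : cabs G2.[z] <= 46 * B ^+ 9 * g * T ^+ (k + 4).
  have -> : G2.[z] = x * (2 * (G.[z] * G1.[z] * F1.[z]) + G.[z] * G.[z] * F2.[z]).
    by rewrite -!hornerM -hornerZ -hornerD -hornerZ -expr2.
  have c2' : cabs (2 : C) <= 2 by rewrite cabs_nat.
  apply: (le_trans (pr _ _ _ _ x2 (pl _ _ _ _ (pr _ _ _ _ c2' (pr _ _ _ _ (pr _ _ _ _ a g1) h1))
    (pr _ _ _ _ (pr _ _ _ _ b a) h2)))).
  by rewrite !exprD; apply: le_of_eq; ring.
have gT i : 0 <= g * T ^+ i by rewrite mulr_ge0 ?exprn_ge0.
rewrite /M0; split.
- apply: (le_trans b); rewrite -[leLHS]mulrA -[leRHS]mulrA; apply: ler_wpM2r => //.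
  have := Bm 1%N isT; rewrite expr1; have : 0 <= B ^+ 9 by rewrite exprn_ge0.
  lra.
- apply: (le_trans g1); rewrite -[leLHS]mulrA -[leRHS]mulrA; apply: ler_wpM2r => //.
  have := Bm 5%N isT; have : 0 <= B ^+ 9 by rewrite exprn_ge0.
  lra.
- exact: g2.
Qed.

Lemma jet_E : jet_le 1 M0 E.
Proof.
rewrite -[M0]mulr1; apply: (@jet_resolvent 1) => //; rewrite ?scale1r ?cabs1 ?ler1n //.
by move=> z hz; rewrite mulr1 expr1; apply: hE.
Qed.

End TreeJets.
End Jets.

(** * Means of the tree scale over a circle *)

Section CircleMeans.
Variable R : realType.
Implicit Types (D : {poly R}).

Lemma sum_invsqrt_le M : \sum_(a < M) (Num.sqrt a.+1%:R)^-1 <= 2 * Num.sqrt M%:R :> R.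
Proof.
elim: M => [|M IHM]; first by rewrite big_ord0 sqrtr0 mulr0.
rewrite big_ord_recr /=; apply: (le_trans (lerD IHM (lexx _))).
set a := Num.sqrt (M%:R : R); set b := Num.sqrt (M.+1%:R : R).
have b0 : 0 < b by rewrite sqrtr_gt0.
have a0 : 0 <= a by rewrite sqrtr_ge0.
have a2 : a ^+ 2 = M%:R by rewrite sqr_sqrtr.
have b2 : b ^+ 2 = a ^+ 2 + 1 by rewrite a2 sqr_sqrtr // natr1.
rewrite -(ler_pM2r b0) mulrDl mulVf ?gt_eqF //.
nra.
Qed.

(** With [c^2 = a^2 + b^2], [c <= a + b] turns [1 / (a b)] into at most
    [(1/a + 1/b) / c]. *)
Lemma conv_invsqrt_le m :
  \sum_(i < m.+1) (Num.sqrt i.+1%:R)^-1 * (Num.sqrt (m - i).+1%:R)^-1 <= 4 :> R.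
Proof.
set c := Num.sqrt (m.+2%:R : R).
have c0 : 0 < c by rewrite sqrtr_gt0.
apply: (@le_trans _ _ (\sum_(i < m.+1) c^-1 * ((Num.sqrt i.+1%:R)^-1 + (Num.sqrt (m - i).+1%:R)^-1))).
  apply: ler_sum => i _.
  set a := Num.sqrt (i.+1%:R : R); set b := Num.sqrt ((m - i).+1%:R : R).
  have a0 : 0 < a by rewrite sqrtr_gt0.
  have b0 : 0 < b by rewrite sqrtr_gt0.
  have a2 : a ^+ 2 = i.+1%:R by rewrite sqr_sqrtr.
  have b2 : b ^+ 2 = (m - i).+1%:R by rewrite sqr_sqrtr.
  have c2 : c ^+ 2 = a ^+ 2 + b ^+ 2.
    rewrite a2 b2 sqr_sqrtr // -natrD; congr (_%:R).
    by have := ltn_ord i; lia.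
  have cab : c <= a + b.
    rewrite -ler_sqr ?nnegrE ?addr_ge0 ?(ltW a0) ?(ltW b0) ?(ltW c0) // c2 sqrrD.
    by rewrite lerD2r lerDl mulrn_wge0 // mulr_ge0 ?(ltW a0) ?(ltW b0).
  have -> : a^-1 + b^-1 = (a + b) * (a^-1 * b^-1) by field; rewrite !gt_eqF.
  rewrite mulrA ler_peMl ?mulr_ge0 ?invr_ge0 ?(ltW a0) ?(ltW b0) //.
  by rewrite mulrC ler_pdivlMr // mul1r.
rewrite -mulr_sumr big_split /=.
have e : \sum_(i < m.+1) (Num.sqrt (m - i).+1%:R)^-1 = \sum_(i < m.+1) (Num.sqrt i.+1%:R)^-1 :> R.
  rewrite (reindex_inj rev_ord_inj) /=; apply: eq_bigr => i _.
  by rewrite subSS subKn // -ltnS.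
rewrite e mulrC ler_pdivrMr //.
have h := sum_invsqrt_le m.+1.
have h2 : Num.sqrt (m.+1%:R : R) <= c by apply: ler_wsqrtr; rewrite ler_nat.
by lra.
Qed.

Lemma geometric_sum_le (q : R) N : 0 <= q < 1 -> \sum_(m < N) q ^+ m <= (1 - q)^-1.
Proof.
move=> /andP[q0 q1]; have s0 : 0 < 1 - q by rewrite subr_gt0.
rewrite -[leRHS]mul1r ler_pdivlMr // -opprB mulrN mulrC -subrX1 opprB gerBl.
exact: exprn_ge0.
Qed.

Lemma arith_geometric_sum_le (q : R) N : 0 <= q < 1 ->
  \sum_(m < N) m.+1%:R * q ^+ m <= (1 - q) ^- 2.
Proof.
move=> /andP[q0 q1]; have s0 : 0 < 1 - q by rewrite subr_gt0.
have e : (\sum_(m < N) m.+1%:R * q ^+ m) * (1 - q) ^+ 2 =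
   1 - N.+1%:R * q ^+ N + N%:R * q ^+ N.+1.
  elim: N => [|N IHN]; first by rewrite big_ord0 expr0; ring.
  by rewrite big_ord_recr mulrDl IHN /= -!natr1 !exprS; ring.
rewrite -[leRHS]mul1r ler_pdivlMr ?exprn_gt0 // e.
have : N%:R * q ^+ N.+1 <= N.+1%:R * q ^+ N.
  apply: ler_pM; rewrite ?exprn_ge0 ?ler_nat //.
  by rewrite exprS ler_piMl ?exprn_ge0 // ltW.
lra.
Qed.

Section InverseSqrtCoefficients.
Variables (A : R) (D : {poly R}).
Hypotheses (A0 : 0 <= A) (D0 : nneg_coef D)
  (hD : forall i, D`_i <= A / Num.sqrt i.+1%:R).

Lemma coef_sqr_le m : (D ^+ 2)`_m <= 4 * A ^+ 2.
Proof.
rewrite expr2 coefM.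
apply: (@le_trans _ _ (\sum_(i < m.+1) A ^+ 2 * ((Num.sqrt i.+1%:R)^-1 * (Num.sqrt (m - i).+1%:R)^-1))).
  by apply: ler_sum => i _; rewrite expr2 mulrACA; apply: ler_pM.
by rewrite -mulr_sumr mulrC ler_wpM2r ?sqr_ge0 // conv_invsqrt_le.
Qed.

Lemma coef_cube_le m : (D ^+ 3)`_m <= 8 * A ^+ 3 * Num.sqrt m.+1%:R.
Proof.
rewrite exprS coefM.
apply: (@le_trans _ _ (\sum_(i < m.+1) 4 * A ^+ 3 * (Num.sqrt i.+1%:R)^-1)).
  apply: ler_sum => i _.
  apply: (@le_trans _ _ (A / Num.sqrt i.+1%:R * (4 * A ^+ 2))).
    apply: ler_pM => //; last exact: coef_sqr_le.
    exact: nneg_coefX.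
  by apply: le_of_eq; ring.
rewrite -mulr_sumr; have h := sum_invsqrt_le m.+1.
have c0 : 0 <= 4 * A ^+ 3 by rewrite mulr_ge0 // exprn_ge0.
apply: (le_trans (ler_wpM2l c0 h)).
by apply: le_of_eq; ring.
Qed.

Notation toC := (map_poly (@real_complex R)).
Variables (N : nat) (w : R[i]) (r : R).
Hypotheses (hw : N.-primitive_root w) (r01 : 0 <= r < 1).
Hypothesis hN : forall i, (i <= 3)%N -> (size (D ^+ i) <= N)%N.

Lemma sqr_radius_gap : 0 <= r ^+ 2 < 1 /\ (1 - r ^+ 2)^-1 <= (1 - r)^-1.
Proof.
have /andP[r0 r1] := r01.
have h : r ^+ 2 <= r by rewrite expr2 ler_piMl // ltW.
have h1 : r ^+ 2 < 1 by apply: le_lt_trans r1.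
split; first by rewrite sqr_ge0.
by rewrite lef_pV2 ?posrE ?subr_gt0 // lerD2l lerN2.
Qed.

(** The fourth and the sixth powers are squares of moduli of the square and of the
    cube of [D], whose coefficients are easily bounded, so Parseval applies. *)
Lemma mean_pow4_le :
  \sum_(j < N) cabs (toC D).[r%:C * w ^+ j] ^+ 4 <= N%:R * (16 * A ^+ 4 / (1 - r)).
Proof.
have /andP[r0 r1] := r01; have [q01 qr] := sqr_radius_gap.
have e (j : 'I_N) : cabs (toC D).[r%:C * w ^+ j] ^+ 4 = cabs (toC (D ^+ 2)).[r%:C * w ^+ j] ^+ 2.
  by rewrite rmorphXn horner_exp cabsX -exprM.
rewrite (eq_bigr _ (fun j _ => e j)) (parseval hw) //; last by rewrite size_map_poly hN.
apply: ler_wpM2l => //.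
apply: (@le_trans _ _ (\sum_(m < N) 16 * A ^+ 4 * (r ^+ 2) ^+ m)).
  apply: ler_sum => m _; apply: ler_wpM2r; first by rewrite exprn_ge0 // sqr_ge0.
  have D2 : 0 <= (D ^+ 2)`_m by exact: nneg_coefX.
  rewrite coef_map /= cabs_real ger0_norm //.
  rewrite (_ : 16 * A ^+ 4 = (4 * A ^+ 2) ^+ 2); last by ring.
  by apply: lerXn2r; rewrite ?nnegrE ?coef_sqr_le // mulr_ge0 ?sqr_ge0.
rewrite -mulr_sumr; apply: ler_wpM2l; first by rewrite mulr_ge0 ?exprn_ge0.
exact: le_trans (geometric_sum_le _ q01) qr.
Qed.

Lemma mean_pow6_le :
  \sum_(j < N) cabs (toC D).[r%:C * w ^+ j] ^+ 6 <= N%:R * (64 * A ^+ 6 / (1 - r) ^+ 2).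
Proof.
have /andP[r0 r1] := r01; have [q01 qr] := sqr_radius_gap.
have e (j : 'I_N) : cabs (toC D).[r%:C * w ^+ j] ^+ 6 = cabs (toC (D ^+ 3)).[r%:C * w ^+ j] ^+ 2.
  by rewrite rmorphXn horner_exp cabsX -exprM.
rewrite (eq_bigr _ (fun j _ => e j)) (parseval hw) //; last by rewrite size_map_poly hN.
apply: ler_wpM2l => //.
apply: (@le_trans _ _ (\sum_(m < N) 64 * A ^+ 6 * (m.+1%:R * (r ^+ 2) ^+ m))).
  apply: ler_sum => m _; rewrite mulrA; apply: ler_wpM2r; first by rewrite exprn_ge0 // sqr_ge0.
  have D3 : 0 <= (D ^+ 3)`_m by exact: nneg_coefX.
  rewrite coef_map /= cabs_real ger0_norm //.
  have -> : 64 * A ^+ 6 * m.+1%:R = (8 * A ^+ 3 * Num.sqrt m.+1%:R) ^+ 2.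
    by rewrite exprMn sqr_sqrtr //; ring.
  by apply: lerXn2r; rewrite ?nnegrE ?coef_cube_le // !mulr_ge0 ?exprn_ge0 ?sqrtr_ge0.
rewrite -mulr_sumr; apply: ler_wpM2l; first by rewrite mulr_ge0 ?exprn_ge0.
apply: (le_trans (arith_geometric_sum_le _ q01)).
rewrite -!exprVn; apply: lerXn2r => //; rewrite nnegrE invr_ge0.
  by rewrite subr_ge0; have /andP[_ /ltW] := q01.
by rewrite subr_ge0 ltW.
Qed.

(** The power 5 is interpolated between 4 and 6: [2 u^5 <= q u^4 + u^6 / q], with
    [q = sqrt n] balancing the two means. *)
Lemma mean_pow5_le (b : R) (t : R[i] -> R) n : (0 < n)%N -> 0 <= b ->
  1 - r = (2 * n%:R)^-1 ->
  (forall j : 'I_N, 0 <= t (r%:C * w ^+ j) <= b * cabs (toC D).[r%:C * w ^+ j]) ->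
  \sum_(j < N) t (r%:C * w ^+ j) ^+ 5 <=
  N%:R * ((16 * (b * A) ^+ 4 + 128 * (b * A) ^+ 6) * (n%:R * Num.sqrt n%:R)).
Proof.
move=> n0 b0 rE ht; set q := Num.sqrt (n%:R : R).
have nR : 0 < n%:R :> R by rewrite ltr0n.
have q0 : 0 < q by rewrite sqrtr_gt0.
have q2 : q ^+ 2 = n%:R by rewrite sqr_sqrtr // ltW.
apply: (@le_trans _ _ (\sum_(j < N) (q / 2 * b ^+ 4 * cabs (toC D).[r%:C * w ^+ j] ^+ 4 +
     q^-1 / 2 * b ^+ 6 * cabs (toC D).[r%:C * w ^+ j] ^+ 6))).
  apply: ler_sum => j _; have /andP[t0 t1] := ht j.
  set v := cabs _ in t1 *; set u := t _ in t0 t1 *.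
  have h4 : u ^+ 4 <= b ^+ 4 * v ^+ 4 by rewrite -exprMn; apply: lerXn2r; rewrite ?nnegrE // (le_trans t0).
  have h6 : u ^+ 6 <= b ^+ 6 * v ^+ 6 by rewrite -exprMn; apply: lerXn2r; rewrite ?nnegrE // (le_trans t0).
  apply: (@le_trans _ _ (q / 2 * u ^+ 4 + q^-1 / 2 * u ^+ 6)).
    rewrite -subr_ge0.
    have -> : q / 2 * u ^+ 4 + q^-1 / 2 * u ^+ 6 - u ^+ 5 = (q - u) ^+ 2 * u ^+ 4 / (2 * q).
      by field; rewrite gt_eqF.
    by apply: divr_ge0; [rewrite mulr_ge0 ?sqr_ge0 ?exprn_ge0 | rewrite mulr_ge0 // ltW].
  by apply: lerD; rewrite -[leRHS]mulrA; apply: ler_wpM2l => //;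
     rewrite divr_ge0 // ?invr_ge0 ltW.
rewrite big_split /= -!mulr_sumr.
have h4 := mean_pow4_le; have h6 := mean_pow6_le.
have c4 : 0 <= q / 2 * b ^+ 4 by rewrite mulr_ge0 ?exprn_ge0 // divr_ge0 // ltW.
have c6 : 0 <= q^-1 / 2 * b ^+ 6 by rewrite mulr_ge0 ?exprn_ge0 // divr_ge0 // invr_ge0 ltW.
apply: (le_trans (lerD (ler_wpM2l c4 h4) (ler_wpM2l c6 h6))).
apply: le_of_eq.
by rewrite rE -q2; field; rewrite gt_eqF.
Qed.

End InverseSqrtCoefficients.

Section HeightChoice.
Variables (p : nat -> R) (m2 : R) (K : nat).
Hypotheses (cl : critical_law p m2) (K0 : (0 < K)%N).
Let Phi := trunc_pgf p K.
Let Y := tree_series Phi.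

(** The tree series increase with the height and stay bounded at [r < 1]
    together with their Euler derivatives, so that some increment is small. *)
Lemma small_increment (r eta : R) n : 0 <= r < 1 -> 0 < eta ->
  exists2 h, (n <= h)%N &
    (Y h.+1 - Y h).[r] <= eta /\ (euler_deriv (Y h.+1 - Y h)).[r] <= eta.
Proof.
move=> /andP[r0 r1] e0.
have nPhi : nneg_coef Phi by exact: (nneg_trunc_pgf cl).
have Phi1 : Phi.[1] <= 1 by have /andP[] := Phi_at1 cl K0.
have nY h : nneg_coef (Y h) by exact: nneg_tree_series.
have nE P : nneg_coef P -> nneg_coef (euler_deriv P).
  by move=> hP i; rewrite coef_euler_deriv mulr_ge0.
have nI h : nneg_coef (Y h.+1 - Y h) by move=> i; rewrite coefB subr_ge0 tree_series_mono.
pose S h := (Y h).[r] + (euler_deriv (Y h)).[r].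
have s0 : 0 < 1 - r by rewrite subr_gt0.
have Sb h : S h <= 1 + (1 - r)^-1.
  have /andP[_ y1] := tree_series_le nPhi Phi1 h (x := r) ltac:(by rewrite r0 ltW).
  apply: lerD; first by apply: (le_trans y1); exact: ltW.
  have szE : (size (euler_deriv (Y h)) <= size (Y h))%N.
    by apply/leq_sizeP => i hi; rewrite coef_euler_deriv nth_default ?mulr0.
  rewrite (horner_coef_wide _ szE).
  apply: (@le_trans _ _ (\sum_(i < size (Y h)) (Y h)`_i * (1 - r)^-1)).
    apply: ler_sum => i _; rewrite coef_euler_deriv mulrAC mulrC.
    apply: ler_wpM2l; first exact: nY.
    rewrite -[leRHS]mul1r ler_pdivlMr //.
    case: (nat_of_ord i) => [|m]; first by rewrite !mul0r.
    have := @natX_expr_le1 R r m ltac:(by rewrite r0 ltW); apply: le_trans.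
    apply: ler_wpM2r; first exact: ltW.
    by apply: ler_wpM2l => //; rewrite exprS ler_piMl ?exprn_ge0 // ltW.
  rewrite -mulr_suml -(horner1E (leqnn _)) ler_piMl ?invr_ge0 ?(ltW s0) //.
  have /andP[_ y2] := tree_series_le nPhi Phi1 h (x := 1) ltac:(by rewrite ler01 lexx).
  exact: y2.
have [h nh hh] : exists2 h, (n <= h)%N & S h.+1 - S h <= eta.
  apply: contrapT => H.
  have grow j : j%:R * eta <= S (n + j)%N.
    elim: j => [|j IHj].
      by rewrite mul0r addn0 addr_ge0 // nneg_coef_horner //; apply: nE.
    rewrite addnS -natr1 mulrDl mul1r leNgt; apply/negP => lt.
    by apply: H; exists (n + j)%N; [rewrite leq_addr | lra].
  pose j := (Num.truncn ((1 + (1 - r)^-1) / eta)).+1.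
  have : (1 + (1 - r)^-1) / eta < j%:R by exact: truncnS_gt.
  rewrite ltr_pdivrMr // => lt; have := lt_le_trans lt (grow j).
  by rewrite ltNge Sb.
exists h => //.
have a0 : 0 <= (Y h.+1 - Y h).[r] by rewrite nneg_coef_horner.
have b0 : 0 <= (euler_deriv (Y h.+1 - Y h)).[r] by rewrite nneg_coef_horner //; apply: nE.
have e : S h.+1 - S h = (Y h.+1 - Y h).[r] + (euler_deriv (Y h.+1 - Y h)).[r].
  by rewrite /S euler_derivB !hornerD !hornerN; ring.
rewrite e in hh; split; lra.
Qed.

End HeightChoice.
End CircleMeans.

(** * The tree series on the disc *)

Section SlopeSeries.
Variable S : comNzRingType.

(** For [j = 0] this is one step of the recursion for the tree series; for [j = 1]
    it is the slope at [Y] of the map [Y |-> X * Phi(Y)]. *)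
Definition slope_series (Phi Y : {poly S}) j := 'X * (Phi^`(j) \Po Y).

Lemma euler_slope_series (Phi Y : {poly S}) j :
  euler_deriv (slope_series Phi Y j) =
  slope_series Phi Y j + slope_series Phi Y j.+1 * euler_deriv Y.
Proof.
by rewrite /euler_deriv /slope_series derivM derivX deriv_comp -derivnS; ring.
Qed.

Lemma cong_comp_poly n (Q P P' : {poly S}) : cong_poly n P P' -> cong_poly n (Q \Po P) (Q \Po P').
Proof.
move=> h; rewrite !comp_polyE => i hi; rewrite !coef_sum; apply: eq_bigr => j _.
rewrite !coefZ; congr (_ * _); elim: (nat_of_ord j) i hi => [|k IHk] //.
by rewrite !exprS; apply: congM.
Qed.

Lemma cong_slope_series n (Phi P P' : {poly S}) j : cong_poly n P P' ->
  cong_poly n (slope_series Phi P j) (slope_series Phi P' j).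
Proof. by move=> h; apply: congM => //; apply: cong_comp_poly. Qed.

End SlopeSeries.

Section DiscFacts.
Variables (R : realType) (p : nat -> R) (m2 : R).
Hypothesis cl : critical_law p m2.
Notation toC := (map_poly (@real_complex R)).
Variables (K n h : nat).
Hypotheses (n0 : (0 < n)%N) (nK : (n <= K)%N) (nh : (n <= h)%N).
Let Phi := trunc_pgf p K.
Let Ys := tree_series Phi.
Let Y := toC (Ys h).
Let r : R := 1 - (2 * n%:R)^-1.
Let eta : R := p 0%N / 16 * (1 - r).
(** A small increment from height [h] to [h + 1] makes [Y] an approximate fixed
    point on the whole disc of radius [r]. *)
Hypothesis inc0 : (Ys h.+1 - Ys h).[r] <= eta.
Hypothesis inc1 : (euler_deriv (Ys h.+1 - Ys h)).[r] <= eta.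

Let K0 : (0 < K)%N. Proof. exact: leq_trans nK. Qed.
Let nPhi : nneg_coef Phi. Proof. exact: (nneg_trunc_pgf cl). Qed.
Let Phi1 : Phi.[1] <= 1. Proof. by have /andP[] := Phi_at1 cl K0. Qed.
Let p01 : 0 < p 0%N <= 1. Proof. exact: p0_le1 cl. Qed.
Let radius_gap1 : 0 < 1 - r <= 2^-1. Proof. exact: (radius_gap R n0). Qed.
Let r01 : 0 <= r < 1. Proof. by have /andP[a b] := radius_gap1; apply/andP; split; lra. Qed.

Lemma nneg_horner_mono (P : {poly R}) (a b : R) : nneg_coef P -> 0 <= a <= b -> P.[a] <= P.[b].
Proof.
move=> hP /andP[a0 ab]; rewrite !horner_coef; apply: ler_sum => i _.
by apply: ler_wpM2l => //; apply: lerXn2r; rewrite ?nnegrE // (le_trans a0).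
Qed.

Lemma toC_le (P : {poly R}) z : nneg_coef P -> cabs z <= r -> cabs (toC P).[z] <= P.[r].
Proof.
move=> hP hz; apply: (le_trans (horner_cabs_le _ hP)); apply: nneg_horner_mono => //.
by rewrite cabs_ge0.
Qed.

Lemma nneg_inc : nneg_coef (Ys h.+1 - Ys h).
Proof. by move=> i; rewrite coefB subr_ge0 tree_series_mono. Qed.

Lemma toC_tree_series_S : toC (Ys h.+1) = 'X * (toC Phi \Po Y).
Proof. by rewrite /= rmorphM /= map_polyX map_comp_poly. Qed.

Lemma Y_le_r z : cabs z <= r -> cabs Y.[z] <= r.
Proof.
move=> hz; apply: (le_trans (toC_le _ hz)); first exact: nneg_tree_series.
have /andP[a b] := r01.
by have /andP[] := tree_series_le nPhi Phi1 h (x := r) ltac:(by rewrite a ltW).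
Qed.

Lemma fixed_point_error z : cabs z <= r -> cabs (z * (toC Phi).[Y.[z]] - Y.[z]) <= eta.
Proof.
move=> hz; apply: le_trans inc0.
have -> : z * (toC Phi).[Y.[z]] - Y.[z] = (toC (Ys h.+1 - Ys h)).[z].
  by rewrite rmorphB hornerD hornerN /= toC_tree_series_S hornerM hornerX horner_comp.
exact: toC_le nneg_inc hz.
Qed.

Let eta_le : eta <= p 0%N / 4 * (1 - r).
Proof.
have /andP[a _] := p01; have /andP[b _] := radius_gap1.
by rewrite /eta ler_wpM2r ?(ltW b) //; lra.
Qed.

Lemma slope_seriesE j z :
  (slope_series (toC Phi) Y j).[z] = z * ((toC Phi)^`(j)).[Y.[z]].
Proof. by rewrite hornerM hornerX horner_comp. Qed.

Lemma disc_gap z : cabs z <= r -> 0 < 1 - cabs Y.[z] <= 1.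
Proof.
move=> hz; have h1 := Y_le_r hz; have h2 := cabs_ge0 Y.[z]; have /andP[_ h3] := r01.
by apply/andP; split; lra.
Qed.

Lemma disc_slope_gap z : cabs z <= r ->
  p 0%N * (1 - cabs Y.[z]) <= 1 - cabs (slope_series (toC Phi) Y 1).[z].
Proof.
by move=> hz; rewrite slope_seriesE; apply: (slope_gap cl K0 n0 hz (Y_le_r hz)).
Qed.

Lemma disc_one_sub_slope z : cabs z <= r ->
  cabs (1 - (slope_series (toC Phi) Y 1).[z]) <= stolz_const p m2 * (1 - cabs Y.[z]).
Proof.
move=> hz; rewrite slope_seriesE.
exact: (one_sub_slope_le cl K0 n0 nK hz (Y_le_r hz) (fixed_point_error hz) eta_le).
Qed.

Let z1 z : cabs z <= r -> cabs z <= 1.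
Proof. by move=> hz; apply: (le_trans hz); have /andP[_ /ltW] := r01. Qed.

Let u1 z : cabs z <= r -> cabs Y.[z] <= 1.
Proof. by move=> hz; apply: (le_trans (Y_le_r hz)); have /andP[_ /ltW] := r01. Qed.

Lemma disc_slope2 z : cabs z <= r -> cabs (slope_series (toC Phi) Y 2).[z] <= m2.
Proof.
move=> hz; rewrite slope_seriesE cabsM.
apply: le_trans (deriv2_pgf_le cl K (u1 hz)).
by rewrite ler_piMl ?cabs_ge0 // z1.
Qed.

Lemma disc_slope3 z : cabs z <= r ->
  cabs (slope_series (toC Phi) Y 3).[z] * (1 - cabs Y.[z]) <= m2.
Proof.
move=> hz; have /andP[s0 _] := disc_gap hz; rewrite slope_seriesE cabsM.
apply: le_trans (deriv3_pgf_le cl K (u1 hz)).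
by apply: ler_wpM2r; rewrite ?(ltW s0) // ler_piMl ?cabs_ge0 // z1.
Qed.

Lemma disc_slope4 z : cabs z <= r ->
  cabs (slope_series (toC Phi) Y 4).[z] * (1 - cabs Y.[z]) ^+ 2 <= 2 * m2.
Proof.
move=> hz; rewrite slope_seriesE cabsM.
apply: le_trans (deriv4_pgf_le cl K (u1 hz)).
by apply: ler_wpM2r; rewrite ?sqr_ge0 // ler_piMl ?cabs_ge0 // z1.
Qed.

(** The Euler derivative of [Y] times [1 - F] is nearly [z Phi(Y)], which is bounded
    below. Hence [1 / (1 - |Y|)] is dominated on the circle by that Euler
    derivative, whose coefficients are known to be small. *)
Lemma circle_euler_ge z : cabs z = r ->
  p 0%N / 16 <= cabs (toC (euler_deriv (Ys h))).[z] * (stolz_const p m2 * (1 - cabs Y.[z])).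
Proof.
move=> hz'; have hz : cabs z <= r by rewrite hz'.
have /andP[p0 p1] := p01; have /andP[g0 g1] := radius_gap1.
set E := toC (euler_deriv _); set F := (slope_series (toC Phi) Y 1).[z].
apply: (@le_trans _ _ (cabs E.[z] * cabs (1 - F))); last first.
  by apply: ler_wpM2l; rewrite ?cabs_ge0 // disc_one_sub_slope.
have EE : E = euler_deriv Y by rewrite /E /euler_deriv rmorphM /= map_polyX deriv_map.
have e : E.[z] * (1 - F) = z * (toC Phi).[Y.[z]] - (toC (euler_deriv (Ys h.+1 - Ys h))).[z].
  have -> : toC (euler_deriv (Ys h.+1 - Ys h)) = euler_deriv (slope_series (toC Phi) Y 0) - E.
    rewrite EE euler_derivB rmorphB; congr (_ - _); last by rewrite -EE.
    by rewrite /euler_deriv rmorphM /= map_polyX -deriv_map toC_tree_series_S.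
  rewrite euler_slope_series -EE hornerD hornerN hornerD [(_ * E).[z]]hornerM -/F.
  by rewrite [(slope_series _ _ 0).[z]]slope_seriesE; ring.
rewrite -cabsM e.
have h1 := pgf_cabs_ge cl K0 n0 hz (Y_le_r hz) (fixed_point_error hz) eta_le.
have h2 : cabs (toC (euler_deriv (Ys h.+1 - Ys h))).[z] <= eta.
  apply: le_trans inc1; apply: toC_le => // i.
  by rewrite coef_euler_deriv mulr_ge0 // nneg_inc.
apply: (le_trans _ (lerB_cabs _ _)); rewrite cabsM hz'.
have h3 : 2^-1 * (p 0%N / 4) <= r * cabs (toC Phi).[Y.[z]].
  by apply: ler_pM => //; lra.
have h4 : eta <= p 0%N / 16 * 2^-1 by rewrite /eta ler_wpM2l //; lra.
lra.
Qed.

Lemma cong_euler_Y : cong_poly n (euler_deriv Y) (Y + slope_series (toC Phi) Y 1 * euler_deriv Y).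
Proof.
have h1 : cong_poly n Y (slope_series (toC Phi) Y 0).
  move=> i hi; rewrite -[slope_series _ _ 0]/('X * (toC Phi \Po Y)) -toC_tree_series_S !coef_map.
  congr (_ %:C); apply: coef_tree_series_stable; first exact: leq_trans hi nh.
  by rewrite (leq_trans hi) // (leq_trans nh).
apply: (cong_trans (cong_euler h1)); rewrite euler_slope_series.
by apply: congD => //; exact: cong_sym.
Qed.

End DiscFacts.

(** * Coefficients of the bivariate series *)

Definition tangential (R : realType) (kappa : R) (x : R[i]) :=
  [/\ x != 1, cabs x <= 3 / 2 & cabs x <= 1 + (4 * kappa)^-1 * cabs (1 - x)].

(** By Lagrange inversion the coefficient is one of a power of [Phi], and [Phi]
    contains a coin with the outcomes 0 and [k0]. *)
Lemma tree_coef_decay (R : realType) (p : nat -> R) (m2 : R) : critical_law p m2 ->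
  exists A : R, exists K0 : nat, 0 < A /\ forall K h i, (K0 <= K)%N ->
    (euler_deriv (tree_series (trunc_pgf p K) h))`_i <= A / Num.sqrt i.+1%:R.
Proof.
move=> cl; have [k0 k0gt pk0] := cl_branch cl.
pose eps := Num.min (p 0%N) (p k0).
have eps0 : 0 < eps by rewrite lt_min (cl_p0 cl).
exists (eps *+ 2)^-1, k0; split; first by rewrite invr_gt0 pmulrn_lgt0.
move=> K h i hK; set Phi := trunc_pgf p K.
have K0 : (0 < K)%N by exact: leq_trans hK.
have nPhi : nneg_coef Phi by exact: (nneg_trunc_pgf cl).
rewrite coef_euler_deriv; case: i => [|i].
  by rewrite mul0r divr_ge0 ?sqrtr_ge0 // invr_ge0 mulrn_wge0 // ltW.
apply: (le_trans (coef_tree_series_le nPhi h (ltn0Sn i))).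
pose S := Phi - eps *: (1 + 'X^k0).
have hS : nneg_coef S.
  move=> j; rewrite coefB coefZ coefD coef1 coefXn coef_trunc_pgf subr_ge0.
  case: (eqVneq j 0%N) => [->|j0].
    by rewrite ltn_eqF // addr0 mulr1 /= ge_min lexx.
  rewrite add0r; case: eqP => [->|_]; first by rewrite mulr1 hK ge_min lexx orbT.
  by rewrite mulr0; case: ifP => // _; exact: cl_ge0 cl _.
have U1 : (eps *: (1 + 'X^k0)).[1] = eps *+ 2.
  by rewrite hornerZ hornerD hornerC hornerXn expr1n -mulr2n mulr_natr.
have /andP[_ P1] := Phi_at1 cl K0.
have S1 : S.[1] <= 1 - eps *+ 2 by rewrite hornerD hornerN U1 lerD2r.
have S0 : 0 <= S.[1] by rewrite nneg_coef_horner.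
apply: (coef_exp_le i.+1 i k0gt eps0 _ hS S1); last by rewrite addrC subrK.
by rewrite -subr_ge0 (le_trans S0).
Qed.

Section Assembly.
Variables (R : realType) (n : nat) (D : set R[i]) (t : R[i] -> R).
Notation C := R[i].
Hypothesis t1 : forall z, D z -> 1 <= t z.

Lemma jet_pair_series (Y E W Gx Gy : {poly C}) (x y : C) (M gx gy : R) :
  1 <= M -> 3^-1 <= gx -> 3^-1 <= gy -> cabs x <= 2 -> cabs y <= 2 ->
  jet_le n D t 0 M Y -> jet_le n D t 1 M E -> jet_le n D t 0 M W ->
  jet_le n D t 0 (M * gx) Gx -> jet_le n D t 0 (M * gy) Gy ->
  jet_le n D t 1 (16 * M ^+ 2 * (271 * M ^+ 4 * (gx * gy)))
    (Y * E * (Gx + Gy + ((-1) *: 1 + (x * y) *: (W * Y * (Gx * Gy))))).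
Proof.
move=> M1 g1 g2 x2 y2 jY jE jW jGx jGy.
have M0 : 0 < M by apply: lt_le_trans M1.
have gx0 : 0 < gx by apply: lt_le_trans g1.
have gy0 : 0 < gy by apply: lt_le_trans g2.
have jYE := jet_leM t1 (ltW M0) (ltW M0) jY jE.
have jWY := jet_leM t1 (ltW M0) (ltW M0) jW jY.
have Mgx : 0 <= M * gx by rewrite mulr_ge0 // ltW.
have Mgy : 0 <= M * gy by rewrite mulr_ge0 // ltW.
have jG := jet_leM t1 Mgx Mgy jGx jGy.
have c1 : 0 <= 4 * M * M by rewrite !mulr_ge0 // ltW.
have c2 : 0 <= 4 * (M * gx) * (M * gy) by rewrite mulr_ge0 // mulr_ge0.
have jWYG := jet_leM t1 c1 c2 jWY jG.
have c3 : 0 <= 4 * (4 * M * M) * (4 * (M * gx) * (M * gy)) by rewrite mulr_ge0 // mulr_ge0.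
have jxy := jet_leZ (x * y) c3 jWYG.
have j1 := jet_leZ (-1) ler01 (jet_le1 n t1).
have jS := jet_leD (jet_leD jGx jGy) (jet_leD j1 jxy).
have bound : M * gx + M * gy + (cabs (-1 : C) * 1 +
   cabs (x * y) * (4 * (4 * M * M) * (4 * (M * gx) * (M * gy)))) <= 271 * M ^+ 4 * (gx * gy).
  rewrite cabsN cabs1 mulr1 cabsM.
  have xy4 : cabs x * cabs y <= 2 * 2 by apply: ler_pM; rewrite ?cabs_ge0.
  have h1 := ler_wpM2r c3 xy4.
  have M4 : M <= M ^+ 4 by rewrite -{1}[M]expr1 ler_weXn2l.
  have M41 : 1 <= M ^+ 4 by rewrite exprn_ege1.
  have ggx : gx <= 3 * (gx * gy) by nra.
  have ggy : gy <= 3 * (gx * gy) by nra.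
  have gg : 1 <= 9 * (gx * gy) by nra.
  have gg0 : 0 < gx * gy by rewrite mulr_gt0.
  have a1 : M * gx <= M ^+ 4 * (3 * (gx * gy)) by apply: ler_pM => //; exact: ltW.
  have a2 : M * gy <= M ^+ 4 * (3 * (gx * gy)) by apply: ler_pM => //; exact: ltW.
  have a3 : 1 * 1 <= M ^+ 4 * (9 * (gx * gy)) by apply: ler_pM.
  have a4 : 2 * 2 * (4 * (4 * M * M) * (4 * (M * gx) * (M * gy))) = 256 * (M ^+ 4 * (gx * gy)) by ring.
  (* 271 = 3 + 3 + 9 + 256, one summand for each term of the factor *)
  rewrite a4 in h1; lra.
have jS' := jet_le_mono t1 bound jS.
have c4 : 0 <= 271 * M ^+ 4 * (gx * gy).
  by apply: mulr_ge0; apply: mulr_ge0; rewrite ?ler0n ?exprn_ge0 // ltW.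
have := jet_leM t1 c1 c4 jYE jS'.
rewrite add0n addn0; apply: jet_le_mono => //.
by apply: le_of_eq; ring.
Qed.

Lemma jet_le_cong k M (P Q : {poly C}) : cong_poly n P Q -> jet_le n D t k M Q -> jet_le n D t k M P.
Proof.
move=> h [P0 [P1 [P2 [p0 p1 p2 hP]]]]; exists P0, P1, P2; split => //.
- exact: cong_trans p0.
- exact: cong_trans (cong_euler h) p1.
- exact: cong_trans (cong_euler (cong_euler h)) p2.
Qed.

End Assembly.

(** With [E = 1 / (1 - F)], [Gx = 1 / (1 - x F)] and [Gy = 1 / (1 - y F)], the three
    congruences give
    [H = Y * E * (Gx + Gy - 1 + x * y * W * Y * Gx * Gy)].
    On the circle of radius [r = 1 - 1 / (2 n)], the factor [E] is [O(t)] with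
    [t = 1 / (1 - |Y|)], and
    [Gx], [Gy] are [O(1 / |1 - x|)], [O(1 / |1 - y|)], so the second Euler derivative
    of [H] is [O(t^5)] times these constants. It multiplies the coefficient of [X^n]
    by [n^2], while the mean of [t^5] is [O(n^(3/2))]. *)
Lemma pair_series_coef_bound (R : realType) (p : nat -> R) (m2 : R) : critical_law p m2 ->
  exists (C0 kappa : R) (K0 : nat), [/\ 0 < C0, 1 <= kappa &
  forall n K h (x y : R[i]) (Lx Ly H : {poly R[i]}),
    (0 < n)%N -> (n + K0 <= K)%N -> (n <= h)%N -> tangential kappa x -> tangential kappa y ->
    let toC := map_poly (@real_complex R) in
    let Phi := trunc_pgf p K in
    let Y := toC (tree_series Phi h) in
    let F := slope_series (toC Phi) Y 1 in
    let W := slope_series (toC Phi) Y 2 in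
    cong_poly n (Lx * (1 - x *: F)) Y -> cong_poly n (Ly * (1 - y *: F)) Y ->
    cong_poly n (H * (1 - F)) (Y + (x *: (F * Lx) + y *: (F * Ly) + (x * y) *: (W * (Lx * Ly)))) ->
    cabs H`_n * Num.sqrt n%:R <= C0 / cabs (1 - x) / cabs (1 - y)].
Proof.
move=> cl; have [A [K0 [A0 hA]]] := tree_coef_decay cl.
have /andP[p0 p1] := p0_le1 cl; have m20 := second_moment_ge0 cl.
pose S := stolz_const p m2.
have S0 : 0 < S.
  have dc : 0 <= defect_const p m2.
    by rewrite /defect_const !addr_ge0 ?divr_ge0 ?addr_ge0 ?mulr_ge0 // ltW.
  by rewrite /S /stolz_const mulr_gt0 ?divr_gt0 // ltr_pwDr.
(* the opening of the Stolz angle that contains the slope *)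
pose kappa := S / p 0%N + 1.
have k1 : 1 <= kappa by rewrite lerDr divr_ge0 // ltW.
pose B : R := 1 + 2 * m2 + 20 * (kappa + 1) + 2 * (11 + 10 * kappa) / p 0%N.
have b4 : 0 <= 2 * (11 + 10 * kappa) / p 0%N by rewrite divr_ge0 ?(ltW p0) //; lra.
have B1 : 1 <= B by rewrite /B; lra.
pose M : R := 46 * B ^+ 9.
have M1 : 1 <= M.
  have : 1 <= B ^+ 9 by rewrite exprn_ege1.
  rewrite /M; lra.
pose b := 16 * S / p 0%N.
have b0 : 0 < b by rewrite divr_gt0 // mulr_gt0.
pose CA := 16 * (b * A) ^+ 4 + 128 * (b * A) ^+ 6.
have bA : 0 < b * A by rewrite mulr_gt0.
have CA0 : 0 < CA by rewrite addr_gt0 // mulr_gt0 // exprn_gt0.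
pose CH : R := 16 * M ^+ 2 * (271 * M ^+ 4).
have M0 : 0 < M by apply: lt_le_trans M1.
have CH0 : 0 < CH.
  by apply: mulr_gt0; apply: mulr_gt0; rewrite ?ltr0n // exprn_gt0.
exists (2 * CH * CA), kappa, K0; split; [by apply: mulr_gt0 => //; apply: mulr_gt0 | exact: k1 |].
move=> n K h x y Lx Ly H n0 hK nh tgx tgy toC Phi Y F W eLx eLy eH.
have nK : (n <= K)%N by exact: leq_trans (leq_addr _ _) hK.
have K0K : (K0 <= K)%N by exact: leq_trans (leq_addl _ _) hK.
have KK0 : (0 < K)%N by exact: leq_trans nK.
pose r : R := 1 - (2 * n%:R)^-1.
have radius_gap1 : 0 < 1 - r <= 2^-1 by exact: (radius_gap R n0).
have r01 : 0 <= r < 1 by have /andP[a1 a2] := radius_gap1; apply/andP; split; lra.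
have eta0 : 0 < p 0%N / 16 * (1 - r) by have /andP[a1 _] := radius_gap1; rewrite mulr_gt0 // divr_gt0.
have [h' nh' [inc0 inc1]] := small_increment cl KK0 n r01 eta0.
pose Y' := toC (tree_series Phi h').
pose Q j := slope_series (toC Phi) Y' j.
have YY : cong_poly n Y Y'.
  move=> i hi; rewrite !coef_map; congr (_ %:C); apply: coef_tree_series_stable.
    exact: leq_trans nh.
  exact: leq_trans nh'.
have FF : cong_poly n F (Q 1%N) by exact: cong_slope_series.
have WW : cong_poly n W (Q 2%N) by exact: cong_slope_series.
pose D := [set z : R[i] | cabs z <= r].
pose t z := (1 - cabs Y'.[z])^-1.
have Ds z : D z -> 0 < 1 - cabs Y'.[z] <= 1 by move=> hz; exact: (@disc_gap R p m2 cl K n h' n0 nK z hz).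
have t1 z : D z -> 1 <= t z.
  by move=> /Ds /andP[s0 s1]; rewrite /t invr_ge1 ?unitfE ?gt_eqF.
have tcancel z : D z -> (1 - cabs Y'.[z]) * t z = 1.
  by move=> /Ds /andP[s0 _]; rewrite /t divff // gt_eqF.
have hF z : D z -> p 0%N * (1 - cabs Y'.[z]) <= 1 - cabs (Q 1%N).[z].
  by move=> hz; exact: (@disc_slope_gap R p m2 cl K n h' n0 nK z hz).
have h1F z : D z -> cabs (1 - (Q 1%N).[z]) <= S * (1 - cabs Y'.[z]).
  by move=> hz; exact: (@disc_one_sub_slope R p m2 cl K n h' n0 nK inc0 z hz).
have hst z : D z -> cabs (1 - (Q 1%N).[z]) <= kappa * (1 - cabs (Q 1%N).[z]).
  move=> hz; apply: (le_trans (h1F z hz)).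
  have a := hF z hz; have /andP[s0 _] := Ds z hz.
  have F0 : 0 <= 1 - cabs (Q 1%N).[z] by apply: le_trans a; rewrite mulr_ge0 // ltW.
  have e : S * (1 - cabs Y'.[z]) = S / p 0%N * (p 0%N * (1 - cabs Y'.[z])) by field; rewrite gt_eqF.
  rewrite e mulrDl mul1r; apply: (@le_trans _ _ (S / p 0%N * (1 - cabs (Q 1%N).[z]))).
    by apply: ler_wpM2l => //; rewrite divr_ge0 // ltW.
  by rewrite lerDl.
(* polynomial stand-ins G for the resolvents 1 / (1 - a F), at most twice as large *)
have stand_in (a : R[i]) (ka : R) : 0 <= ka ->
  (forall z, D z -> p 0%N * (1 - cabs Y'.[z]) <= ka * cabs (1 - a * (Q 1%N).[z])) ->
  exists G, cong_poly n (G * (1 - a *: Q 1%N)) 1 /\ forall z, D z ->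
     cabs G.[z] <= 2 * ka / p 0%N * t z /\
     (forall c, 0 < c -> c <= cabs (1 - a * (Q 1%N).[z]) -> cabs G.[z] <= 2 / c).
  move=> ka0 hq; have /andP[r0 _] := r01.
  have hz0 z : D z -> 0 < cabs (1 - a * (Q 1%N).[z]).
    move=> hz; have /andP[s0 _] := Ds z hz; have := hq z hz.
    have : 0 < p 0%N * (1 - cabs Y'.[z]) by rewrite mulr_gt0.
    move=> u v; rewrite lt_neqAle cabs_ge0 andbT eq_sym; apply/eqP => e.
    by move: (lt_le_trans u v); rewrite e mulr0 ltxx.
  have eQ z : (1 - a *: Q 1%N).[z] = 1 - a * (Q 1%N).[z].
    by rewrite hornerD hornerN hornerZ hornerC.
  have hQ z : cabs z <= r -> (1 - a *: Q 1%N).[z] != 0.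
    by move=> hz; rewrite eQ -cabs_eq0 gt_eqF // hz0.
  have half0 : 0 < 2^-1 :> R by rewrite invr_gt0.
  have [G [g1 g2]] := poly_inverse_approx n r0 half0 hQ; exists G; split => // z hz.
  have hG : cabs G.[z] * cabs (1 - a * (Q 1%N).[z]) <= 2.
    have := g2 z hz; rewrite hornerM eQ -cabsM.
    set v := _ * _ => hv; have := ler_cabsD (v - 1) 1; rewrite subrK cabs1; lra.
  have cG := cabs_ge0 G.[z].
  split; last first.
    move=> c c0 hc; rewrite ler_pdivlMr //; apply: le_trans hG.
    exact: ler_wpM2l.
  have a1 := ler_wpM2l cG (hq z hz).
  have a2 : cabs G.[z] * (ka * cabs (1 - a * (Q 1%N).[z])) <= ka * 2.
    by rewrite mulrCA; apply: ler_wpM2l.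
  have a3 : p 0%N * cabs G.[z] = cabs G.[z] * (p 0%N * (1 - cabs Y'.[z])) * t z.
    by rewrite -!mulrA tcancel //; ring.
  have t0 : 0 <= t z by apply: le_trans (t1 z hz).
  have : p 0%N * cabs G.[z] <= ka * 2 * t z.
    by rewrite a3; apply: ler_wpM2r => //; apply: (le_trans a1).
  rewrite -ler_pdivlMl // => hh; apply: (le_trans hh).
  by apply: le_of_eq; ring.
have res a : tangential kappa a -> exists G, [/\ cong_poly n (G * (1 - a *: Q 1%N)) 1,
    (forall z, D z -> cabs G.[z] <= B * t z) &
    (forall z, D z -> cabs G.[z] <= B * (cabs (1 - a))^-1 * t z ^+ 0)].
  move=> [a1 a32 atan].
  have hres z : D z -> cabs (1 - a) <= 10 * (kappa + 1) * cabs (1 - a * (Q 1%N).[z]).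
    by move=> hz; apply: resolvent_ge => //; apply: hst.
  have ka0 : 0 <= 11 + 10 * kappa by lra.
  have [|G [g1 g2]] := stand_in a (11 + 10 * kappa) ka0.
    move=> z hz; apply: (le_trans (hF z hz)).
    have F1 : cabs (Q 1%N).[z] <= 1.
      have /andP[s0 _] := Ds z hz; have := hF z hz.
      have : 0 <= p 0%N * (1 - cabs Y'.[z]) by rewrite mulr_ge0 // ltW.
      lra.
    have u1 := lerB_cabs 1 (Q 1%N).[z]; rewrite cabs1 in u1.
    have u2 : cabs (1 - (Q 1%N).[z]) <= cabs (1 - a * (Q 1%N).[z]) + cabs (1 - a).
      rewrite (_ : 1 - (Q 1%N).[z] = (1 - a * (Q 1%N).[z]) + (a - 1) * (Q 1%N).[z]); last by ring.
      apply: (le_trans (ler_cabsD _ _)); rewrite lerD2l cabsM cabs_subC.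
      by rewrite ler_piMr ?cabs_ge0.
    have := hres z hz; lra.
  exists G; split => // z hz; have [v1 v2] := g2 z hz.
    apply: (le_trans v1); apply: ler_wpM2r; first by apply: le_trans (t1 z hz).
    by rewrite /B; lra.
  have ca : 0 < cabs (1 - a).
    by rewrite lt_neqAle cabs_ge0 andbT eq_sym cabs_eq0 subr_eq0 eq_sym.
  have kk : 0 < 10 * (kappa + 1) by lra.
  have c0 : 0 < cabs (1 - a) / (10 * (kappa + 1)) by rewrite divr_gt0.
  have := v2 _ c0; rewrite ler_pdivrMr // mulrC => /(_ (hres z hz)) v3.
  rewrite expr0 mulr1; apply: (le_trans v3); rewrite invf_div mulrA.
  apply: ler_wpM2r; first by rewrite invr_ge0 ltW.
  by rewrite /B; lra.
have [E [eE bE]] : exists E, cong_poly n (E * (1 - Q 1%N)) 1 /\ forall z, D z -> cabs E.[z] <= B * t z.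
  have [|E [e1 e2]] := stand_in 1 1 ler01.
    move=> z hz; rewrite !mul1r; apply: (le_trans (hF z hz)).
    by have := lerB_cabs 1 (Q 1%N).[z]; rewrite cabs1.
  rewrite scale1r in e1; exists E; split => // z hz; have [v1 _] := e2 z hz.
  apply: (le_trans v1); apply: ler_wpM2r; first by apply: le_trans (t1 z hz).
  rewrite mulr1; apply: (@le_trans _ _ (2 * (11 + 10 * kappa) / p 0%N)); last by rewrite /B; lra.
  by rewrite ler_wpM2r ?invr_ge0 ?(ltW p0) //; lra.
have [Gx [eGx bGx bGx']] := res x tgx.
have [Gy [eGy bGy bGy']] := res y tgy.
have hYB z : D z -> cabs Y'.[z] <= B.
  by move=> /Ds /andP[s0 _]; apply: le_trans B1; lra.
have hFB z : D z -> cabs (Q 1%N).[z] <= B.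
  move=> hz; have := hF z hz; have /andP[s0 _] := Ds z hz.
  have : 0 <= p 0%N * (1 - cabs Y'.[z]) by rewrite mulr_ge0 // ltW.
  by move=> u v; apply: le_trans B1; lra.
have mB : m2 <= B by rewrite /B; lra.
have m2B : 2 * m2 <= B by rewrite /B; lra.
have hWB z : D z -> cabs (Q 2%N).[z] <= B.
  by move=> hz; apply: le_trans mB; exact: (@disc_slope2 R p m2 cl K n h' n0 nK z hz).
have hVB z : D z -> cabs (Q 3%N).[z] <= B * t z.
  move=> hz; have /andP[s0 _] := Ds z hz; rewrite /t ler_pdivlMr //.
  by apply: le_trans mB; exact: (@disc_slope3 R p m2 cl K n h' n0 nK z hz).
have hUB z : D z -> cabs (Q 4%N).[z] <= B * t z ^+ 2.
  move=> hz; have /andP[s0 _] := Ds z hz; rewrite /t exprVn ler_pdivlMr ?exprn_gt0 //.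
  by apply: le_trans m2B; exact: (@disc_slope4 R p m2 cl K n h' n0 nK z hz).
have eqY : cong_poly n (euler_deriv Y') (Y' + Q 1%N * euler_deriv Y').
  exact: cong_euler_Y.
have eqF := euler_slope_series (toC Phi) Y' 1.
have eqW := euler_slope_series (toC Phi) Y' 2.
have eqV := euler_slope_series (toC Phi) Y' 3.
have jY := jet_Y t1 B1 eqY eqF eE hYB hFB hWB hVB hUB bE.
have jW := jet_W t1 B1 eqY eqF eqW eqV eE hYB hFB hWB hVB hUB bE.
have jE := jet_E t1 B1 eqY eqF eqW eE hYB hFB hWB hVB hUB bE.
have x2 (a : R[i]) : tangential kappa a -> cabs a <= 2 by move=> [_ h1 _]; lra.
have gpos (a : R[i]) : 0 <= (cabs (1 - a))^-1 by rewrite invr_ge0 cabs_ge0.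
have jGx := jet_resolvent t1 B1 eqY eqF eqW eE hYB hFB hWB hVB hUB bE eGx (x2 x tgx) (gpos x) bGx bGx'.
have jGy := jet_resolvent t1 B1 eqY eqF eqW eE hYB hFB hWB hVB hUB bE eGy (x2 y tgy) (gpos y) bGy bGy'.
have g3 (a : R[i]) : tangential kappa a -> 3^-1 <= (cabs (1 - a))^-1.
  move=> tga; have a2 := x2 a tga; have [a1 _ _] := tga.
  have ca : 0 < cabs (1 - a).
    by rewrite lt_neqAle cabs_ge0 andbT eq_sym cabs_eq0 subr_eq0 eq_sym.
  by rewrite lef_pV2 ?posrE //; have := ler_cabsB 1 a; rewrite cabs1; lra.
have jH0 := jet_pair_series t1 M1 (g3 x tgx) (g3 y tgy) (x2 x tgx) (x2 y tgy) jY jE jW jGx jGy.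
set H0 := Y' * E * _ in jH0.
have HH0 : cong_poly n H H0.
  have sLx : cong_poly n Lx (Gx * Y').
    apply: (cong_solve eGx); rewrite mulrC; apply: cong_trans YY; apply: cong_trans eLx.
    by apply: congM => //; apply: congB => //; apply: congZ; apply: cong_sym.
  have sLy : cong_poly n Ly (Gy * Y').
    apply: (cong_solve eGy); rewrite mulrC; apply: cong_trans YY; apply: cong_trans eLy.
    by apply: congM => //; apply: congB => //; apply: congZ; apply: cong_sym.
  have gF a G : cong_poly n (G * (1 - a *: Q 1%N)) 1 -> cong_poly n (a *: (Q 1%N * G)) (G + (-1) *: 1).
    move=> e i hi; have := e i hi.
    have -> : G * (1 - a *: Q 1%N) = G - a *: (Q 1%N * G) by rewrite -!mul_polyC; ring.
    rewrite coefB => /eqP; rewrite subr_eq addrC -subr_eq => /eqP <-.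
    by rewrite coefD scaleN1r coefN.
  have sH : cong_poly n H (E * (Y' + (x *: (Q 1%N * (Gx * Y')) + y *: (Q 1%N * (Gy * Y')) +
      (x * y) *: (Q 2%N * (Gx * Y' * (Gy * Y')))))).
    apply: (cong_solve eE); rewrite mulrC.
    apply: (@cong_trans _ _ (H * (1 - F))).
      by apply: congM => //; apply: congB => //; apply: cong_sym.
    apply: (cong_trans eH); apply: congD => //; apply: congD.
      by apply: congD; apply: congZ; apply: congM.
    by apply: congZ; apply: congM => //; apply: congM.
  apply: (cong_trans sH).
  have -> : E * (Y' + (x *: (Q 1%N * (Gx * Y')) + y *: (Q 1%N * (Gy * Y')) +
      (x * y) *: (Q 2%N * (Gx * Y' * (Gy * Y'))))) =
    Y' * E * (1 + (x *: (Q 1%N * Gx)) + (y *: (Q 1%N * Gy)) + (x * y) *: (Q 2%N * Y' * (Gx * Gy))).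
    by rewrite -!mul_polyC; ring.
  rewrite /H0; apply: congM => //.
  have -> : Gx + Gy + (-1 *: 1 + (x * y) *: (Q 2%N * Y' * (Gx * Gy))) =
     1 + (Gx + (-1) *: 1) + (Gy + (-1) *: 1) + (x * y) *: (Q 2%N * Y' * (Gx * Gy)).
    by rewrite scaleN1r; ring.
  by apply: congD => //; apply: congD; [apply: congD => //; exact: gF | exact: gF].
have [P0 [P1 [P2 [_ _ q2 hP]]]] := jet_le_cong HH0 jH0.
have P2n : P2`_n = n%:R ^+ 2 * H`_n.
  by rewrite -q2 // !coef_euler_deriv mulrA expr2.
(* the polygon has enough vertices for exact averages of all polynomials involved *)
pose Dr := euler_deriv (tree_series Phi h').
pose N := (size P2 + n.+1 + (size (Dr ^+ 0) + (size (Dr ^+ 1) + (size (Dr ^+ 2) + size (Dr ^+ 3)))))%N.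
have [|w hw] := @prim_root_exists R N; first by rewrite /N addnS.
have nD : nneg_coef Dr.
  by move=> i; rewrite coef_euler_deriv mulr_ge0 //; apply: nneg_tree_series; exact: (nneg_trunc_pgf cl).
have /andP[r0 r1] := r01.
have hD i : Dr`_i <= A / Num.sqrt i.+1%:R by exact: hA.
have hsz i : (i <= 3)%N -> (size (Dr ^+ i) <= N)%N.
  by case: i => [|[|[|[|//]]]] _; rewrite /N; clear; lia.
have cw (j : 'I_N) : cabs (r%:C * w ^+ j) = r.
  by rewrite cabsM cabsX (cabs_prim_root hw) expr1n mulr1 cabs_real ger0_norm.
have ht (j : 'I_N) : 0 <= t (r%:C * w ^+ j) <= b * cabs (toC Dr).[r%:C * w ^+ j].
  set z := _ * _; have hz : D z by rewrite /D /= cw.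
  have tz : 0 <= t z by apply: le_trans (t1 z hz).
  rewrite tz /=.
  have := circle_euler_ge cl n0 nK inc0 inc1 (cw j); rewrite -/z -/Phi -/Y' -/Dr -/S => hh.
  have := ler_wpM2r tz hh.
  rewrite [leRHS](_ : _ = cabs (toC Dr).[z] * S * ((1 - cabs Y'.[z]) * t z)); last by ring.
  rewrite tcancel // mulr1 mulrAC ler_pdivrMr // => h5.
  rewrite -(ler_pM2l p0); apply: (le_trans h5).
  by apply: le_of_eq; rewrite /b; field; rewrite gt_eqF.
have rE : 1 - r = (2 * n%:R)^-1 by rewrite /r subKr.
have mean5 := mean_pow5_le (ltW A0) nD hD hw r01 hsz n0 (ltW b0) rE ht.
have szP2 : (size P2 <= N)%N by rewrite /N -addnA leq_addr.
have nN : (n < N)%N by rewrite /N; clear; lia.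
have cP := cabs_coef_le hw r0 szP2 nN.
set gg := (cabs (1 - x))^-1 * (cabs (1 - y))^-1 in jH0 hP.
have cP2 : \sum_(j < N) cabs P2.[r%:C * w ^+ j] <= CH * gg * \sum_(j < N) t (r%:C * w ^+ j) ^+ 5.
  rewrite mulr_sumr; apply: ler_sum => j _.
  have hz : D (r%:C * w ^+ j) by rewrite /D /= cw.
  have [_ _] := hP _ hz; rewrite mulrA; exact.
have gg0 : 0 <= CH * gg.
  by apply: mulr_ge0; [exact: ltW | apply: mulr_ge0].
have big := le_trans cP (le_trans cP2 (ler_wpM2l gg0 mean5)).
have NR : 0 < N%:R :> R by rewrite ltr0n; exact: leq_ltn_trans nN.
have nR : 0 < n%:R :> R by rewrite ltr0n.
set q := Num.sqrt (n%:R : R) in big *.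
have q0 : 0 < q by rewrite sqrtr_gt0.
have q2' : q ^+ 2 = n%:R by rewrite sqr_sqrtr // ltW.
have rn : 2^-1 <= r ^+ n.
  have s01 : 0 <= 1 - r <= 1 by rewrite subr_ge0 (ltW r1) gerBl r0.
  rewrite rE in s01.
  have := @bernoulli_ge R _ n s01; rewrite -/r.
  have -> : n%:R * (2 * n%:R)^-1 = 2^-1 :> R by field; rewrite gt_eqF.
  by move=> h5; lra.
have big2 : cabs P2`_n * 2^-1 <= CH * gg * (CA * (n%:R * q)).
  rewrite -(ler_pM2r NR).
  apply: (@le_trans _ _ (cabs P2`_n * r ^+ n * N%:R)).
    by apply: ler_wpM2r; [exact: ltW | apply: ler_wpM2l; rewrite ?cabs_ge0].
  apply: (le_trans big).
  by apply: le_of_eq; rewrite /CA; ring.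
rewrite P2n cabsM cabsX cabs_nat in big2.
rewrite -(ler_pM2l (mulr_gt0 nR q0)).
have -> : n%:R * q * (cabs H`_n * q) = 2 * (n%:R ^+ 2 * cabs H`_n * 2^-1).
  by rewrite -q2'; field.
have -> : n%:R * q * (2 * CH * CA / cabs (1 - x) / cabs (1 - y)) = 2 * (CH * gg * (CA * (n%:R * q))).
  by rewrite /gg; ring.
by rewrite ler_pM2l.
Qed.

(** * Sums over forests *)

Section ForestSums.
Variables (A : comNzRingType) (T : finType) (k : nat).
Implicit Types a b c : T -> A.

Lemma sum_forest a : \sum_(f : {ffun 'I_k -> T}) \prod_i a (f i) = (\sum_t a t) ^+ k.
Proof.
rewrite -(bigA_distr_bigA (fun _ t => a t)) /= prodr_const card_ord //.
Qed.

Lemma sum_forest1 a b (j : 'I_k) :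
  \sum_(f : {ffun 'I_k -> T}) (\prod_i a (f i)) * b (f j) =
  (\sum_t a t) ^+ k.-1 * (\sum_t a t * b t).
Proof.
pose G i t := a t * (if i == j then b t else 1).
rewrite (eq_bigr (fun f : {ffun 'I_k -> T} => \prod_i G i (f i))); last first.
  move=> f _; rewrite /G big_split /=; congr (_ * _).
  by rewrite (bigD1 j) //= eqxx big1 ?mulr1 // => i /negPf ->.
rewrite -(bigA_distr_bigA G) (bigD1 j) //= mulrC; congr (_ * _); last first.
  by apply: eq_bigr => t _; rewrite /G eqxx.
rewrite (eq_bigr (fun=> \sum_t a t)); last first.
  by move=> i /negPf ij; apply: eq_bigr => t _; rewrite /G ij mulr1.
by rewrite prodr_const cardC1 card_ord.
Qed.

Lemma sum_forest2 a b c (i j : 'I_k) : i != j ->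
  \sum_(f : {ffun 'I_k -> T}) (\prod_l a (f l)) * (b (f i) * c (f j)) =
  (\sum_t a t) ^+ k.-2 * ((\sum_t a t * b t) * (\sum_t a t * c t)).
Proof.
move=> ij; pose G l t := a t * ((if l == i then b t else 1) * (if l == j then c t else 1)).
rewrite (eq_bigr (fun f : {ffun 'I_k -> T} => \prod_l G l (f l))); last first.
  move=> f _; rewrite /G big_split /= big_split /=; congr (_ * (_ * _)).
    by rewrite (bigD1 i) //= eqxx big1 ?mulr1 // => l /negPf ->.
  by rewrite (bigD1 j) //= eqxx big1 ?mulr1 // => l /negPf ->.
rewrite -(bigA_distr_bigA G) (bigD1 i) //= (bigD1 j) /=; last by rewrite eq_sym.
have -> : \sum_t G i t = \sum_t a t * b t.
  by apply: eq_bigr => t _; rewrite /G eqxx (negPf ij) mulr1.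
have -> : \sum_t G j t = \sum_t a t * c t.
  by apply: eq_bigr => t _; rewrite /G eqxx eq_sym (negPf ij) mul1r.
have -> : \prod_(l | (l != i) && (l != j)) \sum_t G l t = \prod_(l | (l != i) && (l != j)) \sum_t a t.
  by apply: eq_bigr => l /andP[/negPf li /negPf lj]; apply: eq_bigr => t _; rewrite /G li lj !mulr1.
rewrite prodr_const (_ : #|_| = k.-2); first by ring.
have -> : k.-2 = (#|'I_k|.-1).-1 by rewrite card_ord.
rewrite -(cardC1 i) (cardD1 j (predC1 i)) !inE eq_sym ij /=.
by apply: eq_card => l; rewrite !inE andbC.
Qed.

Lemma sum_forest_linear a b :
  \sum_(f : {ffun 'I_k -> T}) (\prod_i a (f i)) * \sum_j b (f j) =
  k%:R * ((\sum_t a t) ^+ k.-1 * (\sum_t a t * b t)).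
Proof.
transitivity (\sum_(j < k) \sum_(f : {ffun 'I_k -> T}) (\prod_i a (f i)) * b (f j)).
  by rewrite exchange_big /=; apply: eq_bigr => f _; rewrite mulr_sumr.
transitivity (\sum_(j < k) (\sum_t a t) ^+ k.-1 * (\sum_t a t * b t)).
  by apply: eq_bigr => j _; exact: sum_forest1.
by rewrite sumr_const card_ord mulr_natl.
Qed.

Lemma sum_forest_bilinear a b c :
  \sum_(f : {ffun 'I_k -> T}) (\prod_i a (f i)) * \sum_i \sum_(j | j != i) b (f i) * c (f j) =
  (k * k.-1)%:R * ((\sum_t a t) ^+ k.-2 * ((\sum_t a t * b t) * (\sum_t a t * c t))).
Proof.
set S := _ ^+ _ * _.
transitivity (\sum_(i < k) \sum_(j < k | j != i) \sum_(f : {ffun 'I_k -> T})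
    (\prod_l a (f l)) * (b (f i) * c (f j))).
  transitivity (\sum_(i < k) \sum_(f : {ffun 'I_k -> T}) \sum_(j < k | j != i)
    (\prod_l a (f l)) * (b (f i) * c (f j))); last first.
    by apply: eq_bigr => i _; rewrite exchange_big.
  rewrite exchange_big /=; apply: eq_bigr => f _; rewrite mulr_sumr.
  by apply: eq_bigr => i _; rewrite mulr_sumr.
transitivity (\sum_(i < k) \sum_(j < k | j != i) S).
  apply: eq_bigr => i _; apply: eq_bigr => j ji; apply: sum_forest2.
  by rewrite eq_sym.
transitivity (\sum_(i < k) S *+ k.-1).
  by apply: eq_bigr => i _; rewrite sumr_const cardC1 card_ord.
by rewrite sumr_const card_ord -mulrnA mulr_natl mulnC.
Qed.

End ForestSums.

(** * Plane trees of bounded height and bounded degrees *)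

(** Bounding the height ([< h]) and the numbers of children ([<= K]) makes the plane
    trees a finite type. There is no tree of height less than 0. *)
Fixpoint rtree (K h : nat) : finType :=
  if h is h'.+1 then {k : 'I_K.+1 & {ffun 'I_k -> rtree K h'}}%type else void.

Fixpoint verts K h : rtree K h -> seq label :=
  match h with
  | 0 => fun=> [::]
  | h'.+1 => fun t => [::] :: flatten [seq [seq (nat_of_ord i) :: v | v <- verts (tagged t i)] | i <- enum 'I_(tag t)]
  end.

Fixpoint tweight (R : nzRingType) (p : nat -> R) K h : rtree K h -> R :=
  match h with
  | 0 => fun=> 0
  | h'.+1 => fun t => p (tag t) * \prod_i tweight p (tagged t i)
  end.

Fixpoint tdeg K h : rtree K h -> label -> nat :=
  match h with
  | 0 => fun _ _ => 0%N
  | h'.+1 => fun t v =>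
      if v is i :: v' then
        (if insub i is Some j then tdeg (tagged t (j : 'I_(tag t))) v' else 0%N)
      else tag t
  end.

Lemma sum_verts (A : nmodType) K h (t : rtree K h.+1) (g : label -> A) :
  \sum_(v <- verts t) g v =
  g [::] + \sum_i \sum_(v <- verts (tagged t i)) g (nat_of_ord i :: v).
Proof.
rewrite /= big_cons; congr (_ + _); rewrite big_flatten big_map big_enum /=.
by apply: eq_bigr => i _; rewrite big_map.
Qed.

Lemma prod_verts (A : comNzRingType) K h (t : rtree K h.+1) (g : label -> A) :
  \prod_(v <- verts t) g v =
  g [::] * \prod_i \prod_(v <- verts (tagged t i)) g (nat_of_ord i :: v).
Proof.
rewrite /= big_cons; congr (_ * _); rewrite big_flatten big_map big_enum /=.
by apply: eq_bigr => i _; rewrite big_map.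
Qed.

Lemma size_verts K h (t : rtree K h.+1) :
  size (verts t) = (\sum_i size (verts (tagged t i))).+1.
Proof.
rewrite /= size_flatten /shape -map_comp sumnE big_map big_enum /=.
by congr (_.+1); apply: eq_bigr => i _; rewrite size_map.
Qed.

Lemma tdeg_child K h (t : rtree K h.+1) (i : 'I_(tag t)) v :
  tdeg t (nat_of_ord i :: v) = tdeg (tagged t i) v.
Proof. by rewrite /= valK. Qed.

Lemma tweightE (R : comNzRingType) (p : nat -> R) K h (t : rtree K h) :
  tweight p t = \prod_(v <- verts t) p (tdeg t v).
Proof.
elim: h t => [[]//|h IHh] t; rewrite prod_verts /=; congr (_ * _).
apply: eq_bigr => i _; rewrite IHh; apply: eq_bigr => v _.
by rewrite -tdeg_child.
Qed.

Section Statistics.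
Variable (C : comNzRingType).
Implicit Types x y : C.

Definition depth_sum x K h (t : rtree K h) : C := \sum_(v <- verts t) x ^+ size v.

Definition lca_sum x y K h (t : rtree K h) : C :=
  \sum_(v <- verts t) \sum_(w <- verts t)
    x ^+ (size v - size (lca v w)) * y ^+ (size w - size (lca v w)).

Lemma depth_sumS x K h (t : rtree K h.+1) :
  depth_sum x t = 1 + x * \sum_i depth_sum x (tagged t i).
Proof.
rewrite /depth_sum sum_verts expr0 mulr_sumr; congr (_ + _).
by apply: eq_bigr => i _; rewrite mulr_sumr; apply: eq_bigr => v _; rewrite exprS.
Qed.

(** Two vertices in the subtree of the same child have their last common ancestor
    there; for all other pairs it is the root. *)
Lemma lca_sumS x y K h (t : rtree K h.+1) :
  lca_sum x y t = \sum_i lca_sum x y (tagged t i) +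
    (1 + (x * \sum_i depth_sum x (tagged t i) + y * \sum_i depth_sum y (tagged t i) +
     (x * y) * \sum_i \sum_(j | j != i) depth_sum x (tagged t i) * depth_sum y (tagged t j))).
Proof.
rewrite /lca_sum sum_verts.
rewrite (sum_verts t (fun w => x ^+ (size [::] - _) * y ^+ (size w - size (lca [::] w)))) /=.
rewrite !expr0 mulr1.
have e1 : \sum_i \sum_(w <- verts (tagged t i)) 1 * y ^+ (size w).+1 = y * \sum_i depth_sum y (tagged t i).
  rewrite mulr_sumr; apply: eq_bigr => i _; rewrite /depth_sum mulr_sumr.
  by apply: eq_bigr => w _; rewrite mul1r exprS.
rewrite e1.
have e2 i : \sum_(v <- verts (tagged t i)) \sum_(w <- verts t)
     x ^+ (size (nat_of_ord i :: v) - size (lca (nat_of_ord i :: v) w)) *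
     y ^+ (size w - size (lca (nat_of_ord i :: v) w)) =
   x * depth_sum x (tagged t i) + (lca_sum x y (tagged t i) +
     (x * y) * \sum_(j | j != i) depth_sum x (tagged t i) * depth_sum y (tagged t j)).
  have hv v : \sum_(w <- verts t) x ^+ (size (nat_of_ord i :: v) - size (lca (nat_of_ord i :: v) w)) *
     y ^+ (size w - size (lca (nat_of_ord i :: v) w)) =
     x * x ^+ size v + (\sum_(w <- verts (tagged t i)) x ^+ (size v - size (lca v w)) * y ^+ (size w - size (lca v w))
       + (x * y) * \sum_(j | j != i) x ^+ size v * depth_sum y (tagged t j)).
    rewrite sum_verts /= subn0 expr0 mulr1 exprS; congr (_ + _).
    rewrite (bigD1 i) //= eqxx; congr (_ + _).
    rewrite mulr_sumr; apply: eq_bigr => j ji; rewrite /depth_sum !mulr_sumr.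
    apply: eq_bigr => w _.
    rewrite (_ : (nat_of_ord i == j) = false) /=; last by apply/negbTE; rewrite eq_sym; exact: ji.
    by rewrite !exprS; ring.
  rewrite (eq_bigr _ (fun v _ => hv v)) !big_split /= -mulr_sumr; congr (_ + (_ + _)).
  rewrite -mulr_sumr exchange_big /=; congr (_ * _); apply: eq_bigr => j _.
  by rewrite -mulr_suml.
rewrite (eq_bigr _ (fun i _ => e2 i)) !big_split /= -!mulr_sumr.
by ring.
Qed.

End Statistics.

(** * Generating polynomials of tree statistics *)

Lemma sum_rtreeS (A : nmodType) K h (G : rtree K h.+1 -> A) :
  \sum_(t : rtree K h.+1) G t =
  \sum_(k < K.+1) \sum_(f : {ffun 'I_k -> rtree K h}) G (Tagged (fun k : 'I_K.+1 => {ffun 'I_k -> rtree K h}) f).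
Proof.
pose F (k : 'I_K.+1) (f : {ffun 'I_k -> rtree K h}) := G (Tagged (fun k : 'I_K.+1 => {ffun 'I_k -> rtree K h}) f).
transitivity (\sum_(k < K.+1) \sum_(f : {ffun 'I_k -> rtree K h}) F k f) => [|//].
rewrite (sig_big_dep (I := 'I_K.+1) xpredT (fun _ => xpredT) F) /=.
by apply: eq_bigr => -[k f] _.
Qed.

Section TreeGeneratingFunctions.
Variables (R : realType) (p : nat -> R) (K : nat).
Notation C := R[i].
Notation toC := (map_poly (@real_complex R)).
Let Phi := trunc_pgf p K.

Definition tree_monomial h (t : rtree K h) : {poly R} := tweight p t *: 'X^(size (verts t)).

Lemma tree_monomialS h (t : rtree K h.+1) :
  tree_monomial t = p (tag t) *: ('X * \prod_i tree_monomial (tagged t i)).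
Proof.
rewrite /tree_monomial scaler_prod size_verts exprS -scalerAr scalerA.
by rewrite (big_morph (fun m => 'X^m : {poly R}) (fun a b => exprD 'X a b) (expr0 'X)).
Qed.

Definition tree_gf (g : forall h, rtree K h -> C) h : {poly C} :=
  \sum_(t : rtree K h) toC (tree_monomial t) * (g h t)%:P.

Lemma coef_tree_gf g h n :
  (tree_gf g h)`_n = \sum_(t : rtree K h | size (verts t) == n) (tweight p t)%:C * g h t.
Proof.
rewrite coef_sum [RHS]big_mkcond /=; apply: eq_bigr => t _.
rewrite coefMC coef_map coefZ coefXn eq_sym /=.
by case: eqP => _; rewrite ?mulr1 // mulr0 mul0r.
Qed.

Lemma toC_trunc_pgf : toC Phi = \sum_(k < K.+1) (p k)%:C *: 'X^k.
Proof.
rewrite /Phi /trunc_pgf poly_def rmorph_sum; apply: eq_bigr => k _.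
by rewrite /= map_polyZ map_polyXn.
Qed.

Lemma comp_pgf0 (S : {poly C}) : toC Phi \Po S = \sum_(k < K.+1) (p k)%:C *: S ^+ k.
Proof.
rewrite toC_trunc_pgf linear_sum; apply: eq_bigr => k _.
by rewrite /= linearZ /= comp_Xn_poly.
Qed.

Lemma comp_pgf1 (S : {poly C}) :
  (toC Phi)^`(1) \Po S = \sum_(k < K.+1) (p k)%:C *: (k%:R * S ^+ k.-1).
Proof.
rewrite derivn1 toC_trunc_pgf (raddf_sum (@deriv C)) linear_sum; apply: eq_bigr => k _.
by rewrite /= derivZ derivXn linearZ /= linearMn /= comp_Xn_poly mulr_natl.
Qed.

Lemma comp_pgf2 (S : {poly C}) :
  (toC Phi)^`(2) \Po S = \sum_(k < K.+1) (p k)%:C *: ((k * k.-1)%:R * S ^+ k.-2).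
Proof.
rewrite derivSn derivn1 toC_trunc_pgf !(raddf_sum (@deriv C)) linear_sum; apply: eq_bigr => k _.
rewrite /= derivZ derivXn derivZ derivMn derivXn linearZ /= !linearMn /= comp_Xn_poly.
by rewrite -mulrnA mulr_natl mulnC scalerMnr.
Qed.

(** A tree is a root with a sequence of subtrees, whose weights multiply and whose
    sizes add up. *)
Lemma tree_gfS (g : forall h, rtree K h -> C) h (G : forall k : 'I_K.+1, {ffun 'I_k -> rtree K h} -> C) :
  (forall (k : 'I_K.+1) (f : {ffun 'I_k -> rtree K h}),
     g h.+1 (Tagged (fun k : 'I_K.+1 => {ffun 'I_k -> rtree K h}) f) = G k f) ->
  tree_gf g h.+1 = 'X * \sum_(k < K.+1) (p k)%:C *:
    \sum_(f : {ffun 'I_k -> rtree K h}) (\prod_i toC (tree_monomial (f i))) * (G k f)%:P.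
Proof.
move=> hG; rewrite /tree_gf sum_rtreeS mulr_sumr; apply: eq_bigr => k _.
rewrite scaler_sumr mulr_sumr; apply: eq_bigr => f _.
rewrite tree_monomialS hG /= map_polyZ rmorphM /= map_polyX rmorph_prod.
by rewrite -!mul_polyC; ring.
Qed.

Lemma sum_tree_monomial h : \sum_(t : rtree K h) toC (tree_monomial t) = toC (tree_series Phi h).
Proof.
elim: h => [|h IHh].
  by rewrite big1 ?rmorph0 // => -[].
pose g h (t : rtree K h) : C := 1.
transitivity (tree_gf g h.+1); first by apply: eq_bigr => t _; rewrite mulr1.
rewrite (tree_gfS (G := fun _ _ => 1)) // [tree_series _ _]/= rmorphM /= map_polyX map_comp_poly.
congr (_ * _); rewrite comp_pgf0 -IHh; apply: eq_bigr => k _; congr (_ *: _).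
by rewrite -sum_forest; apply: eq_bigr => f _; rewrite mulr1.
Qed.

Let Y h := toC (tree_series Phi h).
Let F h := slope_series (toC Phi) (Y h) 1.
Let W h := slope_series (toC Phi) (Y h) 2.

Lemma sum_forest_const h (k : nat) :
  \sum_(f : {ffun 'I_k -> rtree K h}) \prod_i toC (tree_monomial (f i)) = Y h ^+ k.
Proof. by rewrite (sum_forest k (fun t => toC (tree_monomial t))) sum_tree_monomial. Qed.

Lemma tree_series_step h : Y h.+1 = 'X * \sum_(k < K.+1) (p k)%:C *: Y h ^+ k.
Proof. by rewrite /Y [tree_series _ _]/= rmorphM /= map_polyX map_comp_poly comp_pgf0. Qed.

Definition depth_gf x := tree_gf (fun h (t : rtree K h) => depth_sum x t).
Definition lca_gf x y := tree_gf (fun h (t : rtree K h) => lca_sum x y t).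

Lemma polyC_sumr (I : Type) (r : seq I) (D : pred I) (G : I -> C) :
  (\sum_(i <- r | D i) G i)%:P = \sum_(i <- r | D i) (G i)%:P.
Proof. exact: (raddf_sum (@polyC C)). Qed.

Lemma forest_linear_gf h (k : nat) (g : forall h, rtree K h -> C) :
  \sum_(f : {ffun 'I_k -> rtree K h}) (\prod_i toC (tree_monomial (f i))) * \sum_i (g h (f i))%:P
  = k%:R * Y h ^+ k.-1 * tree_gf g h.
Proof.
rewrite (sum_forest_linear k (fun t => toC (tree_monomial t)) (fun t => (g h t)%:P)).
by rewrite sum_tree_monomial mulrA.
Qed.

Lemma slope1_sum h : F h = 'X * \sum_(k < K.+1) (p k)%:C *: (k%:R * Y h ^+ k.-1).
Proof. by rewrite /F /slope_series comp_pgf1. Qed.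

Lemma slope2_sum h : W h = 'X * \sum_(k < K.+1) (p k)%:C *: ((k * k.-1)%:R * Y h ^+ k.-2).
Proof. by rewrite /W /slope_series comp_pgf2. Qed.

Lemma depth_gfS x h : depth_gf x h.+1 = Y h.+1 + x *: (F h * depth_gf x h).
Proof.
rewrite [LHS]/depth_gf (tree_gfS (G := fun k f => 1 + x * \sum_i depth_sum x (f i))); last first.
  by move=> k f; rewrite depth_sumS.
rewrite tree_series_step slope1_sum.
transitivity ('X * (\sum_(k < K.+1) (p k)%:C *: Y h ^+ k +
    x *: ((\sum_(k < K.+1) (p k)%:C *: (k%:R * Y h ^+ k.-1)) * depth_gf x h))); last first.
  move: (\sum_(k < K.+1) (p k)%:C *: Y h ^+ k) => S1.
  move: (\sum_(k < K.+1) (p k)%:C *: (k%:R * Y h ^+ k.-1)) (depth_gf x h) => S2 S3.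
  by rewrite -!mul_polyC; ring.
congr (_ * _); rewrite mulr_suml scaler_sumr -big_split /=; apply: eq_bigr => k _.
transitivity ((p k)%:C *: (Y h ^+ k + x *: (k%:R * Y h ^+ k.-1 * depth_gf x h))); last first.
  by rewrite -!mul_polyC; ring.
congr (_ *: _).
rewrite -forest_linear_gf -sum_forest_const scaler_sumr -big_split /=; apply: eq_bigr => f _.
by rewrite polyCD polyCM polyC_sumr -mul_polyC; ring.
Qed.

(** Of two vertices in the subtrees of different children, one may choose the ordered
    pair of children in [k (k - 1)] ways, which produces the second derivative of
    [Phi]; a single marked child produces the first. *)
Lemma lca_gfS x y h : lca_gf x y h.+1 = F h * lca_gf x y h +
  (Y h.+1 + (x *: (F h * depth_gf x h) + y *: (F h * depth_gf y h) +
   (x * y) *: (W h * (depth_gf x h * depth_gf y h)))).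
Proof.
rewrite [LHS]/lca_gf (tree_gfS (G := fun k f => \sum_i lca_sum x y (f i) +
    (1 + (x * \sum_i depth_sum x (f i) + y * \sum_i depth_sum y (f i) +
     (x * y) * \sum_i \sum_(j | j != i) depth_sum x (f i) * depth_sum y (f j))))); last first.
  by move=> k f; rewrite lca_sumS.
rewrite tree_series_step slope1_sum slope2_sum.
have [dx dxE] : {d | d = depth_gf x h} by exists (depth_gf x h).
have [dy dyE] : {d | d = depth_gf y h} by exists (depth_gf y h).
have [dl dlE] : {d | d = lca_gf x y h} by exists (lca_gf x y h).
rewrite -dxE -dyE -dlE.
transitivity ('X * ((\sum_(k < K.+1) (p k)%:C *: (k%:R * Y h ^+ k.-1)) * dl +
  (\sum_(k < K.+1) (p k)%:C *: Y h ^+ k +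
   (x *: ((\sum_(k < K.+1) (p k)%:C *: (k%:R * Y h ^+ k.-1)) * dx) +
    y *: ((\sum_(k < K.+1) (p k)%:C *: (k%:R * Y h ^+ k.-1)) * dy) +
    (x * y) *: ((\sum_(k < K.+1) (p k)%:C *: ((k * k.-1)%:R * Y h ^+ k.-2)) * (dx * dy)))))); last first.
  move: (\sum_(k < K.+1) (p k)%:C *: Y h ^+ k) => S1.
  move: (\sum_(k < K.+1) (p k)%:C *: (k%:R * Y h ^+ k.-1)) => S2.
  move: (\sum_(k < K.+1) (p k)%:C *: ((k * k.-1)%:R * Y h ^+ k.-2)) => S3.
  by rewrite -!mul_polyC; ring.
congr (_ * _); rewrite !mulr_suml !scaler_sumr -!big_split /=; apply: eq_bigr => k _.
rewrite dxE dyE dlE {dx dxE dy dyE dl dlE}.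
have bil : \sum_(f : {ffun 'I_k -> rtree K h}) (\prod_i toC (tree_monomial (f i))) *
    (\sum_i \sum_(j | j != i) (depth_sum x (f i))%:P * (depth_sum y (f j))%:P) =
   (k * k.-1)%:R * Y h ^+ k.-2 * (depth_gf x h * depth_gf y h).
  rewrite (sum_forest_bilinear k (fun t => toC (tree_monomial t)) (fun t => (depth_sum x t)%:P)
     (fun t => (depth_sum y t)%:P)).
  by rewrite sum_tree_monomial mulrA.
set Q1 := k%:R * Y h ^+ k.-1; set Q2 := (k * k.-1)%:R * Y h ^+ k.-2.
transitivity ((p k)%:C *: (Q1 * lca_gf x y h + (Y h ^+ k + (x *: (Q1 * depth_gf x h) +
   y *: (Q1 * depth_gf y h) + (x * y) *: (Q2 * (depth_gf x h * depth_gf y h)))))); last first.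
  by rewrite -!mul_polyC; ring.
congr (_ *: _); rewrite /Q1 /Q2 -bil -!forest_linear_gf -sum_forest_const.
rewrite !scaler_sumr -!big_split /=; apply: eq_bigr => f _.
have e : (\sum_i \sum_(j | j != i) depth_sum x (f i) * depth_sum y (f j))%:P =
   \sum_i \sum_(j | j != i) (depth_sum x (f i))%:P * (depth_sum y (f j))%:P.
  rewrite polyC_sumr; apply: eq_bigr => i _; rewrite polyC_sumr; apply: eq_bigr => j _.
  by rewrite polyCM.
by rewrite !polyCD !polyCM e !polyC_sumr -!mul_polyC polyCM; ring.
Qed.

Lemma cong_mulX (n : nat) (P P' : {poly C}) : cong_poly n P P' -> cong_poly n.+1 ('X * P) ('X * P').
Proof. by move=> hP [|i] hi; rewrite !coefXM //=; apply: hP. Qed.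

Lemma cong_Y n h : (n <= h)%N -> cong_poly n (Y h) (Y h.+1).
Proof.
move=> nh i hi; rewrite !coef_map; congr (_ %:C); apply: coef_tree_series_stable.
  exact: leq_trans nh.
by rewrite (leq_trans hi) // leqW.
Qed.

Lemma cong_X_slope n h j (P P' : {poly C}) : (n <= h)%N -> cong_poly n P P' ->
  cong_poly n.+1 (slope_series (toC Phi) (Y h) j * P) (slope_series (toC Phi) (Y h.+1) j * P').
Proof.
move=> nh hP; rewrite /slope_series -!mulrA; apply: cong_mulX.
by apply: congM => //; apply: cong_comp_poly; exact: cong_Y.
Qed.

Lemma tree_gf0 g : tree_gf g 0 = 0.
Proof. by rewrite /tree_gf big1 // => -[]. Qed.

Lemma coef0_slope h j (P : {poly C}) : (slope_series (toC Phi) (Y h) j * P)`_0 = 0.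
Proof. by rewrite /slope_series -mulrA coefXM. Qed.

Lemma coef0_tree_series h : (Y h)`_0 = 0.
Proof. by rewrite coef_map tree_series_0. Qed.

Lemma coef0_depth_gf x h : (depth_gf x h)`_0 = 0.
Proof.
case: h => [|h]; first by rewrite /depth_gf tree_gf0 coef0.
by rewrite depth_gfS coefD coefZ coef0_slope coef0_tree_series mulr0 addr0.
Qed.

Lemma coef0_lca_gf x y h : (lca_gf x y h)`_0 = 0.
Proof.
case: h => [|h]; first by rewrite /lca_gf tree_gf0 coef0.
by rewrite lca_gfS !coefD !coefZ !coef0_slope coef0_tree_series !mulr0 !addr0.
Qed.

(** Trees with at most [n] vertices have height less than [h] as soon as [n <= h]. In
    terms of the recursion: each step begins with a factor ['X]. *)
Lemma cong_depth_gf x n h : (n <= h)%N -> cong_poly n (depth_gf x h) (depth_gf x h.+1).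
Proof.
elim: n h => [|n IHn] h hn; first by move=> [|//] _; rewrite !coef0_depth_gf.
case: h hn => [//|h] hn.
rewrite [X in cong_poly _ X _]depth_gfS [X in cong_poly _ _ X]depth_gfS.
apply: congD; first exact: cong_Y.
by apply: congZ; apply: cong_X_slope => //; exact: IHn.
Qed.

Lemma cong_lca_gf x y n h : (n <= h)%N -> cong_poly n (lca_gf x y h) (lca_gf x y h.+1).
Proof.
elim: n h => [|n IHn] h hn; first by move=> [|//] _; rewrite !coef0_lca_gf.
case: h hn => [//|h] hn.
rewrite [X in cong_poly _ X _]lca_gfS [X in cong_poly _ _ X]lca_gfS.
have hd z := @cong_depth_gf z n h hn.
apply: congD; first by apply: cong_X_slope => //; exact: IHn.
apply: congD; first exact: cong_Y.
apply: congD; first by apply: congD; apply: congZ; apply: cong_X_slope.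
by apply: congZ; apply: cong_X_slope => //; apply: congM.
Qed.

Lemma depth_gf_resolvent x n h : (n <= h)%N ->
  cong_poly n (depth_gf x h * (1 - x *: F h)) (Y h).
Proof.
move=> nh; have e : depth_gf x h * (1 - x *: F h) = depth_gf x h - x *: (F h * depth_gf x h).
  by rewrite -!mul_polyC; ring.
rewrite e; apply: (@cong_trans _ _ (Y h.+1)); last by apply: cong_sym; exact: cong_Y.
move=> i hi; rewrite coefB (cong_depth_gf x nh hi) depth_gfS coefD.
by rewrite addrK.
Qed.

Lemma lca_gf_resolvent x y n h : (n <= h)%N ->
  cong_poly n (lca_gf x y h * (1 - F h))
    (Y h + (x *: (F h * depth_gf x h) + y *: (F h * depth_gf y h) +
     (x * y) *: (W h * (depth_gf x h * depth_gf y h)))).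
Proof.
move=> nh; have e : lca_gf x y h * (1 - F h) = lca_gf x y h - F h * lca_gf x y h by ring.
rewrite e; set T := x *: _ + y *: _ + _.
apply: (@cong_trans _ _ (Y h.+1 + T)); last by apply: congD => //; apply: cong_sym; exact: cong_Y.
by move=> i hi; rewrite coefB (cong_lca_gf x y nh hi) lca_gfS coefD addrC addKr.
Qed.

Lemma sum_tweight n h :
  \sum_(t : rtree K h | size (verts t) == n) tweight p t = (tree_series Phi h)`_n.
Proof.
apply: complexI; rewrite rmorph_sum /= -[RHS]coef_map -sum_tree_monomial coef_sum.
rewrite [LHS]big_mkcond; apply: eq_bigr => t _.
rewrite coef_map coefZ coefXn eq_sym /=.
by case: eqP => _; rewrite ?mulr1 // mulr0.
Qed.

End TreeGeneratingFunctions.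

(** * Plane trees as finite family trees *)

(** [c] prescribes the numbers of children of all potential individuals, born or not;
    only those of the individuals of [t] matter. *)
Fixpoint realizes K h : rtree K h -> (label -> nat) -> bool :=
  match h with
  | 0 => fun _ _ => false
  | h'.+1 => fun t c => (c [::] == tag t) &&
      [forall i : 'I_(tag t), realizes (tagged t i) (fun v => c (nat_of_ord i :: v))]
  end.

Lemma verts_consP K h (t : rtree K h.+1) (i : nat) (v : label) :
  reflect (exists2 j : 'I_(tag t), i = nat_of_ord j & v \in verts (tagged t j)) (i :: v \in verts t).
Proof.
rewrite inE /=; apply: (iffP flattenP) => [[s /mapP[j _ ->] /mapP[u hu [-> ->]]] | [j -> hv]].
  by exists j.
exists [seq (nat_of_ord j) :: v | v <- verts (tagged t j)].
  by apply: map_f; rewrite mem_enum.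
exact: map_f.
Qed.

Lemma verts_root K h (t : rtree K h.+1) : [::] \in verts t.
Proof. by rewrite inE. Qed.

Lemma realizesP K h (t : rtree K h) c : (0 < size (verts t))%N ->
  reflect (forall v, v \in verts t -> c v = tdeg t v) (realizes t c).
Proof.
elim: h t c => [[]//|h IHh] t c _; apply: (iffP andP) => [[/eqP e /forallP H] v | H].
  case: v => [|i v]; first by [].
  case/verts_consP=> j -> hv; rewrite tdeg_child.
  have sj : (0 < size (verts (tagged t j)))%N by case: (verts _) hv.
  by have /(IHh _ _ sj) Hj := H j; exact: Hj.
split; first by apply/eqP/H/verts_root.
apply/forallP => j; apply/IHh.
  by case: (h) (tagged t j) => [[]|].
move=> v hv; rewrite -tdeg_child; apply: H; apply/verts_consP; by exists j.
Qed.

Lemma realizes_inj K h (t t' : rtree K h) c : realizes t c -> realizes t' c -> t = t'.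
Proof.
elim: h t t' c => [[]//|h IHh] [k f] [k' f'] c /= /andP[/eqP e1 H1] /andP[/eqP e2 H2].
have ek : k = k' by apply: val_inj; rewrite /= -e1 -e2.
move: f' H2; rewrite -ek => f' H2; congr Tagged; apply/ffunP => i.
exact: IHh (forallP H1 i) (forallP H2 i).
Qed.

Lemma family_tree_rcons c u i : family_tree c (rcons u i) -> family_tree c u /\ (i < c u)%N.
Proof.
move=> ht; have [v e] : exists v, v = rcons u i by exists (rcons u i).
rewrite -e in ht; case: ht e => [|u' i' hu hi]; first by case: u.
by move/rcons_inj=> [<- <-].
Qed.

Lemma family_tree_child c i v : (i < c [::])%N ->
  family_tree (fun u => c (i :: u)) v -> family_tree c (i :: v).
Proof.
move=> hi; elim => [|u j _ IH hj].
  by rewrite -[[:: i]]/(rcons [::] i); apply: family_child => //; exact: family_root.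
by rewrite -rcons_cons; apply: family_child.
Qed.

Lemma family_tree_cons c i v : family_tree c (i :: v) ->
  (i < c [::])%N /\ family_tree (fun u => c (i :: u)) v.
Proof.
elim/last_ind: v => [|v j IHv].
  by rewrite -[[:: i]]/(rcons [::] i) => /family_tree_rcons[_ h]; split => //; exact: family_root.
by rewrite -rcons_cons => /family_tree_rcons[/IHv[h1 h2] h3]; split => //; apply: family_child.
Qed.

Lemma realizes_family K h (t : rtree K h) c : realizes t c ->
  forall v, family_tree c v <-> v \in verts t.
Proof.
elim: h t c => [[]//|h IHh] t c /andP[/eqP e /forallP H] v; split.
  case: v => [|i v]; first by rewrite verts_root.
  move=> /family_tree_cons[hi hv]; apply/verts_consP.
  rewrite e in hi; exists (Ordinal hi) => //.
  exact/(IHh _ _ (H (Ordinal hi))).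
case: v => [_|i v]; first exact: family_root.
case/verts_consP => j -> hv; apply: family_tree_child; first by rewrite e.
exact/(IHh _ _ (H j)).
Qed.

Lemma uniq_verts K h (t : rtree K h) : uniq (verts t).
Proof.
elim: h t => [[]//|h IHh] t /=; apply/andP; split.
  by apply/negP => /flattenP[s /mapP[i _ ->] /mapP[u _ //]].
apply: (allpairs_uniq_dep (f := fun (i : 'I_(tag t)) (v : label) => nat_of_ord i :: v)).
- exact: enum_uniq.
- by move=> i _; exact: IHh.
- by move=> [i v] [j w] _ _ /= [/val_inj -> ->].
Qed.

Lemma size_verts_gt0 K h (t : rtree K h) : (0 < size (verts t))%N.
Proof. by case: h t => [[]|]. Qed.

Lemma exists_realizes K h c :
  (forall v, family_tree c v -> (size v < h)%N /\ (c v <= K)%N) ->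
  exists t : rtree K h, realizes t c.
Proof.
elim: h c => [|h IHh] c H.
  by have [] := H _ (family_root c).
have [_ cK] := H _ (family_root c).
have kP : (c [::] < K.+1)%N by rewrite ltnS.
pose k := Ordinal kP.
have Hi (i : 'I_k) : exists t : rtree K h, realizes t (fun v => c (nat_of_ord i :: v)).
  apply: IHh => v hv; have := H (nat_of_ord i :: v) (family_tree_child (ltn_ord i) hv).
  by rewrite /= ltnS.
have [f hf] := choice Hi.
exists (Tagged (fun k : 'I_K.+1 => {ffun 'I_k -> rtree K h}) (finfun f)) => /=.
by rewrite eqxx /=; apply/forallP => i; rewrite ffunE.
Qed.

Lemma tree_edge_size (t : set label) u v : tree_edge t u v -> (size u <= (size v).+1)%N.
Proof. by move/asboolP => [_ _ [i [->|->]]]; rewrite size_rcons //; lia. Qed.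

Lemma tree_path_size (t : set label) u q : path (tree_edge t) u q ->
  (size u <= size (last u q) + size q)%N.
Proof.
elim: q u => [|v q IHq] u /=; first by rewrite addn0.
by move=> /andP[/tree_edge_size h1 /IHq h2]; lia.
Qed.

(** Walking up from [v] reaches [u] in [size v - size u] steps, and no step decreases
    the length of a label by more than 1. *)
Lemma tree_dist_ancestor (t : set label) u v :
  (forall w i, t (rcons w i) -> t w) -> t v -> prefix u v ->
  tree_dist t v u = (size v - size u)%N.
Proof.
move=> tP tv /prefixP[s ev]; rewrite {}ev in tv *.
have hw : walk (tree_edge t) (u ++ s) u (size s).
  elim/last_ind: s tv => [|s i IHs] tv.
    by exists [::]; rewrite ?cats0.
  rewrite -rcons_cat in tv *; have [q h1 [h2 h3]] := IHs (tP _ _ tv).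
  exists ((u ++ s) :: q) => /=; last by rewrite size_rcons h3.
  rewrite h1 andbT; apply/asboolP; split => //; first exact: tP tv.
  by exists i; right.
have hmin j : walk (tree_edge t) (u ++ s) u j -> (size s <= j)%N.
  by move=> [q /tree_path_size h1 [h2 h3]]; move: h1; rewrite h2 h3 size_cat leq_add2l.
rewrite size_cat addKn /tree_dist /graph_dist; apply: xget_unique => //.
by move=> j [h1 h2]; apply/eqP; rewrite eqn_leq hmin // h2.
Qed.

Lemma lca_prefixl v w : prefix (lca v w) v.
Proof. by have := prefix_lca (lca v w) v w; rewrite prefix_refl => /esym/andP[]. Qed.

Lemma lca_prefixr v w : prefix (lca v w) w.
Proof. by have := prefix_lca (lca v w) v w; rewrite prefix_refl => /esym/andP[]. Qed.

Lemma pair_sum_realizes (R : realType) K h (t : rtree K h) c (x y : R[i]) :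
  realizes t c -> pair_sum (family_tree c) x y = lca_sum x y t.
Proof.
move=> ht; have hm := realizes_family ht.
have eT : family_tree c = [set` verts t].
  by apply/seteqP; split => v /=; have [h1 h2] := hm v.
have pr w i : family_tree c (rcons w i) -> family_tree c w by move=> /family_tree_rcons[].
rewrite /pair_sum.
pose s := [seq (v, w) | v <- verts t, w <- verts t].
have eS : family_tree c `*` family_tree c = [set` s].
  rewrite eT; apply/seteqP; split => -[v w] /=.
    by move=> [/= hv hw]; apply/allpairsP; exists (v, w).
  by move=> /allpairsP[[v' w'] [/= hv hw [-> ->]]].
have us : uniq s.
  by apply: allpairs_uniq; rewrite ?uniq_verts // => -[? ?] [? ?].
rewrite eS -fsbig_seq // /s big_allpairs /lca_sum.
apply: eq_big_seq => v hv; apply: eq_big_seq => w hw /=.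
have tv : family_tree c v by apply/hm.
have tw : family_tree c w by apply/hm.
by rewrite !(tree_dist_ancestor pr) ?lca_prefixl ?lca_prefixr.
Qed.

Lemma family_tree_prefix c v m : family_tree c v -> family_tree c (take m v).
Proof.
elim/last_ind: v => [//|v i IHv] hv; have [hv' _] := family_tree_rcons hv.
case: (leqP m (size v)) => hm.
  by rewrite -cats1 takel_cat //; exact: IHv.
by rewrite take_oversize // size_rcons.
Qed.

(** In a family of [n] members, an individual of generation [g] has [g] proper
    ancestors and one with [k] children has these [k], so that [g < n] and [k < n]. *)
Lemma family_card_realizes K c n h : (n <= h)%N -> (n <= K)%N ->
  (family_tree c #= `I_n)%card <->
  exists2 t : rtree K h, size (verts t) = n & realizes t c.
Proof.
move=> nh nK.
have card_t (t : rtree K h) : realizes t c -> (family_tree c #= `I_(size (verts t)))%card.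
  move=> ht; have -> : family_tree c = [set` [fset v in verts t]%fset].
    apply/seteqP; split => v /=; rewrite inE;
    by have [h1 h2] := realizes_family ht v.
  by apply/card_eq_fsetP; rewrite card_fseq undup_id // uniq_verts.
split => [hn | [t <- ht]]; last exact: card_t.
have fin : finite_set (family_tree c) by apply/finite_setP; exists n.
have small (l : seq label) : uniq l -> (forall v, v \in l -> family_tree c v) -> (size l <= n)%N.
  move=> ul hl; rewrite -(card_fset_set hn); apply: uniq_leq_size => // v hv.
  by rewrite (in_fset_set fin); apply/mem_set/hl.
have bound v : family_tree c v -> (size v < h)%N /\ (c v <= K)%N.
  move=> hv; split.
    apply: leq_trans nh; have := small [seq take i v | i <- iota 0 (size v).+1].
    rewrite size_map size_iota; apply.
      rewrite map_inj_in_uniq ?iota_uniq // => i j.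
      rewrite !mem_iota /= !add0n !ltnS => hi hj /(congr1 size).
      by rewrite !size_takel.
    by move=> u /mapP[i _ ->]; exact: family_tree_prefix.
  apply: leq_trans nK; have := small (v :: [seq rcons v i | i <- iota 0 (c v)]).
  rewrite /= size_map size_iota => hs; apply/ltnW; apply: hs.
    apply/andP; split.
      by apply/negP => /mapP[i _ /(congr1 size)]; rewrite size_rcons; lia.
    by rewrite map_inj_uniq ?iota_uniq // => i j /rcons_inj[].
  move=> u; rewrite inE => /predU1P[->//|] /mapP[i hi ->].
  by move: hi; rewrite mem_iota => /andP[_ hi]; apply: family_child.
have [t ht] := exists_realizes bound; exists t => //.
exact/card_eq_II/(card_eq_trans (card_esym (card_t t ht)) hn).
Qed.

(** * Integrals of functions with finitely many values *)

Lemma measurable_fun_pieces d (T : measurableType d) (R : realType) (I : eqType) (F : I -> set T)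
    (f : T -> R) (z : I -> R) (s : seq I) :
  (forall i, measurable (F i)) -> (forall i w, F i w -> f w = z i) ->
  measurable_fun (\big[setU/set0]_(i <- s) F i) f.
Proof.
move=> mF fz; elim: s => [|i s IHs]; first by rewrite big_nil; exact: measurable_fun_set0.
rewrite big_cons measurable_funU //; last exact: bigsetU_measurable.
split => //; apply: (eq_measurable_fun (cst (z i))); last exact: measurable_cst.
by move=> w; rewrite inE => /fz.
Qed.

Lemma integral_pieces d (T : measurableType d) (R : realType) (P : probability T R) (I : eqType)
    (F : I -> set T) (f : T -> R) (z : I -> R) (s : seq I) :
  (forall i, measurable (F i)) -> uniq s -> trivIset setT F ->
  (forall i w, F i w -> f w = z i) ->
  (\int[P]_(w in \big[setU/set0]_(i <- s) F i) (f w)%:E = (\sum_(i <- s) z i * fine (P (F i)))%:E)%E.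
Proof.
move=> mF us tF fz; rewrite integral_bigsetU_EFin //; last 2 first.
- exact: sub_trivIset tF.
- by apply/measurable_EFinP; apply: measurable_fun_pieces mF fz.
have e i : (\int[P]_(w in F i) (f w)%:E)%E = (z i * fine (P (F i)))%:E.
  rewrite (eq_integral (cst (z i)%:E)); last by move=> w; rewrite inE => /fz ->.
  by rewrite integral_cst // EFinM fineK // fin_num_measure.
by under eq_bigr do rewrite e; rewrite sumEFin.
Qed.

(** * The law of the family tree *)

Section FamilyTreeLaw.
Variables (R : realType) (mu : probability nat R).
Let p (k : nat) : R := fine (mu [set k]).
Variables (d : measure_display) (Omega : measurableType d) (P : probability Omega R).
Variable X : label -> {RV P >-> nat}.
Hypothesis iid : iid_with_law P mu X.
Variables K n : nat.
Hypothesis nK : (n <= K)%N.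

Definition realization (t : rtree K n) : set Omega := [set w | realizes t (fun u => X u w)].

Lemma realizationE (t : rtree K n) :
  realization t = \bigcap_(u in [set` verts t]) (X u @^-1` [set tdeg t u]).
Proof.
apply/seteqP; split => w /=.
  by move=> /(realizesP _ (size_verts_gt0 t)) h u /h.
by move=> h; apply/(realizesP _ (size_verts_gt0 t)) => u /h.
Qed.

Lemma measurable_realization (t : rtree K n) : measurable (realization t).
Proof.
rewrite realizationE; apply: fin_bigcap_measurable => [|u _]; first exact: finite_seq.
exact: measurable_funPTI.
Qed.

Lemma realization_prob (t : rtree K n) : P (realization t) = (tweight p t)%:E.
Proof.
have [ind law] := iid.
rewrite realizationE ind ?uniq_verts // tweightE.
rewrite (big_morph EFin (fun a b => EFinM a b) (erefl 1%:E)).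
apply: eq_bigr => u _; rewrite -[LHS]/(distribution P (X u) [set tdeg t u]) law.
by rewrite /p fineK // fin_num_measure.
Qed.

Lemma trivIset_realization : trivIset setT realization.
Proof.
apply/trivIsetP => t t' _ _; apply: contraNeq => /set0P[w [/= h1 h2]].
by apply/eqP; exact: realizes_inj h1 h2.
Qed.

Let trees := [seq t <- enum {: rtree K n} | size (verts t) == n].

Lemma gw_size_is_bigU : gw_size_is P X n = \big[setU/set0]_(t <- trees) realization t.
Proof.
apply/seteqP; split => w /=.
  move=> /(family_card_realizes _ (leqnn n) nK)[t st ht].
  rewrite -bigcup_seq; exists t => //=.
  by rewrite mem_filter st eqxx mem_enum.
rewrite -bigcup_seq => -[t]; rewrite /= mem_filter => /andP[/eqP st _] ht.
by apply/(family_card_realizes _ (leqnn n) nK); exists t.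
Qed.

Let uniq_trees : uniq trees. Proof. by rewrite filter_uniq // enum_uniq. Qed.

Lemma Rintegral_gw_size (f : Omega -> R) (z : rtree K n -> R) :
  (forall t w, realizes t (fun u => X u w) -> f w = z t) ->
  \int[P]_(w in gw_size_is P X n) f w =
  \sum_(t : rtree K n | size (verts t) == n) z t * tweight p t.
Proof.
move=> fz; rewrite /Rintegral gw_size_is_bigU (integral_pieces _ measurable_realization _ trivIset_realization fz) //=.
rewrite big_filter /= big_enum_cond /=.
by apply: eq_bigr => t _; rewrite realization_prob.
Qed.

Lemma gw_size_prob : P (gw_size_is P X n) = ((tree_series (trunc_pgf p K) n)`_n)%:E.
Proof.
have mA : measurable (gw_size_is P X n).
  by rewrite gw_size_is_bigU; apply: bigsetU_measurable => t _; exact: measurable_realization.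
rewrite -[LHS]fineK ?fin_num_measure //; congr EFin.
rewrite -[LHS]mul1r -Rintegral_cst // (@Rintegral_gw_size _ (fun=> 1)) // -sum_tweight.
by apply: eq_bigr => t _; rewrite mul1r.
Qed.

(** The event of size [n] splits into the realizations of the finitely many trees
    with [n] vertices, on each of which the sum over pairs is constant. *)
Lemma h_eq_coef_ratio (x y : R[i]) :
  h P X n x y = (lca_gf p K x y n)`_n / ((tree_series (trunc_pgf p K) n)`_n)%:C.
Proof.
rewrite /h /cond_expectation gw_size_prob coef_tree_gf /=.
set q := (tree_series _ _)`_n.
rewrite (@Rintegral_gw_size _ (fun t => complex.Re (lca_sum x y t))); last first.
  by move=> t w /pair_sum_realizes <-.
rewrite (@Rintegral_gw_size _ (fun t => complex.Im (lca_sum x y t))); last first.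
  by move=> t w /pair_sum_realizes <-.
have -> : \sum_(t : rtree K n | size (verts t) == n) (tweight p t)%:C * lca_sum x y t =
    (\sum_(t : rtree K n | size (verts t) == n) complex.Re (lca_sum x y t) * tweight p t) +i*
    (\sum_(t : rtree K n | size (verts t) == n) complex.Im (lca_sum x y t) * tweight p t).
  apply/eqP; rewrite eq_complex !raddf_sum /=; apply/andP; split; apply/eqP;
  by apply: eq_bigr => t _; rewrite [RHS]mulrC; case: (lca_sum x y t) => a b /=; ring.
by rewrite -fmorphV; apply/eqP; rewrite eq_complex /= !mulr0 subr0 add0r; apply/andP; split; apply/eqP; ring.
Qed.

End FamilyTreeLaw.

(** * Moments of an offspring law *)

Section OffspringMoments.
Variables (R : realType) (mu : probability nat R).
Let p (k : nat) : R := fine (mu [set k]).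

Let I (f : nat -> R) : \bar R := (\int[mu]_k (f k)%:E)%E.

Let measurable_nat_fun (D : set nat) (f : nat -> R) : measurable_fun D (fun k => (f k)%:E).
Proof. by []. Qed.

Let I_le (f g : nat -> R) : (forall k, 0 <= f k <= g k) -> (I f <= I g)%E.
Proof.
by move=> h; apply: ge0_le_integral => // k _; rewrite lee_fin; have /andP[h1 h2] := h k => //.
Qed.

Let I_add (f g : nat -> R) : (forall k, 0 <= f k) -> (forall k, 0 <= g k) ->
  I (fun k => f k + g k) = (I f + I g)%E.
Proof. by move=> hf hg; rewrite /I -ge0_integralD // => k _; rewrite lee_fin. Qed.

Let I_scale (c : R) (f : nat -> R) : 0 <= c -> (forall k, 0 <= f k) -> I (fun k => c * f k) = (c%:E * I f)%E.
Proof.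
move=> c0 hf; rewrite /I -ge0_integralZl_EFin //.
by move=> k _; rewrite lee_fin.
Qed.

Let segment K : set nat := \big[setU/set0]_(k <- iota 0 K.+1) [set k].

Let segmentP K k : segment K k <-> (k < K.+1)%N.
Proof.
rewrite /segment -bigcup_seq; split => [[j hj ->]|hk].
  by move: hj; rewrite /mkset mem_iota => /andP[].
by exists k => //; rewrite /mkset mem_iota.
Qed.

Let I_segment f K : (\int[mu]_(k in segment K) (f k)%:E = (\sum_(k < K.+1) f k * p k)%:E)%E.
Proof.
rewrite (@integral_pieces _ _ _ mu _ (fun k => [set k]) f f) ?iota_uniq //.
- by rewrite -(big_mkord xpredT (fun k => f k * p k)) /index_iota subn0.
- by apply/trivIsetP => i j _ _; apply: contraNeq => /set0P[k [/= -> ->]].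
- by move=> i k ->.
Qed.

Lemma partial_sum_le (f : nat -> R) K : (forall k, 0 <= f k) -> ((\sum_(k < K.+1) f k * p k)%:E <= I f)%E.
Proof.
move=> f0; rewrite -I_segment; apply: ge0_subset_integral => //.
by move=> k _; rewrite lee_fin.
Qed.

Lemma partial_sum_ge (f g : nat -> R) K : (forall k, 0 <= f k) -> (forall k, 0 <= g k) ->
  (forall k, (K < k)%N -> f k <= g k) ->
  (I f <= (\sum_(k < K.+1) f k * p k)%:E + I g)%E.
Proof.
move=> f0 g0 fg; rewrite -I_segment {1}/I -(setUv (segment K)) ge0_integral_setU //; last 2 first.
- by move=> k _; rewrite lee_fin.
- exact/disj_setPCl.
apply: leeD => //; apply: (@le_trans _ _ (\int[mu]_(k in ~` segment K) (g k)%:E)%E).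
  apply: ge0_le_integral => // k hk; rewrite lee_fin //; apply: fg.
  by rewrite ltnNge; apply/negP => h; apply: hk; apply/segmentP.
by apply: ge0_subset_integral => // k _; rewrite lee_fin.
Qed.

Hypothesis mean1 : I (fun k : nat => k%:R : R) = 1%E.
Hypothesis var_gt0 : (0 < I (fun k : nat => (k%:R - 1) ^+ 2)%R)%E.
Hypothesis var_fin : (I (fun k : nat => (k%:R - 1) ^+ 2)%R < +oo)%E.

Let I1 : I (fun=> 1) = 1%E.
Proof. by rewrite /I integral_cst // mul1e; exact: probability_setT. Qed.

Lemma second_moment_fin : exists2 m2 : R, 0 <= m2 & (I (fun k : nat => k%:R ^+ 2)%R <= m2%:E)%E.
Proof.
have I0 f : (forall k, 0 <= f k) -> (0 <= I f)%E.
  by move=> f0; apply: integral_ge0 => k _; rewrite lee_fin.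
pose V := fine (I (fun k => (k%:R - 1) ^+ 2)).
have eV : I (fun k => (k%:R - 1) ^+ 2) = V%:E.
  by rewrite /V fineK // ge0_fin_numE // ltW.
exists (2 * V + 2).
  have : 0 <= V by rewrite -lee_fin -eV ltW.
  by move=> h; lra.
have -> : ((2 * V + 2)%R%:E = I (fun k : nat => 2 * (k%:R - 1) ^+ 2 + 2 * 1)%R)%E.
  rewrite I_add; last 2 first.
  - by move=> k; rewrite mulr_ge0 // sqr_ge0.
  - by move=> k; rewrite mulr1.
  rewrite !I_scale // ?I1 ?eV; last by move=> k; rewrite sqr_ge0.
  by rewrite -!EFinM -EFinD mulr1.
by apply: I_le => k; rewrite sqr_ge0 /=; have := sqr_ge0 (k%:R - 2 : R); nra.
Qed.

(** As the mean is 1, [E|k - 1| = 2 p 0]. If this vanished, the variance would too. *)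
Lemma p0_gt0 : 0 < p 0%N.
Proof.
have p_ge0 k : 0 <= p k by rewrite fine_ge0.
rewrite lt_def p_ge0 andbT; apply/negP => /eqP p00.
have e : I (fun k => `|k%:R - 1|) = 0%E.
  have h : (I (fun k : nat => `|k%:R - 1| + 1)%R = I (fun k : nat => k%:R + 2 * (k == 0%N)%:R)%R)%E.
    congr I; apply/funext => -[|k] /=.
      by rewrite sub0r normrN normr1; lra.
    by rewrite -natr1 addrK normr_nat mulr0 addr0.
  rewrite I_add // I_add // I_scale // I1 mean1 in h.
  have z : I (fun k => (k == 0%N)%:R) = 0%E.
    apply/eqP; rewrite eq_le; apply/andP; split; last first.
      by apply: integral_ge0 => k _; rewrite lee_fin.
    have := @partial_sum_ge (fun k => (k == 0%N)%:R) (fun=> 0) 0%N.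
    rewrite /I integral0 adde0 big_ord_recl big_ord0 /= p00 mulr0 addr0; apply => //.
    by move=> [].
  move: h; rewrite z mule0 adde0.
  case: (I _) => [r||] //= [] /eqP; rewrite -subr_eq0 addrK => /eqP ->.
  by [].
have ae : ae_eq mu setT (fun k : nat => (k%:R - 1 : R)%:E) (cst 0%E).
  by apply/ae_eq_integral_abs => //; rewrite -[RHS]e; apply: eq_integral.
have : I (fun k => (k%:R - 1) ^+ 2) = 0%E.
  rewrite /I (@ae_eq_integral _ _ _ _ _ (cst 0%E)) ?integral0 //.
  by apply: filterS ae => k h _; have /= [->] := h Logic.I; rewrite expr0n.
by move=> z; move: var_gt0; rewrite z ltxx.
Qed.

(** The truncation bounds are Markov inequalities for [k^2]. *)
Lemma critical_law_of_moments : exists m2, critical_law p m2.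
Proof.
have [m2 m20 hm2] := second_moment_fin.
have p_ge0 k : 0 <= p k by rewrite fine_ge0.
have tail (f : nat -> R) a (K : nat) : (forall k, 0 <= f k) -> I f = 1%E -> (0 < K)%N -> 0 <= a ->
    (forall k : nat, (K < k)%N -> f k <= a * k%:R ^+ 2) -> 1 - a * m2 <= \sum_(k < K.+1) f k * p k <= 1.
  move=> f0 fI K0 a0 fa; apply/andP; split; last by rewrite -lee_fin -fI; exact: partial_sum_le.
  rewrite lerBlDr -lee_fin EFinD -fI EFinM.
  apply: le_trans (partial_sum_ge (g := fun k => a * k%:R ^+ 2) _ _ fa) _ => //.
    by move=> k; rewrite mulr_ge0 // sqr_ge0.
  by rewrite leeD2l // I_scale ?lee_wpmul2l // => k; rewrite sqr_ge0.
have meanK (K : nat) : (0 < K)%N -> 1 - m2 / K%:R <= \sum_(k < K.+1) k%:R * p k <= 1.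
  move=> K0; rewrite mulrC; apply: tail => // k Kk.
  by rewrite expr2 mulrA ler_peMl // ler_pdivlMl ?ltr0n // mulr1 ler_nat ltnW.
exists m2; split => //.
- exact: p0_gt0.
- have [K hK] : exists K : nat, m2 < K%:R.
    by exists (Num.Def.truncn m2).+1; rewrite truncnS_gt.
  have K0 : (0 < K)%N by rewrite -(ltr0n R); exact: le_lt_trans hK.
  apply: contrapT => hn; have /andP[+ _] := meanK K K0.
  rewrite big1 => [|k _]; last first.
    have [->|k0] := posnP k; first by rewrite mul0r.
    have [->|pk] := eqVneq (p k) 0; first by rewrite mulr0.
    by case: hn; exists k => //; rewrite lt_def pk p_ge0.
  by apply/negP; rewrite -ltNge subr_gt0 ltr_pdivrMr ?ltr0n // mul1r.
- move=> K K0; under eq_bigr do rewrite -[p _]mul1r.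
  rewrite mulrC; apply: (tail (fun=> 1)) => // k Kk.
  rewrite -exprVn -exprMn -[leLHS](expr1n _ 2) lerXn2r ?nnegrE //.
  by rewrite ler_pdivlMl ?ltr0n // mulr1 ler_nat ltnW.
- by move=> K; rewrite -lee_fin; apply: le_trans hm2; apply: partial_sum_le => k; rewrite sqr_ge0.
Qed.

End OffspringMoments.

Lemma critical_law_of_variance (R : realType) (mu : probability nat R) :
  ('E_mu[fun k : nat => k%:R : R] = 1)%E ->
  (0 < 'V_mu[fun k : nat => k%:R : R])%E ->
  ('V_mu[fun k : nat => k%:R : R] < +oo)%E ->
  exists m2, critical_law (fun k => fine (mu [set k])) m2.
Proof.
move=> m1; rewrite /variance unlock m1 /= unlock => v0 vfin.
by apply: critical_law_of_moments => //; rewrite -m1 unlock.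
Qed.

(** * The domain of the parameters *)

(** Let [w = x - 1]. For [beta] small, [Re w <= tau |w|] with a small [tau], and
    [|x|^2 = 1 + 2 Re w + |w|^2] shows that [|x| - 1] is at most [e |w|] as long as
    [|w| <= e]. For larger [|w|], it suffices that [|x| < 1 + e^2]. *)
Lemma Delta_tangential (R : realType) (kappa : R) : 1 <= kappa ->
  exists beta delta : R, [/\ 0 < beta < pi / 2, 0 < delta &
    forall x : R[i], Delta beta delta x -> tangential kappa x].
Proof.
move=> k1; pose e := (4 * kappa)^-1; pose tau := e / 2.
have e0 : 0 < e by rewrite invr_gt0 mulr_gt0 // (lt_le_trans ltr01).
have e1 : e <= 1 / 4.
  by rewrite /e invfM mulrC ler_wpM2r // ?invr_ge0 // invf_le1 // (lt_le_trans ltr01).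
have t0 : 0 < tau by rewrite divr_gt0.
have t1 : tau < 1 by rewrite /tau; move: e0 e1; clear -R; lra.
have tb : -1 <= tau <= 1 by move: t0 t1; clear -R; lra.
have at0 : 0 < acos tau by rewrite acos_gt0 // t1 andbT; case/andP: tb.
have atpi : acos tau < pi / 2.
  rewrite -ltr_cos ?in_itv /=; last 2 first.
  - by rewrite ltW //= acos_lepi.
  - by have := pi_gt0 R; clear -R; lra.
  by rewrite cos_pihalf acosK // in_itv.
exists (pi / 2 - acos tau), (e ^+ 2); split.
- by move: at0 atpi; clear -R; lra.
- by rewrite exprn_gt0.
move=> x [xd x1]; rewrite subKr => hx.
have xd' : cabs x < 1 + e ^+ 2 by move: xd; rewrite cabsE ltcR.
pose w := x - 1; pose r := cabs w.
have er : cabs (1 - x) = r by rewrite cabs_subC.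
have r0 : 0 < r by rewrite lt_def cabs_ge0 andbT cabs_eq0 subr_eq0.
have rb : -1 <= complex.Re w / r <= 1.
  rewrite ler_pdivlMr // ler_pdivrMr // mulN1r mul1r Re_le_cabs andbT.
  by rewrite lerNl -raddfN /r -cabsN Re_le_cabs.
have aw : acos tau < acos (complex.Re w / r).
  move: hx; rewrite /carg -/w -/(cabs w) -/r.
  by case: ifP => _; rewrite ?normrN ger0_norm // acos_ge0.
have Rw : complex.Re w <= tau * r.
  rewrite -ler_pdivrMr // leNgt; apply/negP => h.
  move: aw; rewrite -ltr_cos ?in_itv /= ?acos_ge0 ?acos_lepi //.
  by rewrite !acosK ?in_itv //= => /(lt_trans h); rewrite ltxx.
have x2 : cabs x ^+ 2 = 1 + 2 * complex.Re w + r ^+ 2.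
  rewrite /r !cabs_sqr /w; case: (x) => a b /=; rewrite oppr0 addr0; ring.
split=> //.
  have := xd'; have : e ^+ 2 <= 1 / 2 by move: e0 e1; clear -R; nra.
  by clear -R; lra.
rewrite er -/e; have [re|re] := leP r e.
  rewrite -(@ler_pXn2r _ 2) ?nnegrE ?cabs_ge0 ?addr_ge0 ?mulr_ge0 ?(ltW e0) ?(ltW r0) // x2.
  have h1 : 2 * complex.Re w <= e * r by move: Rw; rewrite /tau; clear -R; lra.
  have h2 : r ^+ 2 <= e * r by rewrite expr2 ler_wpM2r // ltW.
  have h3 : 0 <= (e * r) ^+ 2 by rewrite sqr_ge0.
  rewrite sqrrD. rewrite expr1n mul1r mulr2n -!addrA lerD2l lerD //.
  by rewrite -[leLHS]addr0 lerD.
apply: (le_trans (ltW xd')); rewrite lerD2l expr2 ler_wpM2l // ltW //.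
Qed.

(** * Conclusion *)

Lemma min_of_positive (R : realFieldType) (b : nat -> R) n :
  exists2 c, 0 < c & forall m, (m < n)%N -> 0 < b m -> c <= b m.
Proof.
elim: n => [|n [c c0 hc]]; first by exists 1.
have [bn|bn] := ltP 0 (b n).
  exists (Num.min c (b n)); first by rewrite lt_min c0.
  move=> m; rewrite ltnS leq_eqVlt => /predU1P[->|mn] bm; first by rewrite ge_min lexx orbT.
  by rewrite ge_min hc.
exists c => // m; rewrite ltnS leq_eqVlt => /predU1P[->|mn]; last exact: hc.
by rewrite ltNge bn.
Qed.

(** For large [n], Lagrange inversion turns [local_lower_bound] into [q >= c n^(-3/2)];
    finitely many values of [n] remain. *)
Lemma tree_size_lower_bound (R : realType) (p : nat -> R) (m2 : R) : critical_law p m2 ->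
  exists K0 : nat, forall K1, (K0 <= K1)%N -> exists2 c, 0 < c &
    forall n, (0 < n)%N -> let q := (tree_series (trunc_pgf p (n + K1)) n)`_n in
    0 < q -> c <= q * n%:R * Num.sqrt n%:R.
Proof.
move=> cl; have [c [K0 [n1 [c0 hc]]]] := local_lower_bound cl.
exists K0 => K1 K01.
pose q n := (tree_series (trunc_pgf p (n + K1)) n)`_n.
have [c' c'0 hc'] := min_of_positive (fun n => q n * n%:R * Num.sqrt n%:R) n1.
exists (Num.min c c'); first by rewrite lt_min c0.
move=> n n0 /= qn; rewrite -/(q n) in qn *; rewrite ge_min.
have nR : (0 < n%:R :> R) by rewrite ltr0n.
have sn : 0 < Num.sqrt n%:R :> R by rewrite sqrtr_gt0.
have [nn|nn] := ltnP n n1; first by rewrite hc' ?orbT // !mulr_gt0.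
have e := coef_tree_series (trunc_pgf p (n + K1)) n0 (leqnn n).
have := hc n (n + K1)%N nn; rewrite leq_add2l => /(_ K01).
rewrite -e ler_pdivrMr // mulr_gt0 // => /(_ isT); rewrite -/(q n) [n%:R * _]mulrC => ->.
by [].
Qed.

Theorem theorem1p4 (R : realType) (mu : probability nat R)
    (mean1 : ('E_mu[fun k : nat => k%:R : R] = 1)%E)
    (var_gt0 : (0 < 'V_mu[fun k : nat => k%:R : R])%E)
    (var_fin : ('V_mu[fun k : nat => k%:R : R] < +oo)%E) :
  exists C beta delta : R,
    [/\ 0 < C, 0 < beta < pi / 2, 0 < delta &
      forall (d : measure_display) (Omega : measurableType d)
        (P : probability Omega R) (X : label -> {RV P >-> nat}) (n : nat),
        iid_with_law P mu X -> (1 <= n)%N -> (0 < P (gw_size_is P X n))%E ->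
        forall x y : R[i],
          Delta beta delta x -> Delta beta delta y ->
          `|h P X n x y| <= (C * n%:R)%:C * `|1 - x|^-1 * `|1 - y|^-1].
Proof.
have [m2 cl] := critical_law_of_variance mean1 var_gt0 var_fin.
have [A [kappa [Ku [A0 k1 upper]]]] := pair_series_coef_bound cl.
have [Kl lower] := tree_size_lower_bound cl.
have [c c0 {}lower] := lower (Kl + Ku)%N (leq_addr _ _).
have [beta [delta [hbeta delta0 hD]]] := Delta_tangential k1.
exists (A / c), beta, delta; split; [exact: divr_gt0 | exact: hbeta | exact: delta0 |].
move=> d Omega P X n iid n0 Ppos x y /hD tx /hD ty.
set p := (fun k => _) in cl upper lower.
have nK : (n <= n + (Kl + Ku))%N by rewrite leq_addr.
rewrite (h_eq_coef_ratio iid nK); have := gw_size_prob iid nK; rewrite -/p.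
set q := (tree_series _ _)`_n => eq.
have q0 : 0 < q by rewrite -lte_fin -eq.
have hq := lower n n0 q0.
have := upper n (n + (Kl + Ku))%N n x y _ _ _ n0 _ (leqnn n) tx ty
  (depth_gf_resolvent p _ x (leqnn n)) (depth_gf_resolvent p _ y (leqnn n))
  (lca_gf_resolvent p _ x y (leqnn n)).
rewrite leq_add2l leq_addl => /(_ isT).
set H := (lca_gf _ _ _ _ _)`_n => hH.
have cx0 : 0 < cabs (1 - x) by have [+ _ _] := tx; rewrite lt_def cabs_ge0 cabs_eq0 subr_eq0 eq_sym => ->.
have cy0 : 0 < cabs (1 - y) by have [+ _ _] := ty; rewrite lt_def cabs_ge0 cabs_eq0 subr_eq0 eq_sym => ->.
have sn : 0 < Num.sqrt n%:R :> R by rewrite sqrtr_gt0 ltr0n.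
have key : cabs (H / q%:C) <= A / c * n%:R * (cabs (1 - x))^-1 * (cabs (1 - y))^-1.
  rewrite cabsM cabsV cabs_real gtr0_norm // ler_pdivrMr //.
  rewrite -(ler_pM2r sn); apply: (le_trans hH).
  have -> : A / c * n%:R / cabs (1 - x) / cabs (1 - y) * q * Num.sqrt n%:R =
    A / cabs (1 - x) / cabs (1 - y) * ((q * n%:R * Num.sqrt n%:R) / c) by field; rewrite !gt_eqF.
  by rewrite -[leLHS]mulr1 ler_wpM2l ?divr_ge0 ?(ltW A0) ?cabs_ge0 // ler_pdivlMr // mul1r.
rewrite [leLHS]cabsE; move: key; rewrite -lecR => /le_trans; apply.
by rewrite !cabsE -!fmorphV -!rmorphM.
Qed.
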